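(* Consider the linear time-invariant plant $x_{t+1}=Ax_t+B_uu_t+B_ww_t$, $t\ge 0$, with $A$ nonsingular, $(A,B_u)$ stabilizable, $Q\succeq 0$, $R\succ0$ and $(A,Q)$ detectable, and let $P,H,K_v,\hat A$, $J^*_{\infty,nc}$ and $J^*_{\infty,p}$ be as defined in the context. Let $w$ be an IID sequence with $\mathbb{E}[w_i]=0$ and $\mathbb{E}[w_iw_j^\top]=\delta_{ij}I$ for $i,j\in\{0,1,\ldots\}$. The expected per-step cost for the optimal noncausal controller is $$J^*_{\infty,nc}=\mathrm{trace}\big[PB_wB_w^\top\big]-\mathrm{trace}\big[HK_vXK_v^\top\big],$$ where $X$ is the solution to the discrete-time Lyapunov equation $$\hat A^\top X\hat A-X+PB_wB_w^\top P=0 .$$ Moreover, if $J^*_{\infty,p}$ denotes the optimal expected per-step cost achieved by the optimal infinite-horizon controller with $p<\infty$ steps of preview, then $J^*_{\infty,p}\to J^*_{\infty,nc}$ as $p\to\infty$.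
   Context: Here $x_t\in\mathbb{R}^{n_x}$, $u_t\in\mathbb{R}^{n_u}$, $w_t\in\mathbb{R}^{n_w}$; the real matrices $A,B_u,B_w,Q,R$ have compatible dimensions with $Q,R$ symmetric. Under the stated assumptions let $P\succeq 0$ be the unique stabilizing solution of $$0=P-A^\top PA-Q+A^\top PB_uH^{-1}B_u^\top PA,\qquad H:=R+B_u^\top PB_u\succ 0,$$ where stabilizing means that $\hat A:=A-B_uK_x$ is Schur (spectral radius $<1$), with $K_x:=H^{-1}B_u^\top PA$, $K_w:=H^{-1}B_u^\top PB_w$, $K_v:=H^{-1}B_u^\top$. For a sequence of policies $K$, disturbance $w$ and initial condition $x_0$, the average per-step cost is $$J_\infty(K,w,x_0):=\lim_{T\to\infty}\frac1T\sum_{t=0}^{T-1}\big(x_t^\top Qx_t+u_t^\top Ru_t\big).$$ The optimal noncausal controller $K_{nc}$ is $u_t=-K_xx_t-K_ww_t-K_vv^{nc}_{t+1}$ with $v^{nc}_{t+1}=\sum_{j=t+1}^\infty[\hat A^\top]^{j-t}PB_ww_j$. Its expected per-step cost, for stochastic $w$, is $J^*_{\infty,nc}(x_0):=\mathbb{E}[J_\infty(K_{nc},w,x_0)\mid x_0]$; it does not depend on $x_0$ and is written $J^*_{\infty,nc}$. For an integer $p\ge 0$, $J^*_{\infty,p}$ is the minimum of $\mathbb{E}[J_\infty(K,w,x_0)\mid i_0]$ over stabilizing (state uniformly bounded in mean and second moment), possibly randomized, policies $K=\{K_0,K_1,\ldots\}$, with $K_t(u_t,i_t)=\mathrm{Prob}(u_t\mid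 i_t)$ using $i_t=\{x_0,\ldots,x_t,w_0,\ldots,w_{t+p}\}$. It is achieved by $u_t=-K_xx_t-K_ww_t-K_v\sum_{j=t+1}^{t+p}[\hat A^\top]^{j-t}PB_ww_j$, does not depend on $i_0$, and is given by $$J^*_{\infty,p}=\mathrm{trace}\big[PB_wB_w^\top\big]-\mathrm{trace}\Big[\sum_{j=0}^pHK_v(\hat A^\top)^jPB_wB_w^\top P\hat A^jK_v^\top\Big].$$ *)

(* Defs.v *)
From HB Require Import structures.
From mathcomp Require Import all_boot all_order all_algebra.
From mathcomp Require Import complex.
From mathcomp Require Import all_classical all_reals all_analysis.

Set Implicit Arguments.
Unset Strict Implicit.
Unset Printing Implicit Defensive.

Import Order.TTheory GRing.Theory Num.Theory numFieldNormedType.Exports.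

Local Open Scope classical_set_scope.
Local Open Scope ring_scope.

(* Matrices carry the sigma-algebra generated by their entries; over the reals
   this is the Borel sigma-algebra of R^(m * n). *)
Definition matrix_display : measure_display -> measure_display.
Proof. exact. Qed.

Section matrix_measurable.
Context {d : measure_display} {T : measurableType d}.
Variables m n : nat.

Definition entry_events : set (set 'M[T]_(m, n)) :=
  \bigcup_(ij in [set: 'I_m * 'I_n])
    preimage_set_system [set: 'M[T]_(m, n)] (fun M => M ij.1 ij.2) measurable.

Let mx_set0 : <<s entry_events >> set0.
Proof. exact: sigma_algebra0. Qed.

Let mx_setC X : <<s entry_events >> X -> <<s entry_events >> (~` X).
Proof. exact: sigma_algebraC. Qed.

Let mx_bigcup (F : (set 'M[T]_(m, n))^nat) :
  (forall i, <<s entry_events >> (F i)) -> <<s entry_events >> (\bigcup_i F i).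
Proof. exact: sigma_algebra_bigcup. Qed.

HB.instance Definition _ := @isMeasurable.Build (matrix_display d)
  'M[T]_(m, n) <<s entry_events >> mx_set0 mx_setC mx_bigcup.

End matrix_measurable.

Section linear_quadratic.
Context {R : realType}.

Definition quad n (M : 'M[R]_n) (v : 'cV[R]_n) : R := (v^T *m M *m v) 0 0.

Definition possemidef n (M : 'M[R]_n) : Prop :=
  M^T = M /\ forall v, 0 <= quad M v.

Definition posdef n (M : 'M[R]_n) : Prop :=
  M^T = M /\ forall v, v != 0 -> 0 < quad M v.

Definition Schur n (M : 'M[R]_n) : Prop :=
  forall z : R[i], eigenvalue (map_mx (real_complex R) M) z -> `|z| < 1.

Definition stabilizable nx nu (A : 'M[R]_nx) (B : 'M[R]_(nx, nu)) : Prop :=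
  exists K : 'M[R]_(nu, nx), Schur (A - B *m K).

Definition detectable nx ny (A : 'M[R]_nx) (C : 'M[R]_(ny, nx)) : Prop :=
  exists L : 'M[R]_(nx, ny), Schur (A - L *m C).

Section gains.
Context {nx nu nw : nat}.
Variables (A : 'M[R]_nx) (Bu : 'M[R]_(nx, nu)) (Bw : 'M[R]_(nx, nw)).
Variables (Q : 'M[R]_nx) (Ru : 'M[R]_nu) (P : 'M[R]_nx).

Definition Hmx : 'M[R]_nu := Ru + Bu^T *m P *m Bu.
Definition Kv : 'M[R]_(nu, nx) := invmx Hmx *m Bu^T.
Definition Kx : 'M[R]_(nu, nx) := invmx Hmx *m Bu^T *m P *m A.
Definition Kw : 'M[R]_(nu, nw) := invmx Hmx *m Bu^T *m P *m Bw.
Definition Ahat : 'M[R]_nx := A - Bu *m Kx.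

Definition stabilizing_solution : Prop :=
  [/\ possemidef P,
      0 = P - A^T *m P *m A - Q
          + A^T *m P *m Bu *m invmx Hmx *m Bu^T *m P *m A,
      posdef Hmx
    & Schur Ahat].

Definition lyapunov (X : 'M[R]_nx) : Prop :=
  Ahat^T *m X *m Ahat - X + P *m Bw *m Bw^T *m P = 0.

(* The vector v^nc_{t+1}, which looks at all future disturbances. *)
Definition vnc_next (w : nat -> 'cV[R]_nw) (t : nat) : 'cV[R]_nx :=
  limn (fun N => \sum_(t.+1 <= j < N) (Ahat^T ^+ (j - t)%N *m P *m Bw *m w j)).

Definition nc_input (w : nat -> 'cV[R]_nw) (t : nat) (x : 'cV[R]_nx) :
    'cV[R]_nu :=
  - (Kx *m x) - Kw *m w t - Kv *m vnc_next w t.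

(* State at time t when the input at time s is [kappa s x_s]; an open-loop
   input sequence is the case where [kappa] ignores its second argument. *)
Fixpoint state (kappa : nat -> 'cV[R]_nx -> 'cV[R]_nu) (x0 : 'cV[R]_nx)
    (w : nat -> 'cV[R]_nw) (t : nat) : 'cV[R]_nx :=
  if t is s.+1 then
    let x := state kappa x0 w s in A *m x + Bu *m kappa s x + Bw *m w s
  else x0.

Definition average_cost (x : nat -> 'cV[R]_nx) (u : nat -> 'cV[R]_nu)
    (T : nat) : \bar R :=
  (T%:R^-1 * \sum_(t < T) (quad Q (x t) + quad Ru (u t)))%:E.

(* Per-step cost of a trajectory; meaningful only when the averages converge
   in [\bar R], which users of this definition have to ensure. *)
Definition Jinf (x : nat -> 'cV[R]_nx) (u : nat -> 'cV[R]_nu) : \bar R :=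
  limn (average_cost x u).

Definition nc_state (x0 : 'cV[R]_nx) (w : nat -> 'cV[R]_nw) :
    nat -> 'cV[R]_nx :=
  state (nc_input w) x0 w.

Definition nc_control (x0 : 'cV[R]_nx) (w : nat -> 'cV[R]_nw) (t : nat) :
    'cV[R]_nu :=
  nc_input w t (nc_state x0 w t).

End gains.
End linear_quadratic.

Section disturbance.
Context {R : realType}.

Definition mutually_independent d d' (T : measurableType d)
    (T' : measurableType d') (Pr : probability T R)
    (X : nat -> {RV Pr >-> T'}) : Prop :=
  forall (s : seq nat) (B : nat -> set T'),
    uniq s -> (forall i, measurable (B i)) ->
    Pr (\bigcap_(i in [set` s]) (X i @^-1` B i)) =
    (\prod_(i <- s) Pr (X i @^-1` B i))%E.

Definition IID d d' (T : measurableType d) (T' : measurableType d')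
    (Pr : probability T R) (X : nat -> {RV Pr >-> T'}) : Prop :=
  mutually_independent X /\
  forall i (B : set T'), measurable B ->
    distribution Pr (X i) B = distribution Pr (X 0%N) B.

Definition zero_mean_unit_covariance n d (T : measurableType d)
    (Pr : probability T R) (w : nat -> {RV Pr >-> 'cV[R]_n}) : Prop :=
  (forall i k, ('E_Pr[(fun om => w i om k 0)%R])%E = 0%E) /\
  (forall i j k l, ('E_Pr[(fun om => (w i om *m (w j om)^T) k l)%R])%E =
                   ((i == j)%:R * (1%:M : 'M[R]_n) k l)%:E).

End disturbance.

Section preview.
Context {R : realType} {nx nu nw : nat}.
Variables (A : 'M[R]_nx) (Bu : 'M[R]_(nx, nu)) (Bw : 'M[R]_(nx, nw)).
Variables (Q : 'M[R]_nx) (Ru : 'M[R]_nu).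

(* First [T] terms of a sequence of vectors, as the columns of a matrix. *)
Definition prefix_mx n (z : nat -> 'cV[R]_n) (T : nat) : 'M[R]_(n, T) :=
  \matrix_(i < n, s < T) z s i 0.

(* i_t = (x_0, ..., x_t, w_0, ..., w_{t+p}). *)
Local Notation info p t :=
  ('M[R]_(nx, t.+1) * 'M[R]_(nw, (t + p).+1))%type (only parsing).

Definition get_info p (x : nat -> 'cV[R]_nx) (w : nat -> 'cV[R]_nw) (t : nat) :
    info p t :=
  (prefix_mx x t.+1, prefix_mx w (t + p).+1).

(* Randomized policies with p steps of preview: [K t i] is the law of u_t when
   i_t = i. *)
Definition policy (p : nat) := forall t, R.-pker (info p t) ~> 'cV[R]_nu.

(* Disturbance conditioned on i_0: its first p+1 values are the known columns
   of [w0].  As the w_t are independent, the later ones keep their law. *)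
Definition known_then p (w0 : 'M[R]_(nw, p.+1)) (w : nat -> 'cV[R]_nw)
    (t : nat) : 'cV[R]_nw :=
  if (t <= p)%N then col (inord t) w0 else w t.

Section closed_loop.
Context {d : measure_display} {T : measurableType d} {Pr : probability T R}.
Variables (p : nat) (K : policy p).
Variables (x0 : 'cV[R]_nx) (w0 : 'M[R]_(nw, p.+1)).
Variables (w : nat -> {RV Pr >-> 'cV[R]_nw}).
Variables (u : nat -> {RV Pr >-> 'cV[R]_nu}).

Definition dist_of (om : T) : nat -> 'cV[R]_nw :=
  known_then w0 (fun t => w t om).

Definition input_of (om : T) : nat -> 'cV[R]_nu := fun t => u t om.

Definition state_of (om : T) : nat -> 'cV[R]_nx :=
  state A Bu Bw (fun t _ => u t om) x0 (dist_of om).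

(* The inputs are drawn from the policy: given the previous inputs and
   arbitrarily many disturbances, u_t has law [K t i_t].  In particular, given
   i_t, the randomization of u_t is independent of everything else. *)
Definition generated_by : Prop :=
  forall (t N : nat) (B : set 'cV[R]_nu)
         (C : set ('M[R]_(nu, t) * 'M[R]_(nw, N))),
    measurable B -> measurable C ->
    let E := [set om |
      C (prefix_mx (input_of om) t, prefix_mx (dist_of om) N)] in
    Pr (u t @^-1` B `&` E) =
    (\int[Pr]_(om in E) K t (get_info p (state_of om) (dist_of om) t) B)%E.

Definition stabilizing_loop : Prop :=
  exists M : R, forall t,
    (forall k, `| 'E_Pr[(fun om => state_of om t k 0)%R] | <= M%:E)%E /\
    ('E_Pr[(fun om => ((state_of om t)^T *m state_of om t) 0 0)%R] <= M%:E)%E.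

Definition loop_cost_defined : Prop :=
  {ae Pr, forall om, cvgn (average_cost Q Ru (state_of om) (input_of om))}.

Definition loop_cost : \bar R :=
  (\int[Pr]_om Jinf Q Ru (state_of om) (input_of om))%E.

End closed_loop.

Section optimal_cost.
Context {d : measure_display} {T : measurableType d} {Pr : probability T R}.
Variable w : nat -> {RV Pr >-> 'cV[R]_nw}.

(* [K] is stabilizing from i_0 = (x0, w0) and its expected cost given i_0
   is [c].  The loop lives on its own probability space, which carries a copy
   of the disturbance together with the randomization of [K]. *)
Definition has_expected_cost p (x0 : 'cV[R]_nx) (w0 : 'M[R]_(nw, p.+1))
    (K : policy p) (c : \bar R) : Prop :=
  exists (d' : measure_display) (T' : measurableType d')
         (Pr' : probability T' R)
         (w' : nat -> {RV Pr' >-> 'cV[R]_nw})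
         (u : nat -> {RV Pr' >-> 'cV[R]_nu}),
    [/\ IID w',
        forall t B, measurable B ->
          distribution Pr' (w' t) B = distribution Pr (w t) B,
        generated_by K x0 w0 w' u,
        stabilizing_loop x0 w0 w' u
      & loop_cost_defined x0 w0 w' u /\ c = loop_cost x0 w0 w' u].

Definition preview_optimal_cost p (x0 : 'cV[R]_nx) (w0 : 'M[R]_(nw, p.+1)) :
    \bar R :=
  ereal_inf [set c | exists K : policy p, has_expected_cost x0 w0 K c].

End optimal_cost.
End preview.

Section noncausal.
Context {R : realType} {nx nu nw : nat}.
Variables (A : 'M[R]_nx) (Bu : 'M[R]_(nx, nu)) (Bw : 'M[R]_(nx, nw)).
Variables (Q : 'M[R]_nx) (Ru : 'M[R]_nu) (P : 'M[R]_nx).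
Context {d : measure_display} {T : measurableType d} {Pr : probability T R}.
Variables (w : nat -> {RV Pr >-> 'cV[R]_nw}) (x0 : 'cV[R]_nx).

Definition nc_cost_defined : Prop :=
  {ae Pr, forall om : T, cvgn (average_cost Q Ru
    (nc_state A Bu Bw Ru P x0 (fun t => w t om))
    (nc_control A Bu Bw Ru P x0 (fun t => w t om)))}.

Definition nc_expected_cost : \bar R :=
  (\int[Pr]_om Jinf Q Ru
    (nc_state A Bu Bw Ru P x0 (fun t => w t om))
    (nc_control A Bu Bw Ru P x0 (fun t => w t om)))%E.

End noncausal.

(* Main.v *)
Require Import Defs.
From HB Require Import structures.
From mathcomp Require Import all_boot all_order all_algebra.
From mathcomp Require Import complex ring lra zify.
From mathcomp Require Import all_classical all_reals all_analysis.
From mathcomp Require Import measurable_realfun.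

Set Implicit Arguments.
Unset Strict Implicit.
Unset Printing Implicit Defensive.

Import Order.TTheory GRing.Theory Num.Theory numFieldNormedType.Exports.

Local Open Scope classical_set_scope.
Local Open Scope ring_scope.

(* Everything is reduced to a pathwise property of the disturbance: call w
   white if, for every lag k, (1/T) sum_{t<T} w_t w_{t+k}^T tends to I when
   k = 0 and to 0 otherwise.  Almost every path is white: for k = 0 this is
   Etemadi's strong law (only E |w|^2 is finite); for k > 0 the products are
   orthogonal in L2, so their averages vanish along geometric times, and the
   monotone sums of (w_t + w_{t+k})^2 interpolate between those times.

   Along a white path put psi_t = sum_{k>=0} (Ahat^T)^k P Bw w_{t+k}, so that
   psi_t = P Bw w_t + Ahat^T psi_{t+1} and v^nc_{t+1} = Ahat^T psi_{t+1}.  The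
   averages of psi_t psi_t^T satisfy the Lyapunov equation up to o(1), hence
   converge to X.  Completing the square with the storage x'Px + 2 x' Ahat^T psi
   writes the average cost of any input as a telescoping term, plus the average
   of e_t' H e_t where e_t is the deviation from the noncausal input, plus an
   average depending on w only, whose limit is the announced value J.  For the
   noncausal input e = 0.  For the p-step preview input
   e_t = Kv (Ahat^T)^(p+1) psi_{t+p+1}, so the excess cost is exponentially
   small in p.  For an arbitrary stabilizing randomized policy the e-term is
   nonnegative and the telescoping term vanishes along a subsequence, because
   E |x_t|^2 is bounded; hence no policy does better than J. *)

(** * Geometric decay of the powers of a Schur matrix *)

(** The cost is the expectation of a pathwise limit, so showing that this limit is almost surely a
    constant gives existence, value and independence of the initial condition together, without
    exchanging limit and expectation. The obstacle is that paths of a noise with two moments are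
    unbounded. What survives is growth o(sqrt t), the last-term consequence of convergent averages
    of squares; it passes through stable filters, causal or anticausal, and it is exactly the scale
    at which boundary terms quadratic in the state and in psi vanish after division by T.
    Conditioning on i_0 alters finitely many disturbances, which averages do not see, so one
    constant J serves every i_0. The optimal p-step cost is never computed: it is caught between J
    and the cost of one explicit policy. *)

Section geometric_decay.
Context {R : realType}.
Implicit Types (K rho : R).

Definition geo_decay (f : nat -> R) : Prop :=
  exists K rho, [/\ 0 <= K, 0 < rho, rho < 1 & forall k, f k <= K * rho ^+ k].

(** When [l] equals the rate of [b] the solution behaves like k l^k, so the new rate must lie
    strictly above both; the midpoint between their maximum and 1 is taken. *)
Lemma geo_decay_rec (a : nat -> R) (b : nat -> R) l : 0 <= l -> l < 1 ->
  (forall k, a k.+1 <= l * a k + b k) -> geo_decay b -> geo_decay a.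
Proof.
move=> l0 l1 ab [K [rho [K0 rho0 rho1 bK]]].
pose m := Order.max l rho; pose r := (m + 1) / 2.
have m1 : m < 1 by rewrite /m gt_max l1.
have lm : l <= m by rewrite /m le_max lexx.
have rm : rho <= m by rewrite /m le_max lexx orbT.
have mr : m < r by rewrite /r; lra.
have r1 : r < 1 by rewrite /r; lra.
have r0 : 0 < r by lra.
have lr : 0 < r - l by lra.
(* Chosen so that l K' + K <= r K', which closes the induction, with K' also above [a 0]. *)
pose K' := `|a 0%N| + K / (r - l).
have K'0 : 0 <= K' by rewrite addr_ge0// divr_ge0// ltW.
exists K', r; split => // k.
elim: k => [|k IH].
  rewrite expr0 mulr1 (le_trans (ler_norm _))// lerDl divr_ge0// ltW//.
apply: (le_trans (ab k)).
have h1 : l * a k <= l * (K' * r ^+ k) by rewrite ler_wpM2l.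
have h2 : b k <= K * r ^+ k.
  apply: (le_trans (bK k)); rewrite ler_wpM2l// lerXn2r// ?nnegrE; lra.
apply: (le_trans (lerD h1 h2)).
have -> : l * (K' * r ^+ k) + K * r ^+ k = (l * K' + K) * r ^+ k by ring.
rewrite exprS [r * _]mulrC [leRHS]mulrCA mulrC ler_wpM2l// ?exprn_ge0 ?(ltW r0)//.
have : K <= (r - l) * K'.
  rewrite /K' mulrDr mulrCA divff ?mulr1 ?gt_eqF// lerDr mulr_ge0// ltW//.
lra.
Qed.

Lemma geo_decay0 : geo_decay (fun=> 0).
Proof. by exists 0, 2^-1; split=> [|||k]; rewrite ?mul0r//; lra. Qed.

Lemma geo_decay_sum I (s : seq I) (f : I -> nat -> R) :
  (forall i, geo_decay (f i)) -> geo_decay (fun k => \sum_(i <- s) f i k).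
Proof.
move=> h; elim: s => [|i s IH].
  by under eq_fun do rewrite big_nil; exact: geo_decay0.
have [K [r [K0 r0 r1 hK]]] := IH; have [K' [r' [K'0 r'0 r'1 hK']]] := h i.
pose m := Order.max r r'.
have rm : r <= m by rewrite /m le_max lexx.
have r'm : r' <= m by rewrite /m le_max lexx orbT.
exists (K + K'), m; split; [exact: addr_ge0|lra|by rewrite /m gt_max r1|] => k.
rewrite big_cons addrC mulrDl; apply: lerD.
  by apply: (le_trans (hK k)); rewrite ler_wpM2l// lerXn2r// ?nnegrE; lra.
by apply: (le_trans (hK' k)); rewrite ler_wpM2l// lerXn2r// ?nnegrE; lra.
Qed.

Lemma geo_decay_linear (f : nat -> R) :
  geo_decay f -> geo_decay (fun k => k.+1%:R * f k).
Proof.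
move=> [K [r [K0 r0 r1 hK]]].
pose s := (1 + r) / 2.
have s1 : s < 1 by rewrite /s; lra.
have rs : r < s by rewrite /s; lra.
have s0 : 0 < s by lra.
pose c := 1 + (s - r)^-1.
have c0 : 0 < (s - r)^-1 by rewrite invr_gt0; lra.
exists (K * c), s; split => //; first by apply: mulr_ge0 => //; rewrite /c; lra.
have key k : k.+1%:R * r ^+ k <= c * s ^+ k.
  (* The extra [r ^+ k.+1] makes the claim inductive: s times the left side at k exceeds the left
     side at k+1 by (k+1) r^k (s-r)^2. *)
  suff: k.+1%:R * r ^+ k * (s - r) + r ^+ k.+1 <= (1 + (s - r)) * s ^+ k.
    move=> h; have h' : k.+1%:R * r ^+ k * (s - r) <= (1 + (s - r)) * s ^+ k.
      by apply: le_trans h; rewrite lerDl exprn_ge0// ltW.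
    rewrite /c -(ler_pM2r (_ : 0 < s - r)); last lra.
    apply: (le_trans h'); rewrite le_eqVlt; apply/orP; left; apply/eqP.
    have sr : s - r != 0 by rewrite gt_eqF//; lra.
    by field.
  elim: k => [|k IH]; first by rewrite expr0 expr1; lra.
  have p0 : 0 <= r ^+ k by rewrite exprn_ge0// ltW.
  have n0 : (0:R) <= k.+1%:R by [].
  rewrite !exprS -(natr1 k.+1); rewrite exprS in IH.
  move: p0 n0 IH; set q := r ^+ k; set n := k.+1%:R; set v := s ^+ k => p0 n0 IH.
  have h1 : 0 <= (s - r) * (n * (s - r) * q) by rewrite !mulr_ge0//; lra.
  have h2 : s * (n * q * (s - r) + r * q) <= s * ((1 + (s - r)) * v).
    by rewrite ler_wpM2l// ltW.
  nra.
move=> k; apply: (@le_trans _ _ (k.+1%:R * (K * r ^+ k))).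
  by rewrite ler_wpM2l.
by rewrite mulrCA -mulrA ler_wpM2l.
Qed.

End geometric_decay.

Section schur_decay.
Context {R : realType}.
Local Notation C := R[i].
Local Notation normc := Normc.normc.

Lemma normc_ge0 (z : C) : 0 <= normc z.
Proof. by case: z => a b; exact: sqrtr_ge0. Qed.

Lemma geo_decay_complex_rec (y : nat -> C) (l : C) : normc l < 1 ->
  geo_decay (fun k => normc (y k.+1 - l * y k)) ->
  geo_decay (fun k => normc (y k)).
Proof.
move=> l1; apply: (geo_decay_rec (normc_ge0 l) l1) => k.
by rewrite -Normc.normcM -{1}(subrK (l * y k) (y k.+1)) addrC le_normcD.
Qed.

(** A substitute for the Jordan form. With z the last factor, (A - z) N is annihilated by the
    remaining ones, and A^(k+1) N - z A^k N = A^k (A - z) N, so each factor costs one scalar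
    recursion of multiplier z. *)
Lemma geo_decay_annihilated n (A N : 'M[C]_n) (s : seq C) :
  (forall z, z \in s -> normc z < 1) ->
  \prod_(z <- s) (A - z%:M) * N = 0 ->
  forall i j, geo_decay (fun k => normc ((A ^+ k * N) i j)).
Proof.
move=> s1 sN i j; elim/last_ind: s s1 N sN => [|s z IH] s1 N.
  rewrite big_nil mul1r => ->.
  by under eq_fun do rewrite mulr0 mxE Normc.normc0; exact: geo_decay0.
rewrite -cats1 big_cat big_seq1/= -mulrA => sN.
have l1 : normc z < 1 by apply: s1; rewrite mem_rcons in_cons eqxx.
apply: (geo_decay_complex_rec l1).
have := IH _ _ sN; case.
  by move=> z' z's; apply: s1; rewrite mem_rcons in_cons z's orbT.
move=> K [r [K0 r0 r1 h]]; exists K, r; split => // k.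
have := h k; congr (normc _ <= _).
rewrite mulrBl mulrBr [A ^+ k * (A * N)]mulrA -exprSr.
have -> : A ^+ k * (z%:M * N) = z *: (A ^+ k * N).
  by rewrite -mulmxE mul_scalar_mx scalemxAr.
by rewrite !mxE.
Qed.

(** By Cayley-Hamilton over the complex numbers, the product of the A - z over the roots of the
    characteristic polynomial annihilates the identity. *)
Lemma Schur_geo_decay n (A : 'M[R]_n) : Defs.Schur A ->
  forall i j, geo_decay (fun k => `|(A ^+ k) i j|).
Proof.
move: A; case: n => [|n] A hA i j; first by case: i.
pose B := map_mx (real_complex R) A.
have [s hs] := closed_field_poly_normal (char_poly B).
have := char_poly_monic B; rewrite monicE => /eqP hm.
rewrite hm scale1r in hs.
have hs1 z : z \in s -> normc z < 1.
  move=> zs; have /hA : eigenvalue B z.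
    by rewrite eigenvalue_root_char hs root_prod_XsubC.
  by rewrite -[`|z|]/((normc z)%:C)%C -(rmorph1 (real_complex R)) ltcR.
have CH : \prod_(z <- s) (B - z%:M) * 1 = 0.
  rewrite mulr1 -(Cayley_Hamilton B) hs rmorph_prod/=.
  apply: eq_bigr => z _.
  by rewrite rmorphB/= horner_mx_X horner_mx_C.
have [K [r [K0 r0 r1 h]]] := geo_decay_annihilated hs1 CH i j.
exists K, r; split => // k; apply: le_trans (h k).
rewrite mulr1 /B -[map_mx _ _ ^+ k](rmorphXn (map_mx (real_complex R))) mxE.
by rewrite /normc/= expr0n/= addr0 sqrtr_sqr.
Qed.

End schur_decay.

(** * Entrywise norm, limits of matrices, the Lyapunov operator *)

Section matrix_norm.
Context {R : realType}.

Lemma cvg_sumr I (s : seq I) (f : I -> nat -> R) (l : I -> R) :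
  (forall i, f i n @[n --> \oo] --> l i) ->
  \sum_(i <- s) f i n @[n --> \oo] --> \sum_(i <- s) l i.
Proof.
move=> fl; elim: s => [|i s IH].
  by under eq_fun do rewrite big_nil; rewrite big_nil; exact: cvg_cst.
by under eq_fun do rewrite big_cons; rewrite big_cons; exact: cvgD.
Qed.

Lemma eq_cvgn (u v : nat -> R) (l : R) :
  (forall n, u n = v n) -> u n @[n --> \oo] --> l -> v n @[n --> \oo] --> l.
Proof. by move=> /funext ->. Qed.

Lemma cvgn_epsP (u : nat -> R) (l : R) : u n @[n --> \oo] --> l <->
  (forall e, 0 < e -> exists N, forall n, (N <= n)%N -> `|u n - l| <= e).
Proof.
split=> [/cvgrPdistC_le ul e e0|ul].
  by have [N _ NP] := ul e e0; exists N => n Nn; exact: NP.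
apply/cvgrPdistC_le => e e0; have [N NP] := ul e e0.
by exists N => // n Nn; exact: NP.
Qed.

(* The entrywise l1 norm, which is submultiplicative in all shapes. *)
Definition nrm m n (M : 'M[R]_(m, n)) : R := \sum_i \sum_j `|M i j|.

Lemma nrm_ge0 m n (M : 'M[R]_(m, n)) : 0 <= nrm M.
Proof. by apply: sumr_ge0 => i _; apply: sumr_ge0. Qed.

Lemma nrm0 m n : nrm (0 : 'M[R]_(m, n)) = 0.
Proof. by rewrite /nrm big1// => i _; rewrite big1// => j _; rewrite mxE normr0. Qed.

Lemma nrmN m n (M : 'M[R]_(m, n)) : nrm (- M) = nrm M.
Proof. by apply: eq_bigr => i _; apply: eq_bigr => j _; rewrite mxE normrN. Qed.

Lemma nrmD m n (M N : 'M[R]_(m, n)) : nrm (M + N) <= nrm M + nrm N.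
Proof.
rewrite -big_split; apply: ler_sum => i _; rewrite -big_split.
by apply: ler_sum => j _; rewrite mxE ler_normD.
Qed.

Lemma nrmB m n (M N : 'M[R]_(m, n)) : nrm (M - N) <= nrm M + nrm N.
Proof. by rewrite -(nrmN N) nrmD. Qed.

Lemma nrmZ m n a (M : 'M[R]_(m, n)) : nrm (a *: M) = `|a| * nrm M.
Proof.
rewrite mulr_sumr; apply: eq_bigr => i _; rewrite mulr_sumr.
by apply: eq_bigr => j _; rewrite mxE normrM.
Qed.

Lemma nrm_tr m n (M : 'M[R]_(m, n)) : nrm M^T = nrm M.
Proof.
rewrite /nrm exchange_big; apply: eq_bigr => i _; apply: eq_bigr => j _.
by rewrite mxE.
Qed.

Lemma nrm_sum m n I (s : seq I) (F : I -> 'M[R]_(m, n)) :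
  nrm (\sum_(i <- s) F i) <= \sum_(i <- s) nrm (F i).
Proof.
elim: s => [|i s IH]; first by rewrite !big_nil nrm0.
by rewrite !big_cons; apply: (le_trans (nrmD _ _)); rewrite lerD2l.
Qed.

Lemma nrm_entry m n (M : 'M[R]_(m, n)) i j : `|M i j| <= nrm M.
Proof.
rewrite /nrm (bigD1 i)//= (bigD1 j)//= -addrA lerDl addr_ge0//.
  exact: sumr_ge0.
by apply: sumr_ge0 => k _; apply: sumr_ge0.
Qed.

Lemma nrmM m n p (M : 'M[R]_(m, n)) (N : 'M[R]_(n, p)) :
  nrm (M *m N) <= nrm M * nrm N.
Proof.
rewrite mulr_suml; apply: ler_sum => i _.
apply: (@le_trans _ _ (\sum_j \sum_k `|M i k| * `|N k j|)).
  apply: ler_sum => j _; rewrite mxE (le_trans (ler_norm_sum _ _ _))//.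
  by apply: ler_sum => k _; rewrite normrM.
rewrite exchange_big mulr_suml; apply: ler_sum => k _.
rewrite -mulr_sumr ler_wpM2l// /nrm [leRHS](bigD1 k)//= lerDl.
by apply: sumr_ge0 => i' _; apply: sumr_ge0.
Qed.

Lemma nrm_eq0 m n (M : 'M[R]_(m, n)) : nrm M <= 0 -> M = 0.
Proof.
move=> h; apply/matrixP => i j; rewrite mxE; apply/eqP; rewrite -normr_le0.
exact: le_trans (nrm_entry _ _ _) h.
Qed.

Lemma nrm_ord1 (M : 'M[R]_1) : nrm M = `|M 0 0|.
Proof. by rewrite /nrm !big_ord1. Qed.

Lemma nrm_cV n (v : 'cV[R]_n) : nrm v = \sum_i `|v i 0|.
Proof. by apply: eq_bigr => i _; rewrite big_ord1. Qed.

(** Cauchy-Schwarz through Lagrange's identity: the defect is half the sum [s] of the squared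
    differences. *)
Lemma nrm_sqr_le n (v : 'cV[R]_n) : nrm v ^+ 2 <= n%:R * \sum_i v i 0 ^+ 2.
Proof.
rewrite nrm_cV.
pose s := \sum_(i < n) \sum_(j < n) (`|v i 0| - `|v j 0|) ^+ 2.
have s0 : 0 <= s by apply: sumr_ge0 => i _; apply: sumr_ge0 => j _; exact: sqr_ge0.
suff e : s = 2 * (n%:R * (\sum_i v i 0 ^+ 2) - (\sum_i `|v i 0|) ^+ 2).
  by move: s0; rewrite e; lra.
have -> : s = \sum_(i < n) (n%:R * v i 0 ^+ 2 + \sum_j v j 0 ^+ 2
     - 2 * (`|v i 0| * \sum_j `|v j 0|)).
  apply: eq_bigr => i _.
  under eq_bigr => j _ do rewrite sqrrB !real_normK ?num_real// -mulr_natl.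
  rewrite !big_split/= sumrN sumr_const card_ord -[v i 0 ^+ 2 *+ n]mulr_natl.
  by rewrite -2!mulr_sumr addrAC.
rewrite sumrB big_split/= sumr_const card_ord -mulr_natl -!mulr_sumr -mulr_suml.
by rewrite expr2; ring.
Qed.

End matrix_norm.

Section matrix_limits.
Context {R : realType}.

Definition mcvg m n (u : nat -> 'M[R]_(m, n)) (l : 'M[R]_(m, n)) : Prop :=
  forall i j, u k i j @[k --> \oo] --> l i j.

Lemma mcvgP m n (u : nat -> 'M[R]_(m, n)) l :
  mcvg u l <-> nrm (u k - l) @[k --> \oo] --> (0 : R).
Proof.
split=> [ul|ul i j].
  have -> : (0 : R) = \sum_(i < m) \sum_(j < n) 0.
    by rewrite big1// => i _; rewrite big1.
  apply: cvg_sumr => i; apply: cvg_sumr => j.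
  rewrite -(normr0 R); apply: cvg_norm.
  under eq_fun do rewrite !mxE.
  rewrite -[0](subrr (l i j)); apply: cvgB; [exact: ul|exact: cvg_cst].
apply/cvgn_epsP => e e0; have /cvgn_epsP/(_ e e0)[N NP] := ul.
exists N => k Nk; have := NP k Nk; rewrite subr0 ger0_norm ?nrm_ge0//.
by apply: le_trans; have := nrm_entry (u k - l) i j; rewrite !mxE.
Qed.

Lemma mcvg_squeeze m n (u : nat -> 'M[R]_(m, n)) l (e : nat -> R) :
  (forall k, nrm (u k - l) <= e k) -> e k @[k --> \oo] --> (0 : R) -> mcvg u l.
Proof.
move=> ue e0; apply/mcvgP; apply: (squeeze_cvgr _ (cvg_cst 0) e0).
by apply: nearW => k; rewrite nrm_ge0 ue.
Qed.

Lemma mcvg_cst m n (l : 'M[R]_(m, n)) : mcvg (fun=> l) l.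
Proof. by move=> i j; exact: cvg_cst. Qed.

Lemma mcvgD m n (u v : nat -> 'M[R]_(m, n)) l k :
  mcvg u l -> mcvg v k -> mcvg (fun n => u n + v n) (l + k).
Proof.
by move=> ul vk i j; under eq_fun do rewrite mxE; rewrite mxE; exact: cvgD.
Qed.

Lemma mcvgN m n (u : nat -> 'M[R]_(m, n)) l :
  mcvg u l -> mcvg (fun n => - u n) (- l).
Proof.
by move=> ul i j; under eq_fun do rewrite mxE; rewrite mxE; exact: cvgN.
Qed.

Lemma mcvgB m n (u v : nat -> 'M[R]_(m, n)) l k :
  mcvg u l -> mcvg v k -> mcvg (fun n => u n - v n) (l - k).
Proof. by move=> ul vk; apply: mcvgD => //; exact: mcvgN. Qed.

Lemma mcvg_tr m n (u : nat -> 'M[R]_(m, n)) l :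
  mcvg u l -> mcvg (fun n => (u n)^T) l^T.
Proof. by move=> ul i j; under eq_fun do rewrite mxE; rewrite mxE; exact: ul. Qed.

Lemma mcvgMl m n p (M : 'M[R]_(p, m)) (u : nat -> 'M[R]_(m, n)) l :
  mcvg u l -> mcvg (fun n => M *m u n) (M *m l).
Proof.
move=> ul i j; under eq_fun do rewrite mxE; rewrite mxE.
by apply: cvg_sumr => k; apply: cvgM => //; exact: cvg_cst.
Qed.

Lemma mcvgMr m n p (M : 'M[R]_(n, p)) (u : nat -> 'M[R]_(m, n)) l :
  mcvg u l -> mcvg (fun n => u n *m M) (l *m M).
Proof.
move=> ul i j; under eq_fun do rewrite mxE; rewrite mxE.
by apply: cvg_sumr => k; apply: cvgM => //; exact: cvg_cst.
Qed.

Lemma mcvg_trace n (u : nat -> 'M[R]_n) l :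
  mcvg u l -> \tr (u k) @[k --> \oo] --> \tr l.
Proof. by move=> ul; apply: cvg_sumr => i; exact: ul. Qed.

Lemma eq_mcvg m n (v u : nat -> 'M[R]_(m, n)) l :
  (forall k, u k = v k) -> mcvg v l -> mcvg u l.
Proof. by move=> /funext ->. Qed.

Lemma mcvg_unique m n (u : nat -> 'M[R]_(m, n)) l l' :
  mcvg u l -> mcvg u l' -> l = l'.
Proof.
move=> ul ul'; apply/matrixP => i j.
exact: (norm_cvg_unique (ul i j) (ul' i j)).
Qed.

Lemma mcvg_shift m n (u : nat -> 'M[R]_(m, n)) l :
  mcvg u l -> mcvg (fun k => u k.+1) l.
Proof. by move=> ul i j; have := ul i j; rewrite -(cvg_shiftS (fun k => u k i j)). Qed.

Lemma mcvg_unshift m n (u : nat -> 'M[R]_(m, n)) l k :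
  mcvg (fun N => u (N + k)%N) l -> mcvg u l.
Proof. by move=> ul i j; have := ul i j; rewrite -(cvg_shiftn k (fun N => u N i j)). Qed.

(** Links entrywise convergence to the sup-norm topology in which the limit defining [vnc_next] is
    taken. *)
Lemma mcvg_limn m n (u : nat -> 'M[R]_(m, n)) l : mcvg u l -> limn u = l.
Proof.
move=> ul; apply: norm_cvg_lim; apply/cvgrPdistC_le => e e0.
have /mcvgP/cvgn_epsP/(_ e e0)[N NP] := ul.
exists N => // k /= Nk; have := NP k Nk; rewrite subr0 ger0_norm ?nrm_ge0//.
apply: le_trans; rewrite /Num.norm/= mx_normrE.
apply: bigmax_le => [|ij _]; [exact: nrm_ge0|exact: nrm_entry].
Qed.

End matrix_limits.

Arguments mcvg_cst {R m n} l.
Arguments mcvgMl {R m n p} M [u l].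
Arguments mcvgMr {R m n p} M [u l].

Section lyapunov_operator.
Context {R : realType}.

Lemma Schur_nrm_decay n (A : 'M[R]_n) : Defs.Schur A ->
  geo_decay (fun k => nrm (A ^+ k)).
Proof.
move=> hA; apply: geo_decay_sum => i; apply: geo_decay_sum => j.
exact: Schur_geo_decay.
Qed.

(** The continuity of [L] is what turns an approximate solution of the Lyapunov equation into an
    approximation of its solution. Vectorized, the operator is a square matrix, so injectivity is
    enough. *)
Lemma lyapunov_inverse n (A : 'M[R]_n) : Defs.Schur A ->
  exists L : 'M[R]_n -> 'M[R]_n,
    [/\ (forall u l, mcvg u l -> mcvg (fun k => L (u k)) (L l)),
        cancel (fun X => X - A^T *m X *m A) L
      & cancel L (fun X => X - A^T *m X *m A)].
Proof.
move=> hA; pose G := 1%:M - lin_mulmx A^T *m lin_mulmxr A : 'M[R]_(n * n).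
have GE X : mxvec X *m G = mxvec (X - A^T *m X *m A).
  by rewrite mulmxBr mulmx1 mulmxA !mul_vec_lin linearB.
have Ginj X : X - A^T *m X *m A = 0 -> X = 0.
  move=> /subr0_eq hX.
  (* A fixed point of X -> A^T X A can be iterated, and the powers of A tend to 0. *)
  have it k : X = (A^T) ^+ k *m X *m A ^+ k.
    elim: k => [|k IH]; first by rewrite !expr0 mul1mx mulmx1.
    by rewrite {1}IH {1}hX exprSr exprS -!mulmxE !mulmxA.
  have [K [r [K0 r0 r1 hK]]] := Schur_nrm_decay hA.
  apply: nrm_eq0; apply/ler_addgt0Pr => e e0; rewrite add0r.
  have trA k : (A^T) ^+ k = (A ^+ k)^T.
    elim: k => [|k IH]; first by rewrite !expr0 trmx1.
    by rewrite exprS exprSr IH -!mulmxE trmx_mul.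
  have hb k : nrm X <= K * nrm X * K * r ^+ k.
    rewrite {1}(it k); apply: (le_trans (nrmM _ _)).
    rewrite -mulrA; apply: ler_pM; rewrite ?nrm_ge0//.
    apply: (le_trans (nrmM _ _)); rewrite ler_wpM2r ?nrm_ge0// trA nrm_tr.
    apply: (le_trans (hK k)); rewrite -[leRHS]mulr1 ler_wpM2l//.
    by rewrite exprn_ile1// ltW.
  have : K * nrm X * K * r ^+ k @[k --> \oo] --> K * nrm X * K * 0.
    apply: cvgM; first exact: cvg_cst.
    by apply: cvg_expr; rewrite ger0_norm// ltW.
  rewrite mulr0 => /cvgn_epsP/(_ e e0)[N /(_ N (leqnn N))].
  by rewrite subr0; apply: le_trans; rewrite (le_trans (hb N))// ler_norm.
have Gu : G \in unitmx.
  rewrite -row_free_unit; apply: inj_row_free => v.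
  rewrite -[v]vec_mxK GE => /(congr1 vec_mx); rewrite mxvecK linear0 => /Ginj ->.
  by rewrite linear0.
exists (fun Y => vec_mx (mxvec Y *m invmx G)); split.
- move=> u l ul i j; under eq_fun do rewrite !mxE.
  rewrite !mxE; apply: cvg_sumr => c; case/mxvec_indexP: c => a b.
  under eq_fun do rewrite mxvecE; rewrite mxvecE.
  by apply: cvgM; [exact: ul|exact: cvg_cst].
- by move=> X; rewrite -GE mulmxK// mxvecK.
- by move=> Y; apply: (can_inj mxvecK); rewrite -GE vec_mxK mulmxKV.
Qed.

End lyapunov_operator.

(** * Sequences that are o(sqrt t) *)

Section subdiffusive_growth.
Context {R : realType}.
Implicit Types a b : nat -> R.

(** The shift keeps the scale at least 1, also at time 0. *)
Definition sqrtS (t : nat) : R := Num.sqrt t.+1%:R.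

Lemma sqrtS_gt0 t : 0 < sqrtS t. Proof. by rewrite sqrtr_gt0. Qed.

Lemma sqrtS_ge0 t : 0 <= sqrtS t. Proof. exact: sqrtr_ge0. Qed.
#[local] Hint Resolve sqrtS_gt0 sqrtS_ge0 : core.

Lemma sqrtS_ge1 t : 1 <= sqrtS t.
Proof. by rewrite -[leLHS]sqrtr1 ler_wsqrtr// ler1n. Qed.

Lemma sqr_sqrtS t : sqrtS t ^+ 2 = t.+1%:R.
Proof. by rewrite sqr_sqrtr. Qed.

Lemma sqrtSD t k : sqrtS (t + k) <= k.+1%:R * sqrtS t.
Proof.
have k0 : 0 <= k.+1%:R * sqrtS t by rewrite mulr_ge0// ltW ?sqrtS_gt0.
rewrite -[leRHS](ger0_norm k0) -sqrtr_sqr; apply: ler_wsqrtr.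
by rewrite exprMn sqr_sqrtS -natrX -natrM ler_nat; nia.
Qed.

Lemma sqrtS_le t k : (t <= k)%N -> sqrtS t <= sqrtS k.
Proof. by move=> tk; rewrite ler_wsqrtr// ler_nat. Qed.

(* [a t = o(sqrt t)], for nonnegative [a]. *)
Definition osqrt a : Prop :=
  forall e, 0 < e -> exists N, forall t, (N <= t)%N -> a t <= e * sqrtS t.

Lemma osqrt_le a b : (forall t, a t <= b t) -> osqrt b -> osqrt a.
Proof.
move=> ab hb e e0; have [N NP] := hb e e0; exists N => t Nt.
exact: le_trans (ab t) (NP t Nt).
Qed.

Lemma osqrtD a b : osqrt a -> osqrt b -> osqrt (fun t => a t + b t).
Proof.
move=> ha hb e e0; have e2 : 0 < e / 2 by lra.
have [N NP] := ha _ e2; have [M MP] := hb _ e2; exists (maxn N M) => t.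
rewrite geq_max => /andP[Nt Mt]; rewrite (splitr e) mulrDl.
by apply: lerD; [exact: NP|exact: MP].
Qed.

Lemma osqrtZ a c : 0 <= c -> osqrt a -> osqrt (fun t => c * a t).
Proof.
move=> c0 ha e e0; have e1 : 0 < e / (c + 1) by rewrite divr_gt0//; lra.
have [N NP] := ha _ e1; exists N => t Nt.
apply: (le_trans (ler_wpM2l c0 (NP t Nt))).
rewrite mulrA; apply: ler_wpM2r => //.
rewrite mulrCA -[leRHS]mulr1; apply: ler_wpM2l; first exact: ltW.
by rewrite ler_pdivrMr; lra.
Qed.

Lemma osqrt_shift a k : osqrt a -> osqrt (fun t => a (t + k)%N).
Proof.
move=> ha e e0; have e1 : 0 < e / k.+1%:R by rewrite divr_gt0.
have [N NP] := ha _ e1; exists N => t Nt.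
apply: (le_trans (NP _ (leq_trans Nt (leq_addr _ _)))).
rewrite -mulrA ler_wpM2l ?(ltW e0)// mulrC ler_pdivrMr// mulrC.
exact: sqrtSD.
Qed.

Lemma osqrt_bound a : osqrt a -> exists K, 0 <= K /\ forall t, a t <= K * sqrtS t.
Proof.
move=> /(_ 1 ltr01)[N NP]; exists (1 + \sum_(t < N) `|a t|).
have s0 : 0 <= \sum_(t < N) `|a t| by apply: sumr_ge0.
split=> [|t]; first by rewrite addr_ge0.
have sq1 := sqrtS_ge1 t.
have [Nt|tN] := leqP N t.
  apply: (le_trans (NP t Nt)); rewrite ler_wpM2r ?(le_trans ler01)//.
  by rewrite lerDl.
rewrite -[leLHS]mulr1; apply: (le_trans (ler_wpM2r _ (ler_norm _))) => //.
apply: ler_pM => //; rewrite (bigD1 (Ordinal tN))//= addrCA lerDl addr_ge0//.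
exact: sumr_ge0.
Qed.

Lemma osqrtM_cvg a b : (forall t, 0 <= a t) -> (forall t, 0 <= b t) ->
  osqrt a -> osqrt b -> a t * b t / t.+1%:R @[t --> \oo] --> 0.
Proof.
move=> a0 b0 ha hb; apply/cvgn_epsP => e e0.
have [N NP] := ha _ e0; have [M MP] := hb _ ltr01.
exists (maxn N M) => t; rewrite geq_max => /andP[Nt Mt].
rewrite subr0 ger0_norm ?divr_ge0 ?mulr_ge0// ler_pdivrMr//.
apply: (le_trans (ler_pM _ _ (NP t Nt) (MP t Mt))) => //.
by rewrite mul1r -mulrA -expr2 sqr_sqrtS.
Qed.

Lemma osqrt_rec a b l : 0 <= l -> l < 1 -> (forall t, 0 <= a t) ->
  (forall t, a t.+1 <= l * a t + b t) -> osqrt b -> osqrt a.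
Proof.
move=> l0 l1 a0 ab hb e e0.
have l1' : 0 < 1 - l by rewrite subr_gt0.
(* With this tolerance on [b], the bound e/2 on the forced part reproduces itself: l e/2 + (1-l) e/2
   = e/2. The other half of e pays for the initial term l^k a_N. *)
have e2 : 0 < e / 2 * (1 - l) by rewrite mulr_gt0// divr_gt0.
have [N NP] := hb _ e2.
have it k : a (N + k)%N <= l ^+ k * a N + e / 2 * sqrtS (N + k).
  elim: k => [|k IH].
    by rewrite addn0 expr0 mul1r lerDl mulr_ge0// ltW ?sqrtS_gt0// divr_gt0.
  rewrite addnS; apply: (le_trans (ab _)).
  have h1 := ler_wpM2l l0 IH.
  have h2 := NP (N + k)%N (leq_addr _ _).
  apply: (le_trans (lerD h1 h2)); rewrite mulrDr mulrA -exprS -addrA lerD2l.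
  have -> : l * (e / 2 * sqrtS (N + k)) + e / 2 * (1 - l) * sqrtS (N + k)
    = e / 2 * sqrtS (N + k) by ring.
  by rewrite ler_wpM2l// ?sqrtS_le// ltW// divr_gt0.
have : l ^+ k * a N @[k --> \oo] --> 0 * a N.
  by apply: cvgM; [apply: cvg_expr; rewrite ger0_norm|exact: cvg_cst].
have e3 : 0 < e / 2 by rewrite divr_gt0.
rewrite mul0r => /cvgn_epsP/(_ _ e3)[M MP].
exists (N + M)%N => t NMt; have Nt : (N <= t)%N by apply: leq_trans NMt; rewrite leq_addr.
have := it (t - N)%N; rewrite subnKC// => h; apply: (le_trans h).
rewrite [e in leRHS](splitr e) mulrDl lerD2r.
have := MP (t - N)%N; rewrite leq_subRL// => /(_ NMt); rewrite subr0 => h'.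
apply: (le_trans (ler_norm _)); apply: (le_trans h').
by rewrite ler_peMr ?sqrtS_ge1// ltW.
Qed.

Lemma geo_sum_le (r : R) N : 0 <= r -> r < 1 -> \sum_(k < N) r ^+ k <= (1 - r)^-1.
Proof.
move=> r0 r1; have h : 0 < 1 - r by rewrite subr_gt0.
rewrite -(ler_pM2r h) mulVf ?gt_eqF// mulrC -opprB mulNr -subrX1 opprB.
by rewrite gerBl exprn_ge0.
Qed.

Section backward_sum.
Variables (a : nat -> R) (r : R).
Hypotheses (a0 : forall t, 0 <= a t) (r0 : 0 < r) (r1 : r < 1) (oa : osqrt a).

Let part t N := \sum_(k < N) r ^+ k * a (t + k)%N.

(** Since sqrtS (t+k) <= (k+1) sqrtS t, the weights (k+1) r^k bound the sum. The constant is uniform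
    in K and t, so it gives finiteness with a global K, and o(sqrt t) with a small K valid from some
    time on. *)
Lemma backward_part_bound : exists c, 0 <= c /\
  forall K t, 0 <= K -> (forall k, a (t + k)%N <= K * sqrtS (t + k)) ->
  forall N, part t N <= K * c * sqrtS t.
Proof.
have [K' [r' [K'0 r'0 r'1 h]]] : geo_decay (fun k => k.+1%:R * r ^+ k).
  by apply: geo_decay_linear; exists 1, r; split=> // k; rewrite mul1r.
exists (K' * (1 - r')^-1); split.
  by rewrite mulr_ge0// invr_ge0 subr_ge0 ltW.
move=> K t K0 aK N.
apply: (@le_trans _ _ (\sum_(k < N) K * sqrtS t * K' * r' ^+ k)).
  apply: ler_sum => k _.
  apply: (@le_trans _ _ (r ^+ k * (K * (k.+1%:R * sqrtS t)))).
    rewrite ler_wpM2l ?exprn_ge0 ?(ltW r0)//.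
    by apply: (le_trans (aK k)); rewrite ler_wpM2l// sqrtSD.
  have -> : r ^+ k * (K * (k.+1%:R * sqrtS t)) = K * sqrtS t * (k.+1%:R * r ^+ k).
    by ring.
  by rewrite -[leRHS]mulrA ler_wpM2l ?mulr_ge0// ltW// sqrtS_gt0.
rewrite -mulr_sumr.
have -> : K * (K' / (1 - r')) * sqrtS t = K * sqrtS t * K' * (1 - r')^-1 by ring.
by apply: ler_wpM2l; [rewrite !mulr_ge0|apply: geo_sum_le; rewrite // ltW].
Qed.

(** [s t] is the discounted sum of r^k a (t+k) over all k: the scalar model of psi, which looks
    forward in time. *)
Lemma backward_sum : exists s : nat -> R,
  [/\ forall t, 0 <= s t,
      forall t, s t = a t + r * s t.+1,
      forall t N, part t N <= s t,
      osqrt s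
    & forall K, (forall T, \sum_(t < T) a t ^+ 2 <= K * T.+1%:R) ->
        exists K', forall T, \sum_(t < T) s t ^+ 2 <= K' * T.+1%:R].
Proof.
have [c [c0 hc]] := backward_part_bound.
have [K [K0 aK]] := osqrt_bound oa.
have part_nd t : nondecreasing_seq (part t).
  apply/nondecreasing_seqP => N; rewrite /part big_ord_recr/= lerDl.
  by rewrite mulr_ge0// exprn_ge0// ltW.
have part_cvg t : cvgn (part t).
  apply: nondecreasing_is_cvgn => //.
  by exists (K * c * sqrtS t) => _ [N _ <-]; apply: hc => // k; exact: aK.
pose s t := limn (part t).
have part_le t N : part t N <= s t by exact: nondecreasing_cvgn_le.
have s_le t B : (forall N, part t N <= B) -> s t <= B.
  by move=> h; apply: limr_le => //; exact: nearW.
have s0 t : 0 <= s t by apply: le_trans (part_le t 0%N); rewrite /part big_ord0.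
have srec t : s t = a t + r * s t.+1.
  have h1 : part t N.+1 @[N --> \oo] --> s t by rewrite (cvg_shiftS (part t)).
  have h2 : a t + r * part t.+1 N @[N --> \oo] --> a t + r * s t.+1.
    by apply: cvgD; [exact: cvg_cst|apply: cvgM; [exact: cvg_cst|]].
  apply: (norm_cvg_unique h1).
  rewrite (_ : (fun N => part t N.+1) = (fun N => a t + r * part t.+1 N))//.
  apply/funext => N; rewrite /part big_ord_recl/= expr0 mul1r addn0; congr (_ + _).
  rewrite mulr_sumr; apply: eq_bigr => k _.
  by rewrite /bump/= add1n exprS addSnnS mulrA.
have os : osqrt s.
  move=> e e0; have e1 : 0 < e / (c + 1) by rewrite divr_gt0//; lra.
  have [N NP] := oa e1; exists N => t Nt; apply: s_le => M.
  apply: (@le_trans _ _ (e / (c + 1) * c * sqrtS t)).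
    apply: hc => [|k]; first exact: ltW.
    by apply: NP; apply: leq_trans Nt _; rewrite leq_addr.
  apply: ler_wpM2r => //.
  rewrite -mulrA -[leRHS]mulr1; apply: ler_wpM2l; first exact: ltW.
  by rewrite mulrC ler_pdivrMr; lra.
exists s; split => // K1 aK1.
have [M [M0 sM]] := osqrt_bound os.
have d0 : 0 < 1 - r by rewrite subr_gt0.
(* Obtained by solving S <= r S + M^2 (T+1) + K1 (T+1) / (1-r) for the sum S of the squares; M^2
   (T+1) bounds the boundary term at T. *)
exists ((M ^+ 2 + K1 / (1 - r)) / (1 - r)) => T.
rewrite [leRHS]mulrAC ler_pdivlMr// mulrDl.
(* Convexity of the square with weights r and 1 - r, as a + r y = (1-r) (a / (1-r)) + r y. *)
have sq t : s t ^+ 2 <= r * s t.+1 ^+ 2 + a t ^+ 2 / (1 - r).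
  rewrite srec; set x := a t; set y := s t.+1.
  rewrite -subr_ge0.
  have -> : r * y ^+ 2 + x ^+ 2 / (1 - r) - (x + r * y) ^+ 2
     = r * (x - (1 - r) * y) ^+ 2 / (1 - r).
    by field; apply: lt0r_neq0.
  apply: divr_ge0; last exact: ltW.
  by apply: mulr_ge0; [exact: ltW|exact: sqr_ge0].
have h1 : \sum_(t < T) s t ^+ 2 <=
   r * \sum_(t < T) s t.+1 ^+ 2 + (\sum_(t < T) a t ^+ 2) / (1 - r).
  rewrite mulr_sumr mulr_suml -big_split; apply: ler_sum => t _; exact: sq.
have h2 : \sum_(t < T) s t.+1 ^+ 2 <= \sum_(t < T) s t ^+ 2 + s T ^+ 2.
  rewrite -(big_ord_recr T (fun t => s t ^+ 2))/= big_ord_recl lerDr.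
  exact: sqr_ge0.
have h3 : s T ^+ 2 <= M ^+ 2 * T.+1%:R.
  by rewrite -sqr_sqrtS -exprMn lerXn2r ?nnegrE// mulr_ge0// ltW ?sqrtS_gt0.
have h4 : (\sum_(t < T) a t ^+ 2) / (1 - r) <= K1 / (1 - r) * T.+1%:R.
  by rewrite mulrAC ler_wpM2r// ?invr_ge0 ?(ltW d0).
have h5 : r * (\sum_(t < T) s t.+1 ^+ 2) <= r * (\sum_(t < T) s t ^+ 2) + s T ^+ 2.
  apply: (le_trans (ler_wpM2l (ltW r0) h2)); rewrite mulrDr lerD2l.
  by rewrite ler_piMl ?sqr_ge0// ltW.
move: h1 h3 h4 h5; move: (\sum_(t < T) _) (\sum_(t < T) _) (_ / _) => x y z.
by nra.
Qed.

End backward_sum.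
End subdiffusive_growth.

(** * White sequences and their filters *)

Section averages.
Context {R : realType}.

Definition mavg m n (F : nat -> 'M[R]_(m, n)) (T : nat) : 'M[R]_(m, n) :=
  T%:R^-1 *: \sum_(t < T) F t.

Lemma mavgMl m n p (M : 'M[R]_(p, m)) (F : nat -> 'M[R]_(m, n)) T :
  mavg (fun t => M *m F t) T = M *m mavg F T.
Proof. by rewrite /mavg -mulmx_sumr scalemxAr. Qed.

Lemma mavgMr m n p (M : 'M[R]_(n, p)) (F : nat -> 'M[R]_(m, n)) T :
  mavg (fun t => F t *m M) T = mavg F T *m M.
Proof. by rewrite /mavg -mulmx_suml scalemxAl. Qed.

Lemma mavgD m n (F G : nat -> 'M[R]_(m, n)) T :
  mavg (fun t => F t + G t) T = mavg F T + mavg G T.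
Proof. by rewrite /mavg big_split scalerDr. Qed.

Lemma mavg_tr m n (F : nat -> 'M[R]_(m, n)) T :
  mavg (fun t => (F t)^T) T = (mavg F T)^T.
Proof.
apply/matrixP => i j; rewrite !mxE !summxE; congr (_ * _).
by apply: eq_bigr => t _; rewrite mxE.
Qed.

Lemma mavg_trace n (F : nat -> 'M[R]_n) T :
  \tr (mavg F T) = T%:R^-1 * \sum_(t < T) \tr (F t).
Proof. by rewrite /mavg mxtraceZ raddf_sum. Qed.

Lemma nrm_mavg m n (F : nat -> 'M[R]_(m, n)) T :
  nrm (mavg F T) <= T%:R^-1 * \sum_(t < T) nrm (F t).
Proof.
rewrite nrmZ ger0_norm ?invr_ge0// ler_wpM2l ?invr_ge0//; exact: nrm_sum.
Qed.

Lemma inv_natr_cvg0 : T%:R^-1 @[T --> \oo] --> (0 : R).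
Proof. by rewrite -(cvg_shiftS (fun T => T%:R^-1 : R)); exact: cvg_harmonic. Qed.

Lemma mavg_shift m n (F : nat -> 'M[R]_(m, n)) l k :
  mcvg (mavg F) l -> mcvg (mavg (fun t => F (t + k)%N)) l.
Proof.
elim: k => [|k IH] Fl.
  by apply: eq_mcvg Fl => T; congr (_ *: _); apply: eq_bigr => t _; rewrite addn0.
have /mcvg_shift Fl' := IH Fl.
have c1 : T.+1%:R / T%:R @[T --> \oo] --> (1 : R).
  rewrite -(cvg_shiftS (fun T => T.+1%:R / T%:R : R)).
  rewrite (_ : [sequence _]_n = fun n => 1 + n.+1%:R^-1); last first.
    by apply/funext => N /=; rewrite -[N.+2%:R]natr1 mulrDl divff ?mul1r.
  by have := cvgD (cvg_cst (1 : R)) (@cvg_harmonic R); rewrite addr0 => h; exact: h.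
(* Dropping the first term of T+1 consecutive ones and renormalizing changes the average by a factor
   tending to 1 and a term F k / T. *)
have h : mcvg (fun T => (T.+1%:R / T%:R) *: mavg (fun t => F (t + k)%N) T.+1
     - T%:R^-1 *: F k) (1 *: l - 0).
  apply: mcvgB => i j; under eq_fun do rewrite mxE; rewrite mxE.
    by apply: cvgM => //; exact: Fl'.
  rewrite -(mul0r (F k i j)).
  by apply: cvgM; [exact: inv_natr_cvg0|exact: cvg_cst].
rewrite scale1r subr0 in h; apply: eq_mcvg h => T.
rewrite /mavg scalerA mulrAC divff// mul1r -scalerBr; congr (_ *: _).
rewrite big_ord_recl/= addrC addKr.
by apply: eq_bigr => t _; rewrite /bump/= add1n addSnnS.
Qed.

Lemma ravg_bounded (f : nat -> R) l :
  T%:R^-1 * (\sum_(t < T) f t) @[T --> \oo] --> (l : R) ->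
  exists K, forall T, \sum_(t < T) f t <= K * T.+1%:R.
Proof.
move=> /cvgn_epsP/(_ 1 ltr01)[N NP].
have s0 : 0 <= \sum_(T < N) `|\sum_(t < T) f t| by apply: sumr_ge0.
exists (`|l| + 1 + \sum_(T < N) `|\sum_(t < T) f t|) => T.
have T1 : 1 <= T.+1%:R :> R by rewrite ler1n.
have l0 : 0 <= `|l| by [].
have [NT|TN] := leqP N T; last first.
  apply: (@le_trans _ _ (\sum_(T < N) `|\sum_(t < T) f t|)).
    rewrite (bigD1 (Ordinal TN))//=; apply: (le_trans (ler_norm _)).
    by rewrite lerDl; apply: sumr_ge0.
  by nra.
have h := NP T NT.
have h1 : T%:R^-1 * \sum_(t < T) f t <= `|l| + 1.
  by move: h; rewrite ler_norml => /andP[_ h]; have := ler_norm l; lra.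
case: T NT T1 h h1 => [|T] NT T1 h h1; first by rewrite big_ord0 mulr1; lra.
move: h1; rewrite mulrC ler_pdivrMr// => h1; apply: (le_trans h1).
have : T.+1%:R <= T.+2%:R :> R by rewrite ler_nat.
have := ler0n R T.+1; nra.
Qed.

(** The last term is a difference of consecutive partial sums, whose averages share their limit. *)
Lemma ravg_term_cvg0 (f : nat -> R) l :
  T%:R^-1 * (\sum_(t < T) f t) @[T --> \oo] --> (l : R) ->
  f T / T.+1%:R @[T --> \oo] --> (0 : R).
Proof.
move=> fl; have fl' := fl.
move: fl'; rewrite -(cvg_shiftS (fun T => T%:R^-1 * \sum_(t < T) f t : R)) => fl'.
have c : T%:R / T.+1%:R @[T --> \oo] --> (1 : R).
  rewrite (_ : (fun n => _) = fun n => 1 - n.+1%:R^-1); last first.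
    apply/funext => n; have n0 : (n.+1%:R : R) != 0 by [].
    by apply: (mulIf n0); rewrite mulrVK ?unitfE// mulrBl mulVf// mul1r -natr1 addrK.
  by have := cvgB (cvg_cst (1 : R)) (@cvg_harmonic R); rewrite subr0 => h; exact: h.
have h : T.+1%:R^-1 * (\sum_(t < T.+1) f t)
    - T%:R / T.+1%:R * (T%:R^-1 * \sum_(t < T) f t) @[T --> \oo] --> l - 1 * l.
  apply: cvgB; first exact: fl'.
  exact: (cvgM c fl).
rewrite mul1r subrr in h.
apply: eq_cvgn h => T.
rewrite big_ord_recr/= mulrDr; case: T => [|T].
  by rewrite big_ord0 !mulr0 add0r subr0 mulrC.
have -> S : T.+1%:R / T.+2%:R * (T.+1%:R^-1 * S) = T.+2%:R^-1 * S :> R.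
  by rewrite mulrA [_ / _ / _]mulrAC divff// mul1r.
by rewrite addrAC subrr add0r mulrC.
Qed.

End averages.

Section white_noise.
Context {R : realType} {nw : nat}.
Implicit Types w : nat -> 'cV[R]_nw.

Definition white w : Prop := forall k,
  mcvg (mavg (fun t => w t *m (w (t + k)%N)^T)) (k == 0%N)%:R%:M.

Variable w : nat -> 'cV[R]_nw.
Hypothesis hw : white w.

Lemma white_sqr_avg :
  T%:R^-1 * (\sum_(t < T) \sum_i w t i 0 ^+ 2) @[T --> \oo] --> (nw%:R : R).
Proof.
have /mcvg_trace := @hw 0%N; rewrite eqxx mxtrace1; apply: eq_cvgn => T; rewrite mavg_trace; congr (_ * _).
apply: eq_bigr => t _; apply: eq_bigr => i _.
by rewrite mxE big_ord1 mxE addn0 expr2.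
Qed.

Lemma white_sqr_bound : exists K, forall T, \sum_(t < T) nrm (w t) ^+ 2 <= K * T.+1%:R.
Proof.
have [K KP] := ravg_bounded (f := fun t => \sum_i w t i 0 ^+ 2) white_sqr_avg.
exists (nw%:R * K) => T; rewrite -mulrA; apply: (@le_trans _ _
  (nw%:R * \sum_(t < T) \sum_i w t i 0 ^+ 2)); last by rewrite ler_wpM2l.
by rewrite mulr_sumr; apply: ler_sum => t _; exact: nrm_sqr_le.
Qed.

(** The averages of |w_t|^2 converge, so |w_t|^2 / (t+1) tends to 0. Dividing by [nw.+1] also covers
    an empty disturbance. *)
Lemma white_osqrt : osqrt (fun t => nrm (w t)).
Proof.
move=> e e0; have /cvgn_epsP := ravg_term_cvg0 (f := fun t => \sum_i w t i 0 ^+ 2) white_sqr_avg.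
have e1 : 0 < e ^+ 2 / nw.+1%:R by rewrite divr_gt0// exprn_gt0.
move=> /(_ _ e1)[N NP]; exists N => t /NP; rewrite subr0 => h.
rewrite -(ler_pXn2r (_ : 0 < 2)%N) ?nnegrE ?nrm_ge0 ?mulr_ge0 ?sqrtS_ge0 ?(ltW e0)//.
apply: (le_trans (nrm_sqr_le _)); rewrite exprMn sqr_sqrtS.
have {h} := le_trans (ler_norm _) h; rewrite ler_pdivrMr// => h.
apply: (@le_trans _ _ (nw%:R * (e ^+ 2 / nw.+1%:R * t.+1%:R))).
  by rewrite ler_wpM2l.
rewrite mulrA ler_wpM2r// mulrCA ler_piMr ?sqr_ge0// ler_pdivrMr// mul1r.
by rewrite ler_nat.
Qed.

Section filtered.
Variables (n : nat) (B : 'M[R]_n) (G : 'M[R]_(n, nw)).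
Hypothesis hB : Defs.Schur B^T.

Let trB k : (B^T) ^+ k = (B ^+ k)^T.
Proof.
elim: k => [|k IH]; first by rewrite !expr0 trmx1.
by rewrite exprS exprSr IH -!mulmxE trmx_mul.
Qed.

(** The Schur hypothesis is on [B^T] because [B] will be the transpose of [Ahat]; the entrywise norm
    ignores transposition. *)
Lemma nrm_filter_decay : geo_decay (fun k => nrm (B ^+ k)).
Proof.
have [K [r [K0 r0 r1 h]]] := Schur_nrm_decay hB.
by exists K, r; split => // k; rewrite -nrm_tr -trB.
Qed.

Lemma mcvg_series m p (F : nat -> 'M[R]_(m, p)) (g : nat -> R) c :
  (forall k, nrm (F k) <= g k) -> (forall N, \sum_(k < N) g k <= c) ->
  exists2 l, mcvg (fun N => \sum_(k < N) F k) l & nrm l <= c.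
Proof.
move=> Fg gc; have g0 k : 0 <= g k by apply: le_trans (Fg k); exact: nrm_ge0.
have cv i j : cvgn (fun N => (\sum_(k < N) F k) i j).
  have -> : (fun N => (\sum_(k < N) F k) i j) = series (fun k => F k i j).
    by apply/funext => N; rewrite summxE /series/= big_mkord.
  apply: normed_cvg; apply: (@series_le_cvg _ _ g) => //.
  - by move=> k; exact: normr_ge0.
  - by move=> k; exact: (le_trans (nrm_entry _ _ _) (Fg k)).
  apply: nondecreasing_is_cvgn.
    apply/nondecreasing_seqP => N.
    by rewrite /series/= !big_mkord big_ord_recr lerDl.
  by exists c => _ [N _ <-]; rewrite /series/= big_mkord.
pose l := \matrix_(i, j) limn (fun N => (\sum_(k < N) F k) i j).
have hl : mcvg (fun N => \sum_(k < N) F k) l by move=> i j; rewrite mxE; exact: cv.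
exists l => //; apply/ler_addgt0Pr => e e0.
have /mcvgP/cvgn_epsP/(_ e e0)[N /(_ N (leqnn N))] := hl.
rewrite subr0 ger0_norm ?nrm_ge0// => h.
rewrite -[l](subrK (\sum_(k < N) F k)) (le_trans (nrmD _ _))// addrC lerD//.
  by apply: (le_trans (nrm_sum _ _)); apply: le_trans (gc N); apply: ler_sum.
by rewrite -opprB nrmN.
Qed.

(** The matrix series is dominated termwise by the scalar backward sum of K |G w_t|, from which
    convergence, growth and the bound on the squares are inherited. *)
Lemma filtered_noise : exists psi : nat -> 'cV[R]_n,
  [/\ forall t, mcvg (fun N => \sum_(k < N) B ^+ k *m (G *m w (t + k)%N)) (psi t),
      forall t, psi t = G *m w t + B *m psi t.+1,
      osqrt (fun t => nrm (psi t))
    & exists K, forall T, \sum_(t < T) nrm (psi t) ^+ 2 <= K * T.+1%:R].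
Proof.
have [K [r [K0 r0 r1 hK]]] := nrm_filter_decay.
have oG : osqrt (fun t => K * nrm (G *m w t)).
  apply: osqrtZ => //; apply: (osqrt_le (b := fun t => nrm G * nrm (w t))).
    by move=> t; exact: nrmM.
  by apply: osqrtZ; [exact: nrm_ge0|exact: white_osqrt].
have a0 t : 0 <= K * nrm (G *m w t) by rewrite mulr_ge0 ?nrm_ge0.
have [s [s0 _ part_s os bs]] := backward_sum a0 r0 r1 oG.
have ex t : exists l, mcvg (fun N => \sum_(k < N) B ^+ k *m (G *m w (t + k)%N)) l
    /\ nrm l <= s t.
  have Fg k : nrm (B ^+ k *m (G *m w (t + k)%N)) <=
      r ^+ k * (K * nrm (G *m w (t + k)%N)).
    rewrite mulrA [r ^+ k * K]mulrC; apply: le_trans (nrmM _ _) _.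
    by rewrite ler_wpM2r ?nrm_ge0.
  by have [l h1 h2] := mcvg_series Fg (part_s t); exists l.
have [psi hpsi] := choice ex.
have cpsi t := (hpsi t).1; have ps t := (hpsi t).2.
exists psi; split => //.
- move=> t; have /mcvg_shift h1 := cpsi t.
  apply: (mcvg_unique h1).
  have h2 := mcvgD (mcvg_cst (G *m w t)) (mcvgMl B (cpsi t.+1)).
  apply: eq_mcvg h2 => N; rewrite big_ord_recl/= expr0 mul1mx addn0; congr (_ + _).
  rewrite mulmx_sumr; apply: eq_bigr => k _.
  by rewrite /bump/= add1n exprS -mulmxE -!mulmxA addSnnS.
- exact: osqrt_le os.
have [K1 hK1] := white_sqr_bound.
have [T|K2 hK2] := bs ((K * nrm G) ^+ 2 * K1).
  rewrite -mulrA.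
  apply: (@le_trans _ _ ((K * nrm G) ^+ 2 * \sum_(t < T) nrm (w t) ^+ 2)).
    rewrite mulr_sumr; apply: ler_sum => t _; rewrite -exprMn lerXn2r ?nnegrE//.
      by rewrite !mulr_ge0 ?nrm_ge0.
    by rewrite -mulrA ler_wpM2l// nrmM.
  by rewrite ler_wpM2l// sqr_ge0.
exists K2 => T; apply: le_trans (hK2 T).
by apply: ler_sum => t _; rewrite lerXn2r// nnegrE// nrm_ge0.
Qed.

(** psi_(t+1) involves only w at strictly positive lags from t. Whiteness handles finitely many
    lags; the remainder after m lags is O((m+1) r^m) uniformly in T, which permits letting m
    grow. *)
Lemma white_cross_avg (psi : nat -> 'cV[R]_n) :
  (forall t, psi t = G *m w t + B *m psi t.+1) ->
  (exists K, forall T, \sum_(t < T) nrm (psi t) ^+ 2 <= K * T.+1%:R) ->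
  mcvg (mavg (fun t => w t *m (psi t.+1)^T)) 0.
Proof.
move=> rec [K hK]; have [Kw hKw] := white_sqr_bound.
have unroll m t : psi t.+1 =
    \sum_(k < m) B ^+ k *m (G *m w (t + k.+1)%N) + B ^+ m *m psi (t.+1 + m)%N.
  elim: m => [|m IH]; first by rewrite big_ord0 add0r expr0 mul1mx addn0.
  rewrite IH big_ord_recr/= -addrA; congr (_ + _).
  by rewrite rec mulmxDr !addSn !addnS exprSr -mulmxE !mulmxA.
have trunc m : mcvg (mavg (fun t => w t *m
    (\sum_(k < m) B ^+ k *m (G *m w (t + k.+1)%N))^T)) 0.
  elim: m => [|m IH].
    apply: eq_mcvg (mcvg_cst 0) => T.
    by rewrite /mavg big1 ?scaler0// => t _; rewrite big_ord0 trmx0 mulmx0.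
  have hm : mcvg (mavg (fun t => w t *m (w (t + m.+1)%N)^T)) 0.
    by have := @hw m.+1; rewrite raddf0.
  have h := mcvgD IH (mcvgMr (B ^+ m *m G)^T hm).
  rewrite mul0mx addr0 in h; apply: eq_mcvg h => T.
  rewrite -mavgMr -mavgD; congr (_ *: _); apply: eq_bigr => t _.
  by rewrite big_ord_recr/= linearD/= mulmxDr !trmx_mul !mulmxA.
have [C [r [C0 r0 r1 hC]]] := nrm_filter_decay.
pose rem m T := mavg (fun t => w t *m (B ^+ m *m psi (t.+1 + m)%N)^T) T.
have split_avg m T : mavg (fun t => w t *m (psi t.+1)^T) T = mavg (fun t => w t *m
    (\sum_(k < m) B ^+ k *m (G *m w (t + k.+1)%N))^T) T + rem m T.
  rewrite -mavgD; congr (_ *: _); apply: eq_bigr => t _.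
  by rewrite (unroll m) linearD/= mulmxDr.
(* The factors 2 and 3 come from T+2 <= 2(T+1) and m+T+3 <= 3(m+1)(T+1). *)
pose D := 2 * `|Kw| + 3 * `|K|.
have D0 : 0 <= D by rewrite addr_ge0 ?mulr_ge0.
have rem_le m T : nrm (rem m T) <= D * C * (m.+1%:R * r ^+ m).
  apply: (le_trans (nrm_mavg _ _)).
  case: T => [|T].
    by rewrite big_ord0 mulr0 !mulr_ge0// exprn_ge0// ltW.
  rewrite mulrC ler_pdivrMr//.
  apply: (@le_trans _ _ (\sum_(t < T.+1)
      C * r ^+ m * (nrm (w t) ^+ 2 + nrm (psi (t.+1 + m)%N) ^+ 2))).
    apply: ler_sum => t _; apply: (le_trans (nrmM _ _)); rewrite nrm_tr.
    apply: (@le_trans _ _ (nrm (w t) * (C * r ^+ m * nrm (psi (t.+1 + m)%N)))).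
      apply: ler_wpM2l; first exact: nrm_ge0.
      apply: (le_trans (nrmM _ _)); apply: ler_wpM2r => //; exact: nrm_ge0.
    rewrite mulrCA; apply: ler_wpM2l; first by rewrite mulr_ge0// exprn_ge0// ltW.
    have := nrm_ge0 (w t); have := nrm_ge0 (psi (t.+1 + m)%N).
    move: (nrm _) (nrm _) => x y x0 y0; have := sqr_ge0 (x - y); nra.
  rewrite -mulr_sumr big_split/=.
  have h1 : \sum_(t < T.+1) nrm (w t) ^+ 2 <= 2 * `|Kw| * T.+1%:R.
    apply: (le_trans (hKw _)); apply: (@le_trans _ _ (`|Kw| * (2 * T.+1%:R))).
      apply: (le_trans (ler_wpM2r _ (ler_norm Kw))) => //; apply: ler_wpM2l => //.
      by rewrite -natrM ler_nat; lia.
    by rewrite mulrCA mulrA.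
  (* The shifted window is enlarged to start at 0, where the bound on squares applies; this costs
     the factor m+1. *)
  have h2 : \sum_(t < T.+1) nrm (psi (t.+1 + m)%N) ^+ 2 <=
      3 * `|K| * m.+1%:R * T.+1%:R.
    apply: (@le_trans _ _ (\sum_(t < m.+1 + T.+1) nrm (psi t) ^+ 2)).
      rewrite big_split_ord/= addrC.
      rewrite (eq_bigr (fun t : 'I_T.+1 => nrm (psi (m.+1 + t)%N) ^+ 2)); last first.
        by move=> t _; congr (nrm (psi _) ^+ 2); lia.
      by rewrite lerDl; apply: sumr_ge0 => t _; exact: sqr_ge0.
    apply: (le_trans (hK _)); apply: (@le_trans _ _ (`|K| * (3 * (m.+1%:R * T.+1%:R)))).
      apply: (le_trans (ler_wpM2r _ (ler_norm K))) => //; apply: ler_wpM2l => //.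
      by rewrite -!natrM ler_nat; nia.
    by rewrite mulrCA !mulrA.
  have Cr : 0 <= C * r ^+ m by rewrite mulr_ge0// exprn_ge0// ltW.
  apply: (le_trans (ler_wpM2l Cr (lerD h1 h2))).
  have m1 : 1 <= m.+1%:R :> R by rewrite ler1n.
  have -> : D * C * (m.+1%:R * r ^+ m) * T.+1%:R = C * r ^+ m *
      (2 * `|Kw| * m.+1%:R * T.+1%:R + 3 * `|K| * m.+1%:R * T.+1%:R).
    by rewrite /D; ring.
  apply: ler_wpM2l => //; rewrite lerD2r; apply: ler_wpM2r => //.
  by rewrite -[leLHS]mulr1; apply: ler_wpM2l; rewrite ?mulr_ge0.
have rem_small e : 0 < e -> exists m, forall T, nrm (rem m T) <= e.
  move=> e0; have : geo_decay (fun m => m.+1%:R * r ^+ m).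
    by apply: geo_decay_linear; exists 1, r; split=> // k; rewrite mul1r.
  move=> [K' [r' [K'0 r'0 r'1 h]]].
  have c0 : D * C * K' * r' ^+ m @[m --> \oo] --> D * C * K' * 0.
    apply: cvgM; first exact: cvg_cst.
    by apply: cvg_expr; rewrite ger0_norm// ltW.
  rewrite mulr0 in c0.
  have [m /(_ m (leqnn m))] := (cvgn_epsP _ _).1 c0 _ e0.
  rewrite subr0 => hm; exists m => T; apply: (le_trans (rem_le m T)).
  apply: le_trans hm; apply: le_trans (ler_norm _); rewrite -[leRHS]mulrA.
  by apply: ler_wpM2l; rewrite ?mulr_ge0.
apply/mcvgP/cvgn_epsP => e e0; have e2 : 0 < e / 2 by rewrite divr_gt0.
have [m hm] := rem_small _ e2.
have /mcvgP/cvgn_epsP/(_ _ e2)[N hN] := trunc m.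
exists N => T NT; rewrite !subr0 ger0_norm ?nrm_ge0// (split_avg m).
apply: (le_trans (nrmD _ _)); rewrite (splitr e); apply: lerD; last exact: hm.
by have := hN T NT; rewrite !subr0 ger0_norm ?nrm_ge0.
Qed.

Lemma white_gram_avg (psi : nat -> 'cV[R]_n) X :
  (forall t, psi t = G *m w t + B *m psi t.+1) ->
  (exists K, forall T, \sum_(t < T) nrm (psi t) ^+ 2 <= K * T.+1%:R) ->
  osqrt (fun t => nrm (psi t)) ->
  X - B *m X *m B^T = G *m G^T ->
  mcvg (mavg (fun t => psi t *m (psi t)^T)) X.
Proof.
move=> rec bnd opsi hX; have cross := white_cross_avg rec bnd.
have [L [Lc LK _]] := lyapunov_inverse hB; rewrite trmxK in LK.
pose F := mavg (fun t => psi t *m (psi t)^T).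
(* Boundary defect: the average of the Gram matrices of psi_(t+1) minus that of psi_t. *)
pose b T := T%:R^-1 *: (psi T *m (psi T)^T) - T%:R^-1 *: (psi 0%N *m (psi 0%N)^T).
have b0 : mcvg b (0 - 0).
  apply: mcvgB.
    (* The 2 accounts for dividing by T here and by T+1 in [osqrtM_cvg]. *)
    apply: (@mcvg_squeeze _ _ _ _ _ (fun T => 2 * (nrm (psi T) * nrm (psi T) / T.+1%:R))).
      case=> [|T]; rewrite subr0 nrmZ; first by rewrite invr0 normr0 mul0r !mulr_ge0 ?nrm_ge0.
      rewrite ger0_norm//; apply: (@le_trans _ _ (T.+1%:R^-1 * (nrm (psi T.+1) * nrm (psi T.+1)))).
        by apply: ler_wpM2l => //; apply: le_trans (nrmM _ _) _; rewrite nrm_tr.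
      rewrite mulrC [leRHS]mulrCA; apply: ler_wpM2l; first by rewrite mulr_ge0 ?nrm_ge0.
      rewrite ler_pdivlMr// mulrC ler_pdivrMr// -natrM ler_nat; lia.
    have h := cvgM (cvg_cst (2 : R)) (osqrtM_cvg (fun t => nrm_ge0 (psi t))
      (fun t => nrm_ge0 (psi t)) opsi opsi).
    by rewrite mulr0 in h; exact: h.
  move=> i j; under eq_fun do rewrite mxE.
  have -> : (0 : 'M[R]_n) i j = 0 by rewrite mxE.
  rewrite -(mul0r ((psi 0%N *m (psi 0%N)^T) i j)).
  by apply: cvgM; [exact: inv_natr_cvg0|exact: cvg_cst].
have Fshift T : mavg (fun t => psi t.+1 *m (psi t.+1)^T) T = F T + b T.
  rewrite /F /b /mavg -scalerBr -scalerDr; congr (_ *: _).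
  rewrite addrA -(big_ord_recr T (fun t => psi t *m (psi t)^T))/=.
  by rewrite big_ord_recl/= addrAC subrr add0r.
have eqF T : F T - B *m F T *m B^T = G *m mavg (fun t => w t *m (w t)^T) T *m G^T
    + G *m mavg (fun t => w t *m (psi t.+1)^T) T *m B^T
    + B *m (mavg (fun t => w t *m (psi t.+1)^T) T)^T *m G^T + B *m b T *m B^T.
  apply/eqP; rewrite subr_eq -addrA -mulmxDl -mulmxDr [b T + F T]addrC -Fshift.
  rewrite -mavg_tr -!mavgMl -!mavgMr -!mavgD; apply/eqP; congr (_ *: _).
  apply: eq_bigr => t _; rewrite {1 2}rec linearD/= mulmxDl !mulmxDr !trmx_mul trmxK.
  by rewrite !mulmxA !addrA.
(* Only F - B F B^T is known to converge; the continuous inverse [L] recovers F. *)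
apply: (@eq_mcvg _ _ _ (fun T => L (F T - B *m F T *m B^T))); first by move=> T; exact: (esym (LK (F T))).
rewrite -(LK X); apply: Lc; rewrite hX.
have h0 : mcvg (mavg (fun t => w t *m (w t)^T)) 1%:M.
  by apply: eq_mcvg (@hw 0%N) => T; congr (_ *: _); apply: eq_bigr => t _; rewrite addn0.
have h := mcvgD (mcvgD (mcvgD (mcvgMr G^T (mcvgMl G h0)) (mcvgMr B^T (mcvgMl G cross)))
   (mcvgMr G^T (mcvgMl B (mcvg_tr cross)))) (mcvgMr B^T (mcvgMl B b0)).
rewrite subr0 trmx0 !mulmx0 !mul0mx !addr0 mulmx1 in h.
by apply: eq_mcvg h => T; rewrite eqF.
Qed.

End filtered.
End white_noise.

(** * Completion of squares and average costs *)

Section inner_product.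
Context {R : realType}.

Definition dot n (a b : 'cV[R]_n) : R := (a^T *m b) 0 0.

Lemma dotC n (a b : 'cV[R]_n) : dot a b = dot b a.
Proof. by rewrite /dot -{1}[b]trmxK -trmx_mul mxE. Qed.

Lemma dotDl n (a b c : 'cV[R]_n) : dot (a + b) c = dot a c + dot b c.
Proof. by rewrite /dot linearD/= mulmxDl mxE. Qed.

Lemma dotDr n (a b c : 'cV[R]_n) : dot a (b + c) = dot a b + dot a c.
Proof. by rewrite /dot mulmxDr mxE. Qed.

Lemma dotBr n (a b c : 'cV[R]_n) : dot a (b - c) = dot a b - dot a c.
Proof. by rewrite /dot mulmxBr mxE; congr (_ + _); rewrite mxE. Qed.

Lemma dotMl m n (M : 'M[R]_(m, n)) a b : dot (M *m a) b = dot a (M^T *m b).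
Proof. by rewrite /dot trmx_mul mulmxA. Qed.

Lemma dot_trace n (a b : 'cV[R]_n) : dot a b = \tr (b *m a^T).
Proof. by rewrite mxtrace_mulC /mxtrace big_ord1. Qed.

Lemma quadE n (M : 'M[R]_n) v : quad M v = dot v (M *m v).
Proof. by rewrite /quad /dot mulmxA. Qed.

Lemma quad_trace n (M : 'M[R]_n) v : quad M v = \tr (M *m (v *m v^T)).
Proof. by rewrite quadE dot_trace mulmxA. Qed.

Lemma dot_le_nrm n (a b : 'cV[R]_n) : `|dot a b| <= nrm a * nrm b.
Proof. by rewrite /dot -nrm_ord1 -(nrm_tr a); exact: nrmM. Qed.

Lemma quad_le_nrm n (M : 'M[R]_n) v : `|quad M v| <= nrm M * nrm v ^+ 2.
Proof.
rewrite quadE; apply: le_trans (dot_le_nrm _ _) _; rewrite mulrC expr2 mulrA.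
by apply: ler_wpM2r; [exact: nrm_ge0|exact: nrmM].
Qed.

Lemma trace_le_nrm n (M : 'M[R]_n) : `|\tr M| <= nrm M.
Proof.
apply: le_trans (ler_norm_sum _ _ _) _; apply: ler_sum => i _.
by rewrite (bigD1 i)//= lerDl; apply: sumr_ge0.
Qed.

Lemma dot_symM n (M : 'M[R]_n) a b : M^T = M -> dot a (M *m b) = dot b (M *m a).
Proof. by move=> MT; rewrite dotC dotMl MT. Qed.

Lemma quadD n (M : 'M[R]_n) a b : M^T = M ->
  quad M (a + b) = quad M a + 2 * dot a (M *m b) + quad M b.
Proof.
move=> MT; rewrite !quadE mulmxDr dotDl !dotDr [dot b (M *m a)]dot_symM//.
ring.
Qed.

Lemma quad_ge0 n (M : 'M[R]_n) v : posdef M -> 0 <= quad M v.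
Proof.
move=> [_ h]; have [->|v0] := eqVneq v 0; last exact/ltW/h.
by rewrite quadE mulmx0 /dot mulmx0 mxE.
Qed.

Lemma posdef_unit n (M : 'M[R]_n) : posdef M -> M \in unitmx.
Proof.
move=> [MT h]; rewrite -row_free_unit; apply: inj_row_free => v vM.
apply/eqP; rewrite -(inj_eq trmx_inj) trmx0; apply: contraT => v0.
by have := h _ v0; rewrite /quad trmxK vM mul0mx mxE ltxx.
Qed.

End inner_product.

(** * Schur recursions driven by a forcing term *)

Section stable_recursion.
Context {R : realType}.

(** Kept as a recursion, not a convolution sum, so that squares and expectations pass through it by
    induction. *)
Fixpoint majorant (r a : R) (b : nat -> R) (t : nat) : R :=
  if t is s.+1 then r * majorant r a b s + b s else a.

(** A Schur matrix need not contract the norm, so a one-step estimate would multiply by K at every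
    step. Bounding all the A^k x_t at once, by K r^k times the majorant, pays K only once. *)
Lemma stable_majorant n (A : 'M[R]_n) : Defs.Schur A ->
  exists K r, [/\ 0 <= K, 0 < r, r < 1 & forall x f : nat -> 'cV[R]_n,
    (forall t, x t.+1 = A *m x t + f t) ->
    forall t, nrm (x t) <= K * majorant r (nrm (x 0%N)) (fun s => nrm (f s)) t].
Proof.
move=> hA; have [K [r [K0 r0 r1 hK]]] := Schur_nrm_decay hA.
exists K, r; split => // x f xf t.
suff h k : nrm (A ^+ k *m x t) <=
    K * r ^+ k * majorant r (nrm (x 0%N)) (fun s => nrm (f s)) t.
  by have := h 0%N; rewrite !expr0 mul1mx mulr1.
elim: t k => [|t IH] k /=.
  by apply: le_trans (nrmM _ _) _; apply: ler_wpM2r => //; exact: nrm_ge0.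
rewrite xf mulmxDr mulmxA; apply: le_trans (nrmD _ _) _; rewrite mulrDr.
apply: lerD; first by rewrite mulmxE -exprSr mulrA -[K * _ * r]mulrA -exprSr.
by apply: le_trans (nrmM _ _) _; apply: ler_wpM2r => //; exact: nrm_ge0.
Qed.

Lemma majorant_ge0 r a b t : 0 <= r -> 0 <= a -> (forall s, 0 <= b s) ->
  0 <= majorant r a b t.
Proof. by move=> r0 a0 b0; elim: t => [//|t IH]; rewrite /= addr_ge0 ?mulr_ge0. Qed.

Lemma stable_osqrt n (A : 'M[R]_n) (x f : nat -> 'cV[R]_n) : Defs.Schur A ->
  (forall t, x t.+1 = A *m x t + f t) -> osqrt (fun t => nrm (f t)) ->
  osqrt (fun t => nrm (x t)).
Proof.
move=> hA xf of_; have [K [r [K0 r0 r1 h]]] := stable_majorant hA.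
apply: (osqrt_le (h x f xf)); apply: osqrtZ => //.
apply: (osqrt_rec (ltW r0) r1 _ _ of_) => t; last exact: lexx.
by apply: majorant_ge0 => [||s]; [exact: ltW|exact: nrm_ge0|exact: nrm_ge0].
Qed.

Lemma cvgn0_squeeze (u e : nat -> R) : (forall t, `|u t| <= e t) ->
  e t @[t --> \oo] --> (0 : R) -> u t @[t --> \oo] --> (0 : R).
Proof.
move=> ue e0; apply/cvgn_epsP => d d0; have [N NP] := (cvgn_epsP _ _).1 e0 d d0.
exists N => t /NP; rewrite !subr0 => h.
exact: le_trans (ue t) (le_trans (ler_norm _) h).
Qed.

Lemma osqrtM_mean_cvg (a b : nat -> R) : (forall t, 0 <= a t) -> (forall t, 0 <= b t) ->
  osqrt a -> osqrt b -> T%:R^-1 * (a T * b T) @[T --> \oo] --> (0 : R).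
Proof.
move=> a0 b0 oa ob; have h := osqrtM_cvg a0 b0 oa ob.
have {}h : 2 * (a t * b t / t.+1%:R) @[t --> \oo] --> (2 * 0 : R).
  by apply: cvgM; [exact: cvg_cst|exact: h].
rewrite mulr0 in h; apply: (squeeze_cvgr _ (cvg_cst 0) h).
apply: nearW => -[|T]; first by rewrite invr0 mul0r lexx !mulr_ge0.
rewrite !mulr_ge0//= mulrC [leRHS]mulrCA; apply: ler_wpM2l; first exact: mulr_ge0.
by rewrite ler_pdivlMr// mulrC ler_pdivrMr// -natrM ler_nat; lia.
Qed.

End stable_recursion.

(** * The regulator identity and its consequences along a trajectory *)

Section regulator.
Context {R : realType} {nx nu nw : nat}.
Variables (A : 'M[R]_nx) (Bu : 'M[R]_(nx, nu)) (Bw : 'M[R]_(nx, nw)).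
Variables (Q : 'M[R]_nx) (Ru : 'M[R]_nu) (P : 'M[R]_nx).
Hypothesis hP : stabilizing_solution A Bu Q Ru P.

Local Notation H := (Hmx Bu Ru P).
Local Notation Kx := (Kx A Bu Ru P).
Local Notation Kw := (Kw Bu Bw Ru P).
Local Notation Kv := (Kv Bu Ru P).
Local Notation Ah := (Ahat A Bu Ru P).
Local Notation M := (Bu *m invmx H *m Bu^T).

Let PT : P^T = P. Proof. by case: hP => -[]. Qed.
Let Hpos : posdef H. Proof. by case: hP. Qed.
Let HT : H^T = H. Proof. by case: Hpos. Qed.
Let Hu : H \in unitmx. Proof. exact: posdef_unit. Qed.
Let HiT : (invmx H)^T = invmx H. Proof. by rewrite trmx_inv HT. Qed.
Let MT : M^T = M. Proof. by rewrite !trmx_mul trmxK HiT mulmxA. Qed.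
Let AhT : Ah^T = A^T - A^T *m P *m M.
Proof.
by rewrite /Ahat /Defs.Kx linearB/= !trmx_mul trmxK PT HiT !mulmxA.
Qed.

(* Running cost of the disturbance [w] when [v] summarizes the later ones. *)
Definition noise_cost (w : 'cV[R]_nw) (v : 'cV[R]_nx) : R :=
  quad P (Bw *m w) + 2 * dot (Bw *m w) v - quad M (P *m Bw *m w + v).

Definition storage (x v : 'cV[R]_nx) : R := quad P x + 2 * dot x v.

Definition input_excess (x : 'cV[R]_nx) u (w : 'cV[R]_nw) (v : 'cV[R]_nx) :
  'cV[R]_nu := u + Kx *m x + Kw *m w + Kv *m v.

(** As a function of u, stage cost plus next storage is u'Hu + 2 u'q plus terms free of u, hence the
    square of u + H^-1 q. The Riccati equation ([s8]) removes the terms quadratic in x, and the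
    expression of [Ah^T] ([s7]) those bilinear in x and psi. *)
Lemma completion_of_squares x u w v :
  quad Q x + quad Ru u =
  storage x (Ah^T *m (P *m Bw *m w + v))
  - storage (A *m x + Bu *m u + Bw *m w) v
  + quad H (input_excess x u w v) + noise_cost w v.
Proof.
set d := Bw *m w; have dE : P *m Bw *m w = P *m d by rewrite mulmxA.
set psi := P *m Bw *m w + v; pose y := A *m x + d.
pose q := Bu^T *m (P *m y + v).
have qE : q = Bu^T *m (P *m (A *m x) + psi).
  by rewrite /q /psi /y dE [P *m (_ + d)]mulmxDr addrA.
have eE : input_excess x u w v = u + invmx H *m q.
  rewrite /input_excess /Defs.Kx /Defs.Kw /Defs.Kv qE /psi !mulmxDr -!addrA.
  by rewrite !mulmxA.
have s1 : quad H (input_excess x u w v) =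
    quad H u + 2 * dot u q + dot q (invmx H *m q).
  by rewrite eE quadD// mulKVmx// (quadE _ (_ *m q)) mulKVmx// dotMl HiT.
have s2 : quad H u = quad Ru u + quad P (Bu *m u).
  rewrite !quadE /Hmx mulmxDl dotDr; congr (_ + _).
  by rewrite dotMl !mulmxA.
have s3 : storage (A *m x + Bu *m u + Bw *m w) v =
    quad P y + 2 * dot y v + quad P (Bu *m u) + 2 * dot u q.
  rewrite /storage addrAC -/d -/y quadD// [dot (y + _) v]dotDl /q.
  have -> : dot u (Bu^T *m (P *m y + v)) = dot y (P *m (Bu *m u)) + dot (Bu *m u) v.
    by rewrite -dotMl dotDr dot_symM.
  ring.
have s4 : dot q (invmx H *m q) =
    quad M (P *m (A *m x)) + 2 * dot (P *m (A *m x)) (M *m psi) + quad M psi.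
  by rewrite -quadD// qE dotMl trmxK quadE !mulmxA.
have s5 : quad P y = quad P (A *m x) + 2 * dot (A *m x) (P *m d) + quad P d.
  by rewrite quadD.
have s6 : dot y v = dot (A *m x) v + dot d v by rewrite dotDl.
have s7 : dot x (Ah^T *m psi) = dot (A *m x) (P *m d) + dot (A *m x) v
    - dot (P *m (A *m x)) (M *m psi).
  rewrite AhT mulmxBl dotBr -dotMl /psi dE dotDr; congr (_ - _).
  by rewrite !dotMl PT !mulmxA.
have s8 : quad P x = quad Q x + quad P (A *m x) - quad M (P *m (A *m x)).
  have [_ ric _ _] := hP.
  have -> : quad P (A *m x) = quad (A^T *m P *m A) x.
    by rewrite !quadE dotMl !mulmxA.
  have -> : quad M (P *m (A *m x)) = quad (A^T *m P *m Bu *m invmx H *m Bu^T *m P *m A) x.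
    by rewrite !quadE !dotMl PT !mulmxA.
  rewrite !quadE -dotDr -dotBr -mulmxDl -mulmxBl; congr (dot _ (_ *m _)).
  move: ric => /eqP; rewrite eq_sym addr_eq0 subr_eq subr_eq => /eqP h.
  by rewrite {1}h -addrA addrC.
rewrite s1 s2 s3 s4 /noise_cost -/d s5 s6 -/psi /storage s7 s8.
ring.
Qed.

Section trajectory.
Variables (w : nat -> 'cV[R]_nw) (psi : nat -> 'cV[R]_nx).
Variables (x : nat -> 'cV[R]_nx) (u : nat -> 'cV[R]_nu).
Hypothesis psi_rec : forall t, psi t = P *m Bw *m w t + Ah^T *m psi t.+1.
Hypothesis x_rec : forall t, x t.+1 = A *m x t + Bu *m u t + Bw *m w t.

Let v t := Ah^T *m psi t.
Let V t := storage (x t) (v t).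

Lemma cost_decomposition T :
  T%:R^-1 * \sum_(t < T) (quad Q (x t) + quad Ru (u t)) =
  T%:R^-1 * (V 0%N - V T)
  + T%:R^-1 * (\sum_(t < T) quad H (input_excess (x t) (u t) (w t) (v t.+1)))
  + T%:R^-1 * (\sum_(t < T) noise_cost (w t) (v t.+1)).
Proof.
rewrite -!mulrDr; congr (_ * _); elim: T => [|T IH].
  by rewrite !big_ord0 subrr !addr0.
rewrite !big_ord_recr/= IH (completion_of_squares _ _ (w T) (v T.+1)).
rewrite -[P *m Bw *m w T + v T.+1]psi_rec -x_rec -!/(V _).
ring.
Qed.

End trajectory.

Let hSchur : Defs.Schur Ah. Proof. by case: hP. Qed.

Definition optimal_noncausal_cost (X : 'M[R]_nx) : R :=
  \tr (P *m Bw *m Bw^T) - \tr (H *m Kv *m X *m Kv^T).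

Lemma storage_le_nrm x p :
  `|storage x (Ah^T *m p)| <= nrm P * nrm x ^+ 2 + 2 * (nrm x * (nrm Ah * nrm p)).
Proof.
apply: le_trans (ler_normD _ _) _; apply: lerD; first exact: quad_le_nrm.
rewrite normrM ger0_norm//; apply: ler_wpM2l => //.
apply: le_trans (dot_le_nrm _ _) _; apply: ler_wpM2l; first exact: nrm_ge0.
by rewrite -(nrm_tr Ah); exact: nrmM.
Qed.

Section noise.
Variables (w : nat -> 'cV[R]_nw) (psi : nat -> 'cV[R]_nx) (X : 'M[R]_nx).
Hypothesis hw : white w.
Hypothesis psi_rec : forall t, psi t = P *m Bw *m w t + Ah^T *m psi t.+1.
Hypothesis psi_bnd : exists K, forall T, \sum_(t < T) nrm (psi t) ^+ 2 <= K * T.+1%:R.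
Hypothesis psi_o : osqrt (fun t => nrm (psi t)).
Hypothesis hX : lyapunov A Bu Bw Ru P X.

Let hB : Defs.Schur Ah^T^T. Proof. by rewrite trmxK. Qed.

Lemma psi_gram_avg : mcvg (mavg (fun t => psi t *m (psi t)^T)) X.
Proof.
apply: (white_gram_avg hw hB (G := P *m Bw)) => //.
rewrite trmxK trmx_mul PT mulmxA; apply/eqP; rewrite subr_eq eq_sym addrC.
by move: hX => /eqP; rewrite addrAC subr_eq0.
Qed.

Lemma noise_cost_avg :
  T%:R^-1 * (\sum_(t < T) noise_cost (w t) (Ah^T *m psi t.+1)) @[T --> \oo] -->
  optimal_noncausal_cost X.
Proof.
have cross := white_cross_avg hw hB psi_rec psi_bnd.
have h0 : mcvg (mavg (fun t => w t *m (w t)^T)) 1%:M.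
  by apply: eq_mcvg (@hw 0%N) => T; congr (_ *: _); apply: eq_bigr => t _; rewrite addn0.
have h1 := mcvg_trace (mcvgMr Bw^T (mcvgMl (P *m Bw) h0)).
have h2 := mcvg_trace (mcvgMr Bw^T (mcvgMl Ah^T (mcvg_tr cross))).
have h3 := mcvg_trace (mcvgMl M psi_gram_avg).
rewrite mulmx1 in h1; rewrite trmx0 mulmx0 mul0mx mxtrace0 in h2.
(* The limit is split as the three terms of [noise_cost], the middle one being the vanishing cross
   moment; cyclicity of the trace and H^-1 H = 1 give the last. *)
have -> : optimal_noncausal_cost X = \tr (P *m Bw *m Bw^T) + 2 * 0 - \tr (M *m X).
  rewrite mulr0 addr0 /optimal_noncausal_cost; congr (_ - _).
  rewrite mxtrace_mulC /Defs.Kv trmx_mul trmxK HiT !mulmxA.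
  by rewrite -[Bu *m invmx H *m H]mulmxA mulVmx// mulmx1.
apply: (@eq_cvgn _ (fun T =>
   \tr (P *m Bw *m mavg (fun t => w t *m (w t)^T) T *m Bw^T)
   + 2 * \tr (Ah^T *m (mavg (fun t => w t *m (psi t.+1)^T) T)^T *m Bw^T)
   - \tr (M *m mavg (fun t => psi t *m (psi t)^T) T))); last first.
  apply: cvgB; last exact: h3.
  apply: cvgD; first exact: h1.
  apply: cvgM; [exact: cvg_cst|exact: h2].
move=> T; rewrite -mavg_tr -!mavgMl -!mavgMr !mavg_trace.
rewrite mulrCA -mulrDr -mulrBr; congr (_ * _).
rewrite mulr_sumr -big_split/= -sumrB; apply: eq_bigr => t _.
rewrite /noise_cost -psi_rec !quad_trace dot_trace !trmx_mul trmxK.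
by rewrite !mulmxA.
Qed.

Lemma storage_mean_cvg (x : nat -> 'cV[R]_nx) : osqrt (fun t => nrm (x t)) ->
  T%:R^-1 * (storage (x 0%N) (Ah^T *m psi 0%N) - storage (x T) (Ah^T *m psi T))
    @[T --> \oo] --> (0 : R).
Proof.
move=> ox; have xx := osqrtM_mean_cvg (fun t => nrm_ge0 (x t)) (fun t => nrm_ge0 (x t)) ox ox.
have xp := osqrtM_mean_cvg (fun t => nrm_ge0 (x t)) (fun t => nrm_ge0 (psi t)) ox psi_o.
have V0 : T%:R^-1 * storage (x 0%N) (Ah^T *m psi 0%N) @[T --> \oo] --> (0 : R).
  rewrite -(mul0r (storage (x 0%N) (Ah^T *m psi 0%N))).
  by apply: cvgM; [exact: inv_natr_cvg0|exact: cvg_cst].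
have V1 : T%:R^-1 * storage (x T) (Ah^T *m psi T) @[T --> \oo] --> (0 : R).
  apply: (cvgn0_squeeze (e := fun T => nrm P * (T%:R^-1 * (nrm (x T) * nrm (x T)))
      + 2 * nrm Ah * (T%:R^-1 * (nrm (x T) * nrm (psi T))))) => [T|].
    have -> : nrm P * (T%:R^-1 * (nrm (x T) * nrm (x T)))
      + 2 * nrm Ah * (T%:R^-1 * (nrm (x T) * nrm (psi T))) =
      T%:R^-1 * (nrm P * nrm (x T) ^+ 2 + 2 * (nrm (x T) * (nrm Ah * nrm (psi T)))).
      by ring.
    rewrite normrM ger0_norm ?invr_ge0//; apply: ler_wpM2l; first by rewrite invr_ge0.
    exact: storage_le_nrm.
  have h : nrm P * (T%:R^-1 * (nrm (x T) * nrm (x T)))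
      + 2 * nrm Ah * (T%:R^-1 * (nrm (x T) * nrm (psi T))) @[T --> \oo] -->
      (nrm P * 0 + 2 * nrm Ah * 0 : R).
    by apply: cvgD; apply: cvgM; [exact: cvg_cst|exact: xx|exact: cvg_cst|exact: xp].
  by rewrite !mulr0 addr0 in h.
have h : T%:R^-1 * storage (x 0%N) (Ah^T *m psi 0%N) - T%:R^-1 * storage (x T) (Ah^T *m psi T)
    @[T --> \oo] --> (0 - 0 : R) by apply: cvgB; [exact: V0|exact: V1].
by rewrite subr0 in h; apply: eq_cvgn h => T; rewrite mulrBr.
Qed.

Section closed_loop.
Variables (x : nat -> 'cV[R]_nx) (u : nat -> 'cV[R]_nu).
Hypothesis x_rec : forall t, x t.+1 = A *m x t + Bu *m u t + Bw *m w t.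
Let e t := input_excess (x t) (u t) (w t) (Ah^T *m psi t.+1).

Lemma average_cost_cvg l : osqrt (fun t => nrm (x t)) ->
  T%:R^-1 * (\sum_(t < T) quad H (e t)) @[T --> \oo] --> (l : R) ->
  average_cost Q Ru x u T @[T --> \oo] --> (optimal_noncausal_cost X + l)%:E.
Proof.
move=> ox el; rewrite /average_cost.
apply: cvg_EFin; first by exact: nearW.
have h : T%:R^-1 * (storage (x 0%N) (Ah^T *m psi 0%N) - storage (x T) (Ah^T *m psi T))
  + T%:R^-1 * (\sum_(t < T) quad H (e t))
  + T%:R^-1 * (\sum_(t < T) noise_cost (w t) (Ah^T *m psi t.+1)) @[T --> \oo] -->
  (0 + l + optimal_noncausal_cost X : R).
  apply: cvgD; last exact: noise_cost_avg.
  by apply: cvgD; [exact: storage_mean_cvg|exact: el].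
rewrite add0r addrC in h; apply: eq_cvgn h => T /=.
by rewrite (cost_decomposition psi_rec x_rec).
Qed.

(* Along a subsequence on which [x] is small, the averages are bounded below by
   the noise cost up to a vanishing term, because [H] is positive definite. *)
Lemma average_cost_lower_bound :
  (forall d N, 0 < d -> exists2 T, (N <= T)%N & nrm (x T) <= d * sqrtS T) ->
  cvgn (average_cost Q Ru x u) ->
  ((optimal_noncausal_cost X)%:E <= Jinf Q Ru x u)%E.
Proof.
move=> sub cv.
(* Requiring S N > N makes S diverge and keeps the division by S N meaningful. *)
have [S hS] : exists S : nat -> nat, forall N, (N.+1 <= S N)%N /\
    nrm (x (S N)) <= N.+1%:R^-1 * sqrtS (S N).
  have /choice [S hS] : forall N, exists T, (N.+1 <= T)%N /\
      nrm (x T) <= N.+1%:R^-1 * sqrtS T.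
    by move=> N; have [|T h1 h2] := sub N.+1%:R^-1 N.+1; [rewrite invr_gt0|exists T].
  by exists S.
have Soo : S N @[N --> \oo] --> \oo.
  move=> E [N _ NE]; exists N => // k /= Nk; apply: NE => /=.
  by apply: leq_trans Nk _; apply: ltnW; case: (hS k).
have [K [K0 psiK]] := osqrt_bound psi_o.
have V1 : (S N)%:R^-1 * storage (x (S N)) (Ah^T *m psi (S N)) @[N --> \oo] --> (0 : R).
  (* The smallness comes from x, psi contributing the constant K. The 2 is T+1 <= 2T, and q^2 <= q
     makes both storage terms linear in q = 1/(N+1). *)
  apply: (cvgn0_squeeze (e := fun N => 2 * (nrm P + 2 * (nrm Ah * K)) * N.+1%:R^-1)).
    move=> N; have [SN xN] := hS N; set T := S N in SN xN *.
    rewrite normrM ger0_norm ?invr_ge0// mulrC ler_pdivrMr ?ltr0n ?(leq_ltn_trans _ SN)//.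
    apply: le_trans (storage_le_nrm _ _) _.
    set q := N.+1%:R^-1 in xN *; have q0 : 0 <= q by rewrite invr_ge0.
    have q1 : q <= 1 by rewrite invf_le1// ler1n.
    have s2 := sqr_sqrtS (R := R) T; have s0 := sqrtS_ge0 (R := R) T; have pT := psiK T.
    have x0 := nrm_ge0 (x T); have p0 := nrm_ge0 (psi T).
    have P0 := nrm_ge0 P; have A0 := nrm_ge0 Ah.
    have T2 : T.+1%:R <= 2 * T%:R :> R by rewrite -natrM ler_nat; lia.
    have xx : nrm (x T) ^+ 2 <= q * T.+1%:R.
      rewrite -s2; apply: (@le_trans _ _ ((q * sqrtS T) ^+ 2)).
        by rewrite lerXn2r ?nnegrE// mulr_ge0.
      by rewrite exprMn; apply: ler_wpM2r; [exact: sqr_ge0|rewrite expr2 ler_piMl].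
    have xp : nrm (x T) * nrm (psi T) <= q * K * T.+1%:R.
      rewrite -s2; apply: le_trans (ler_pM x0 p0 xN pT) _.
      by rewrite mulrACA -expr2.
    have h1 := ler_wpM2l P0 xx; have h2 := ler_wpM2l A0 xp.
    have -> : nrm (x T) * (nrm Ah * nrm (psi T)) = nrm Ah * (nrm (x T) * nrm (psi T)).
      by ring.
    have h3 : 0 <= (nrm P + 2 * (nrm Ah * K)) * q by rewrite mulr_ge0// addr_ge0// !mulr_ge0.
    have h4 := ler_wpM2l h3 T2; lra.
  have h : 2 * (nrm P + 2 * (nrm Ah * K)) * N.+1%:R^-1 @[N --> \oo] -->
     (2 * (nrm P + 2 * (nrm Ah * K)) * 0 : R).
    by apply: cvgM; [exact: cvg_cst|exact: cvg_harmonic].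
  by rewrite mulr0 in h.
pose c N := (S N)%:R^-1 * storage (x 0%N) (Ah^T *m psi 0%N)
  - (S N)%:R^-1 * storage (x (S N)) (Ah^T *m psi (S N))
  + (S N)%:R^-1 * (\sum_(t < S N) noise_cost (w t) (Ah^T *m psi t.+1)).
have cJ : c N @[N --> \oo] --> optimal_noncausal_cost X.
  have h : c N @[N --> \oo] --> (0 * storage (x 0%N) (Ah^T *m psi 0%N) - 0
      + optimal_noncausal_cost X : R).
    apply: cvgD; last exact: (cvg_comp _ _ Soo noise_cost_avg).
    apply: cvgB; last exact: V1.
    apply: cvgM; last exact: cvg_cst.
    exact: (cvg_comp _ _ Soo (@inv_natr_cvg0 R)).
  by rewrite mul0r subr0 add0r in h.
have cE : (c N)%:E @[N --> \oo] --> (optimal_noncausal_cost X)%:E.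
  by apply: cvg_EFin; [exact: nearW|exact: cJ].
have aE : average_cost Q Ru x u (S N) @[N --> \oo] --> Jinf Q Ru x u.
  exact: (cvg_comp _ _ Soo cv).
rewrite -(cvg_lim (@ereal_hausdorff R) cE) -(cvg_lim (@ereal_hausdorff R) aE).
apply: lee_lim; [by apply/cvg_ex; eexists; exact: cE|by apply/cvg_ex; eexists; exact: aE|].
apply: nearW => N; rewrite /average_cost lee_fin (cost_decomposition psi_rec x_rec).
rewrite /c mulrBr lerD2r lerDl; apply: mulr_ge0; first by rewrite invr_ge0.
by apply: sumr_ge0 => t _; exact: quad_ge0.
Qed.

End closed_loop.

End noise.
End regulator.

(** * Noncausal and preview controllers along a white sequence *)

Section controllers.
Context {R : realType} {nx nu nw : nat}.
Variables (A : 'M[R]_nx) (Bu : 'M[R]_(nx, nu)) (Bw : 'M[R]_(nx, nw)).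
Variables (Q : 'M[R]_nx) (Ru : 'M[R]_nu) (P : 'M[R]_nx).
Hypothesis hP : stabilizing_solution A Bu Q Ru P.

Local Notation H := (Hmx Bu Ru P).
Local Notation Kx := (Kx A Bu Ru P).
Local Notation Kw := (Kw Bu Bw Ru P).
Local Notation Kv := (Kv Bu Ru P).
Local Notation Ah := (Ahat A Bu Ru P).
Local Notation J := (optimal_noncausal_cost Bu Bw Ru P).

Let hSchur : Defs.Schur Ah. Proof. by case: hP. Qed.

Lemma lyapunov_unique_solution : exists X, unique (lyapunov A Bu Bw Ru P) X.
Proof.
have [L [_ LK KL]] := lyapunov_inverse hSchur.
have eqL X : lyapunov A Bu Bw Ru P X <->
    X - Ah^T *m X *m Ah = P *m Bw *m Bw^T *m P.
  rewrite /lyapunov addrAC; split=> [/subr0_eq h|h].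
    by rewrite -{1}h addrAC subrr add0r.
  by rewrite -h [_ + (X - _)]addrC subrK subrr.
exists (L (P *m Bw *m Bw^T *m P)); split=> [|X /eqL hX]; first by apply/eqL/KL.
by rewrite -hX; exact: LK.
Qed.

(** The preview signal [y] is a parameter: [vnc_next] gives the noncausal controller, [preview_sum]
    the p-step one. *)
Definition feedback (y : nat -> 'cV[R]_nx) (w : nat -> 'cV[R]_nw) (t : nat)
  (x : 'cV[R]_nx) : 'cV[R]_nu := - (Kx *m x) - Kw *m w t - Kv *m y t.

Definition preview_sum p (w : nat -> 'cV[R]_nw) t : 'cV[R]_nx :=
  \sum_(k < p) Ah^T ^+ k.+1 *m (P *m Bw *m w (t + k.+1)%N).

Lemma feedback_excess y w t x v :
  input_excess A Bu Bw Ru P x (feedback y w t x) (w t) v = Kv *m (v - y t).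
Proof.
rewrite /input_excess /feedback mulmxBr.
move: (Kx *m x) (Kw *m w t) (Kv *m v) (Kv *m y t) => a b c d.
have -> : - a - b - d = - d - (a + b) by rewrite opprD addrC.
by rewrite -[X in X + c]addrA subrK addrC.
Qed.

Definition forcing (y : nat -> 'cV[R]_nx) (w : nat -> 'cV[R]_nw) (t : nat) :=
  (Bw - Bu *m Kw) *m w t - Bu *m Kv *m y t.

Lemma feedback_step y w t x :
  A *m x + Bu *m feedback y w t x + Bw *m w t = Ah *m x + forcing y w t.
Proof.
rewrite /feedback /forcing /Ahat !mulmxBr !mulmxBl mulmxN !mulmxA.
rewrite -!addrA; congr (_ + (_ + _)).
by rewrite [RHS]addrC -addrA.
Qed.

Lemma nrm_forcing y w t : nrm (forcing y w t) <=
  nrm (Bw - Bu *m Kw) * nrm (w t) + nrm (Bu *m Kv) * nrm (y t).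
Proof. by apply: le_trans (nrmB _ _) _; apply: lerD; exact: nrmM. Qed.

Section white_path.
Variables (w : nat -> 'cV[R]_nw) (X : 'M[R]_nx).
Hypotheses (hw : white w) (hX : lyapunov A Bu Bw Ru P X).

Lemma noise_summary : exists psi : nat -> 'cV[R]_nx,
  [/\ forall t, mcvg (fun N => \sum_(k < N) Ah^T ^+ k *m (P *m Bw *m w (t + k)%N)) (psi t),
      forall t, psi t = P *m Bw *m w t + Ah^T *m psi t.+1,
      osqrt (fun t => nrm (psi t))
    & exists K, forall T, \sum_(t < T) nrm (psi t) ^+ 2 <= K * T.+1%:R].
Proof. by apply: (filtered_noise hw); rewrite trmxK. Qed.

Lemma feedback_average_cost psi y x0 l :
  (forall t, psi t = P *m Bw *m w t + Ah^T *m psi t.+1) ->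
  osqrt (fun t => nrm (psi t)) ->
  (exists K, forall T, \sum_(t < T) nrm (psi t) ^+ 2 <= K * T.+1%:R) ->
  osqrt (fun t => nrm (y t)) ->
  T%:R^-1 * (\sum_(t < T) quad H (Kv *m (Ah^T *m psi t.+1 - y t))) @[T --> \oo] --> (l : R) ->
  let x := state A Bu Bw (feedback y w) x0 w in
  average_cost Q Ru x (fun t => feedback y w t (x t)) T @[T --> \oo] --> (J X + l)%:E.
Proof.
move=> psi_rec psi_o psi_b yo hl x.
have x_rec t : x t.+1 = A *m x t + Bu *m feedback y w t (x t) + Bw *m w t by [].
apply: (average_cost_cvg hP hw psi_rec psi_b psi_o hX x_rec).
  apply: (stable_osqrt hSchur (f := forcing y w)).
    by move=> t; rewrite x_rec feedback_step.
  apply: (osqrt_le (nrm_forcing y w)).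
  apply: osqrtD; apply: osqrtZ => //; rewrite ?nrm_ge0//.
  exact: white_osqrt.
apply: eq_cvgn hl => T; congr (_ * _); apply: eq_bigr => t _.
by rewrite feedback_excess.
Qed.

Lemma vnc_nextE psi :
  (forall t, mcvg (fun N => \sum_(k < N) Ah^T ^+ k *m (P *m Bw *m w (t + k)%N)) (psi t)) ->
  (* The sum from t+1 to N is reindexed from 0, which shifts the upper bound by t+1; hence
     [mcvg_unshift]. *)
  forall t, vnc_next A Bu Bw Ru P w t = Ah^T *m psi t.+1.
Proof.
move=> hpsi t; apply: mcvg_limn; apply: (mcvg_unshift (k := t.+1)).
apply: eq_mcvg (mcvgMl Ah^T (hpsi t.+1)) => N.
rewrite -[X in index_iota X _]add0n big_addn addnK big_mkord mulmx_sumr; apply: eq_bigr => k _.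
by rewrite [(k + _)%N]addnC addSnnS addKn exprS -mulmxE !mulmxA.
Qed.

Lemma nc_average_cost x0 :
  average_cost Q Ru (nc_state A Bu Bw Ru P x0 w) (nc_control A Bu Bw Ru P x0 w) T
    @[T --> \oo] --> (J X)%:E.
Proof.
have [psi [psi_l psi_rec psi_o psi_b]] := noise_summary.
have vE := vnc_nextE psi_l.
have h := @feedback_average_cost psi (vnc_next A Bu Bw Ru P w) x0 0 psi_rec psi_o psi_b.
rewrite -[J X]addr0; apply: h.
  apply: (osqrt_le (b := fun t => nrm Ah * nrm (psi t.+1))).
    by move=> t; rewrite vE -(nrm_tr Ah); exact: nrmM.
  apply: osqrtZ; first exact: nrm_ge0.
  apply: (osqrt_le _ (osqrt_shift 1 psi_o)) => t; by rewrite addn1.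
apply: (@eq_cvgn _ (fun=> 0)); last exact: cvg_cst.
move=> T; rewrite big1 ?mulr0// => t _.
by rewrite vE subrr mulmx0 quadE mulmx0 /dot mulmx0 mxE.
Qed.

Lemma preview_average_cost p x0 :
  let y := preview_sum p w in
  let x := state A Bu Bw (feedback y w) x0 w in
  let N := Kv *m Ah^T ^+ p.+1 in
  average_cost Q Ru x (fun t => feedback y w t (x t)) T
    @[T --> \oo] --> (J X + \tr (H *m N *m X *m N^T))%:E.
Proof.
move=> y x N.
have [psi [psi_l psi_rec psi_o psi_b]] := noise_summary.
have tail m t : Ah^T *m psi t.+1 =
    preview_sum m w t + Ah^T ^+ m.+1 *m psi (t.+1 + m)%N.
  elim: m => [|m IH]; first by rewrite /preview_sum big_ord0 add0r expr1 addn0.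
  rewrite IH /preview_sum big_ord_recr/= -addrA; congr (_ + _).
  rewrite psi_rec mulmxDr !addSn !addnS; congr (_ + _).
  by rewrite [Ah^T ^+ m.+2]exprSr -mulmxE !mulmxA.
apply: (@feedback_average_cost psi) => //.
  apply: (osqrt_le (b := fun t => nrm Ah * nrm (psi t.+1) +
     nrm (Ah^T ^+ p.+1) * nrm (psi (t + p.+1)%N))).
    move=> t; have -> : y t = Ah^T *m psi t.+1 - Ah^T ^+ p.+1 *m psi (t.+1 + p)%N.
      by rewrite (tail p) addrK.
    apply: le_trans (nrmB _ _) _; apply: lerD.
      by rewrite -(nrm_tr Ah); exact: nrmM.
    by rewrite addSnnS; exact: nrmM.
  apply: osqrtD; apply: osqrtZ; rewrite ?nrm_ge0//.
    by apply: (osqrt_le _ (osqrt_shift 1 psi_o)) => t; rewrite addn1.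
  exact: (osqrt_shift p.+1 psi_o).
(* The excess is a quadratic form in psi_(t+p+1), and averages are insensitive to the shift, so its
   Gram limit is again X. *)
have gram := mavg_shift p.+1 (psi_gram_avg hP hw psi_rec psi_b psi_o hX).
have h := mcvg_trace (mcvgMr N^T (mcvgMl (H *m N) gram)).
apply: eq_cvgn h => T; rewrite -mavgMl -mavgMr mavg_trace; congr (_ * _).
apply: eq_bigr => t _; rewrite (tail p) [preview_sum _ _ _ + _]addrC addrK.
by rewrite addSnnS (mulmxA Kv) -/N quad_trace (trmx_mul N) !mulmxA.
Qed.

(** The trace is quadratic in the decaying gain: one factor is bounded by a constant, the other
    supplies r^p. *)
Lemma preview_excess_cvg0 :
  \tr (H *m (Kv *m Ah^T ^+ p.+1) *m X *m (Kv *m Ah^T ^+ p.+1)^T)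
    @[p --> \oo] --> (0 : R).
Proof.
have [K [r [K0 r0 r1 hK]]] := Schur_nrm_decay hSchur.
have AT k : Ah^T ^+ k = (Ah ^+ k)^T.
  elim: k => [|k IH]; first by rewrite !expr0 trmx1.
  by rewrite exprS exprSr IH -!mulmxE trmx_mul.
have N0 : forall p, nrm (Kv *m Ah^T ^+ p.+1) <= nrm Kv * K * r ^+ p.
  move=> p; apply: le_trans (nrmM _ _) _; rewrite AT nrm_tr -mulrA.
  apply: ler_wpM2l; first exact: nrm_ge0.
  apply: le_trans (hK _) _; apply: ler_wpM2l => //.
  by rewrite exprS ler_piMl// ?exprn_ge0// ltW.
have c0 : 0 <= nrm Kv * K by rewrite mulr_ge0 ?nrm_ge0.
apply: (cvgn0_squeeze (e := fun p => nrm H * (nrm Kv * K) * nrm X * (nrm Kv * K) * r ^+ p)).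
  move=> p; apply: le_trans (trace_le_nrm _) _.
  apply: le_trans (nrmM _ _) _; rewrite nrm_tr.
  have -> : nrm H * (nrm Kv * K) * nrm X * (nrm Kv * K) * r ^+ p =
     (nrm H * (nrm Kv * K) * nrm X) * (nrm Kv * K * r ^+ p) by ring.
  apply: ler_pM => //; rewrite ?nrm_ge0//.
  apply: le_trans (nrmM _ _) _; apply: ler_wpM2r; first exact: nrm_ge0.
  apply: le_trans (nrmM _ _) _; apply: ler_wpM2l; first exact: nrm_ge0.
  apply: le_trans (N0 p) _; rewrite -[leRHS]mulr1; apply: ler_wpM2l => //.
  by rewrite exprn_ile1// ltW.
have h : nrm H * (nrm Kv * K) * nrm X * (nrm Kv * K) * r ^+ p @[p --> \oo] -->
    (nrm H * (nrm Kv * K) * nrm X * (nrm Kv * K) * 0 : R).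
  by apply: cvgM; [exact: cvg_cst|apply: cvg_expr; rewrite ger0_norm// ltW].
by rewrite mulr0 in h.
Qed.

End white_path.

(** The convexity inequality behind [backward_sum], iterated. It moves a pathwise bound on the norm
    to the squares, whose means are known. *)
Lemma majorant_sqr (r a : R) (b : nat -> R) t : 0 < r -> r < 1 ->
  majorant r a b t ^+ 2 <= majorant r (a ^+ 2) (fun s => b s ^+ 2 / (1 - r)) t.
Proof.
move=> r0 r1; have d0 : 0 < 1 - r by rewrite subr_gt0.
elim: t => [//|t IH] /=; apply: le_trans (_ : r * majorant r a b t ^+ 2 + b t ^+ 2 / (1 - r) <= _).
  move: (majorant _ _ _ _) (b t) => y z; rewrite -subr_ge0.
  have -> : r * y ^+ 2 + z ^+ 2 / (1 - r) - (r * y + z) ^+ 2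
     = r * (z - (1 - r) * y) ^+ 2 / (1 - r).
    by field; apply: lt0r_neq0.
  apply: divr_ge0; last exact: ltW.
  by apply: mulr_ge0; [exact: ltW|exact: sqr_ge0].
by rewrite lerD2r; apply: ler_wpM2l; [exact: ltW|].
Qed.

Lemma le_majorant (r a : R) (b c : nat -> R) t : 0 <= r ->
  (forall s, b s <= c s) -> majorant r a b t <= majorant r a c t.
Proof.
by move=> r0 bc; elim: t => [//|t IH] /=; apply: lerD => //; exact: ler_wpM2l.
Qed.

Lemma sqr_sum_le n (f : 'I_n -> R) : (\sum_i f i) ^+ 2 <= n%:R * \sum_i f i ^+ 2.
Proof.
have := nrm_sqr_le (\col_i f i); rewrite nrm_cV.
rewrite [X in _ * X](eq_bigr (fun i => f i ^+ 2)); last by move=> i _; rewrite mxE.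
apply: le_trans; rewrite -(real_normK (num_real (\sum_i f i))).
rewrite lerXn2r ?nnegrE ?sumr_ge0//.
apply: le_trans (ler_norm_sum _ _ _) _.
by apply: ler_sum => i _; rewrite mxE.
Qed.

(** The right side is linear in the squared entries of w and its constants depend on neither x0, w
    nor t, so taking means termwise bounds the second moment of the state uniformly in time. *)
Lemma preview_state_bound p : exists K r c, [/\ 0 <= K, 0 < r, r < 1, 0 <= c &
  forall x0 w t,
  nrm (state A Bu Bw (feedback (preview_sum p w) w) x0 w t) ^+ 2 <=
  K * majorant r (nrm x0 ^+ 2)
    (fun s => c * \sum_(k < p.+1) \sum_i w (s + k)%N i 0 ^+ 2) t].
Proof.
have [K [r [K0 r0 r1 hK]]] := stable_majorant hSchur.
have d0 : 0 < 1 - r by rewrite subr_gt0.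
(* Gain of [forcing] on w_(t+k): the direct effect for k = 0, the previewed disturbances for k >
   0. *)
pose a k := if k is k'.+1 then nrm (Bu *m Kv) * nrm (Ah^T ^+ k *m (P *m Bw))
  else nrm (Bw - Bu *m Kw).
have a0 k : 0 <= a k by case: k => [|k]; rewrite ?mulr_ge0 ?nrm_ge0.
pose c0 := \sum_(k < p.+1) a k.
have c00 : 0 <= c0 by apply: sumr_ge0.
have f_le (w : nat -> 'cV[R]_nw) t : nrm (forcing (preview_sum p w) w t) <=
    c0 * \sum_(k < p.+1) nrm (w (t + k)%N).
  apply: le_trans (nrm_forcing _ _ _) _.
  apply: (@le_trans _ _ (\sum_(k < p.+1) a k * nrm (w (t + k)%N))).
    rewrite big_ord_recl/= addn0 lerD2l.
    apply: le_trans (ler_wpM2l (nrm_ge0 _) (nrm_sum _ _)) _.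
    rewrite mulr_sumr; apply: ler_sum => k _; rewrite /bump/= add1n -mulrA.
    by apply: ler_wpM2l; [exact: nrm_ge0|rewrite mulmxA; exact: nrmM].
  rewrite mulr_sumr; apply: ler_sum => k _; apply: ler_wpM2r; first exact: nrm_ge0.
  by rewrite /c0 (bigD1 k)//= lerDl; apply: sumr_ge0.
exists (K ^+ 2), r, (c0 ^+ 2 * p.+1%:R * nw%:R / (1 - r)); split => //.
- exact: sqr_ge0.
- by rewrite divr_ge0 ?(ltW d0)// !mulr_ge0// sqr_ge0.
move=> x0 w t; set x := state _ _ _ _ _ _.
have xr s : x s.+1 = Ah *m x s + forcing (preview_sum p w) w s.
  by rewrite -feedback_step.
have := hK x _ xr t; rewrite -[x 0%N]/x0 => h.
have m0 : 0 <= majorant r (nrm x0) (fun s => nrm (forcing (preview_sum p w) w s)) t.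
  by apply: majorant_ge0 => [||s]; [exact: ltW|exact: nrm_ge0|exact: nrm_ge0].
apply: (@le_trans _ _ ((K * majorant r (nrm x0)
    (fun s => nrm (forcing (preview_sum p w) w s)) t) ^+ 2)).
  by rewrite lerXn2r ?nnegrE ?nrm_ge0 ?mulr_ge0.
rewrite exprMn; apply: ler_wpM2l; first exact: sqr_ge0.
apply: le_trans (majorant_sqr _ _ _ r0 r1) _.
apply: le_majorant => [|s]; first exact: ltW.
rewrite [leRHS]mulrAC; apply: ler_wpM2r; first by rewrite invr_ge0 ltW.
apply: (@le_trans _ _ ((c0 * \sum_(k < p.+1) nrm (w (s + k)%N)) ^+ 2)).
  rewrite lerXn2r ?nnegrE ?nrm_ge0//; rewrite mulr_ge0//.
  by apply: sumr_ge0 => k _; exact: nrm_ge0.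
rewrite exprMn -[leRHS]mulrA -[leRHS]mulrA; apply: (ler_wpM2l (sqr_ge0 c0)).
apply: le_trans (sqr_sum_le _) _; apply: ler_wpM2l => //.
by rewrite mulr_sumr; apply: ler_sum => k _; exact: nrm_sqr_le.
Qed.

End controllers.

Section eventually_white.
Context {R : realType} {nw : nat}.

Lemma mavg_eventually m n (F G : nat -> 'M[R]_(m, n)) N l :
  (forall t, (N <= t)%N -> F t = G t) -> mcvg (mavg F) l -> mcvg (mavg G) l.
Proof.
(* From time N on, the two averages differ by exactly D / T. *)
move=> FG Fl; pose D := \sum_(t < N) (G t - F t).
have h : mcvg (fun T => mavg F T + T%:R^-1 *: D) (l + 0).
  apply: mcvgD => // i j; under eq_fun do rewrite mxE.
  have -> : (0 : 'M[R]_(m, n)) i j = 0 by rewrite mxE.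
  rewrite -(mul0r (D i j)).
  by apply: cvgM; [exact: inv_natr_cvg0|exact: cvg_cst].
rewrite addr0 in h; apply: (mcvg_unshift (k := N)).
have h' : mcvg (fun T => mavg F (T + N)%N + (T + N)%:R^-1 *: D) l.
  by move=> i j; rewrite (cvg_shiftn N (fun T => (mavg F T + T%:R^-1 *: D) i j)); exact: h.
apply: eq_mcvg h' => T; rewrite /mavg -scalerDr; congr (_ *: _).
rewrite addnC !big_split_ord/= addrAC; congr (_ + _).
  by rewrite -big_split/=; apply: eq_bigr => t _; rewrite addrC subrK.
by apply: eq_bigr => t _; rewrite FG// leq_addr.
Qed.

(** Needed for [known_then]: fixing the disturbances in i_0 leaves a path white. *)
Lemma white_eventually (w w' : nat -> 'cV[R]_nw) N :
  (forall t, (N <= t)%N -> w t = w' t) -> white w -> white w'.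
Proof.
move=> ww hw k; apply: (mavg_eventually (N := N) _ (@hw k)) => t Nt.
by rewrite !ww// (leq_trans Nt)// leq_addr.
Qed.

End eventually_white.

(** * Integrals and means *)

Section nonmeasurable_integral.
Context {R : realType} {d : measure_display} {T : measurableType d}.
Variable Pr : probability T R.
Local Open Scope ereal_scope.

(** No measurability: the integral of a nonnegative function is a supremum over the simple functions
    below it, hence monotone. *)
Lemma le_integralT (f g : T -> \bar R) :
  (forall x, 0 <= f x) -> (forall x, f x <= g x) ->
  \int[Pr]_x f x <= \int[Pr]_x g x.
Proof.
move=> f0 fg; rewrite !ge0_integralTE//=; last by move=> x; exact: le_trans (fg x).
apply: le_ereal_sup => _ [h hf <-]; exists h => // x /=.
exact: le_trans (hf x) (fg x).
Qed.

Lemma integral_cst_probability (c : \bar R) : \int[Pr]_x cst c x = c.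
Proof.
rewrite (integral_cst Pr measurableT) -[RHS]mule1; congr (_ * _).
exact: probability_setT.
Qed.

(** Measurable comparison functions that take an extreme value on a null set and a constant
    elsewhere. *)
Lemma measurable_dichotomy (N : set T) (y z : \bar R) : measurable N ->
  measurable_fun [set: T] ((fun x => if x \in N then y else z) : T -> \bar R).
Proof.
move=> mN; apply: measurable_fun_ifT => //; apply: (measurable_fun_bool true).
rewrite setTI (_ : _ @^-1` _ = N)//.
by apply/seteqP; split => x /= => [/set_mem|/mem_set].
Qed.

(* The integral is the one of a possibly non-measurable function: only its
   bounds on a set of full measure are used. *)
Lemma integral_ae_ge (f : T -> \bar R) (c : R) : (0 <= c)%R ->
  {ae Pr, forall x, c%:E <= f x} -> c%:E <= \int[Pr]_x f x.
Proof.
move=> c0 [N [mN N0 fN]].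
have fNx x : ~ N x -> c%:E <= f x by move=> nN; apply: contrapT => h; exact/nN/fN.
have mind y z := measurable_dichotomy y z mN.
have lo : c%:E <= \int[Pr]_x f^\+ x.
  apply: (@le_trans _ _ (\int[Pr]_x (if x \in N then 0 else c%:E))).
    rewrite (@ge0_ae_eq_integral _ _ _ _ _ _ (cst c%:E))//.
    - by rewrite integral_cst_probability.
    - by move=> x _; case: ifP; rewrite ?lee_fin.
    - exists N; split => // x /= h; apply: contrapT => nN; apply: h => _.
      by rewrite memNset.
  apply: le_integralT => x; first by case: ifP; rewrite ?lee_fin.
  case: ifPn => [_|]; first exact: funepos_ge0.
  by rewrite notin_setE => /fNx cf; rewrite funeposE le_max cf.
have hi : \int[Pr]_x f^\- x = 0.
  apply/eqP; rewrite eq_le integral_ge0 ?andbT; last by move=> x _; exact: funeneg_ge0.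
  (* The negative part is uncontrolled on N; bounding it by +oo there is free since N is null. *)
  apply: (@le_trans _ _ (\int[Pr]_x (if x \in N then +oo else 0))).
    apply: le_integralT => x; first exact: funeneg_ge0.
    case: ifPn => [_|]; first exact: leey.
    rewrite notin_setE => /fNx cf; rewrite funenegE ge_max lexx andbT oppe_le0.
    by apply: le_trans cf; rewrite lee_fin.
  rewrite (@ge0_ae_eq_integral _ _ _ _ _ _ (cst 0))//.
  - by rewrite integral0.
  - by move=> x _; case: ifP.
  - exists N; split => // x /= h; apply: contrapT => nN; apply: h => _.
    by rewrite memNset.
by rewrite integralE hi sube0.
Qed.

Lemma integral_ae_cst (f : T -> \bar R) (c : R) : (0 <= c)%R ->
  {ae Pr, forall x, f x = c%:E} -> \int[Pr]_x f x = c%:E.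
Proof.
move=> c0 [N [mN N0 fN]].
have fNx x : ~ N x -> f x = c%:E by move=> nN; apply: contrapT => h; exact/nN/fN.
apply/eqP; rewrite eq_le; apply/andP; split; last first.
  by apply: integral_ae_ge => //; exists N; split => // x /= h; apply: contrapT => /fNx fx;
     apply: h; rewrite fx.
rewrite integralE; apply: (@le_trans _ _ (\int[Pr]_x f^\+ x)).
  rewrite -[leRHS]sube0; apply: leeB => //.
  by apply: integral_ge0 => x _; exact: funeneg_ge0.
apply: (@le_trans _ _ (\int[Pr]_x (if x \in N then +oo else c%:E))).
  apply: le_integralT => x; first exact: funepos_ge0.
  case: ifPn => [_|]; first exact: leey.
  by rewrite notin_setE => /fNx fx; rewrite funeposE ge_max fx lexx lee_fin.
rewrite (@ge0_ae_eq_integral _ _ _ _ _ _ (cst c%:E))//.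
- by rewrite integral_cst_probability.
- exact: measurable_dichotomy.
- by move=> x _; case: ifP; rewrite ?lee_fin.
- by exists N; split => // x /= h; apply: contrapT => nN; apply: h => _; rewrite memNset.
Qed.

End nonmeasurable_integral.

Section mean.
Context {R : realType} {d : measure_display} {T : measurableType d}.
Variable Pr : probability T R.

(** Integrability and value travel together, so that means can be added and subtracted without
    meeting infinite values. *)
Definition has_mean (X : T -> R) (m : R) : Prop :=
  Pr.-integrable [set: T] (EFin \o X) /\ (\int[Pr]_x (X x)%:E = m%:E)%E.

Lemma has_mean_ge0 (X : T -> R) m : measurable_fun [set: T] X ->
  (forall x, 0 <= X x) -> (\int[Pr]_x (X x)%:E = m%:E)%E -> has_mean X m.
Proof.
move=> mX X0 Xm; split => //; apply/integrableP; split.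
  exact: measurableT_comp.
by under eq_integral => x _ do rewrite gee0_abs ?lee_fin//; rewrite Xm ltry.
Qed.

Lemma has_mean_measurable X m : has_mean X m -> measurable_fun [set: T] X.
Proof. by move=> [/integrableP[/measurable_EFinP]]. Qed.

Lemma has_mean_unique X m m' : has_mean X m -> has_mean X m' -> m = m'.
Proof. by move=> [_ h] [_]; rewrite h => -[]. Qed.

Lemma has_meanD X Y m n : has_mean X m -> has_mean Y n ->
  has_mean (fun x => X x + Y x) (m + n).
Proof.
move=> [iX hX] [iY hY]; split; first exact: (integrableD measurableT iX iY).
under eq_integral => x _ do rewrite EFinD.
by rewrite (integralD_EFin measurableT iX iY)/= hX hY EFinD.
Qed.

Lemma has_meanB X Y m n : has_mean X m -> has_mean Y n ->
  has_mean (fun x => X x - Y x) (m - n).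
Proof.
move=> [iX hX] [iY hY]; split; first exact: (integrableB measurableT iX iY).
under eq_integral => x _ do rewrite EFinB.
by rewrite (integralB_EFin measurableT iX iY)/= hX hY EFinB.
Qed.

Lemma has_mean_cst (c : R) : has_mean (fun=> c) c.
Proof.
split; first exact: finite_measure_integrable_cst.
exact: integral_cst_probability.
Qed.

Lemma has_meanZ X m (c : R) : has_mean X m -> has_mean (fun x => c * X x) (c * m).
Proof.
move=> [iX hX]; split.
  by under [X in _.-integrable _ X]eq_fun do rewrite /= EFinM; exact: integrableZl.
under eq_integral => x _ do rewrite EFinM.
by rewrite (integralZl measurableT iX) hX EFinM.
Qed.

Lemma has_mean_sum I (s : seq I) (X : I -> T -> R) (m : I -> R) :
  (forall i, has_mean (X i) (m i)) ->
  has_mean (fun x => \sum_(i <- s) X i x) (\sum_(i <- s) m i).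
Proof.
move=> h; elim: s => [|i s IH].
  by rewrite big_nil; under eq_fun do rewrite big_nil; exact: has_mean_cst.
by rewrite big_cons; under eq_fun do rewrite big_cons; exact: has_meanD.
Qed.

Lemma has_mean_le X Y m n : has_mean X m -> has_mean Y n ->
  (forall x, X x <= Y x) -> m <= n.
Proof.
move=> [iX hX] [iY hY] XY; rewrite -lee_fin -hX -hY.
by apply: le_integral => // x _; rewrite lee_fin.
Qed.

Lemma has_mean_dominated (X Y : T -> R) n : measurable_fun [set: T] X -> has_mean Y n ->
  (forall x, `|X x| <= Y x) -> exists m, has_mean X m.
Proof.
move=> mX [iY hY] XY.
have iX : Pr.-integrable [set: T] (EFin \o X).
  apply: (le_integrable measurableT _ _ iY); first exact: measurableT_comp.
  by move=> x _ /=; rewrite lee_fin; exact: le_trans (XY x) (ler_norm _).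
exists (fine (\int[Pr]_x (X x)%:E)); split => //.
by rewrite fineK//; exact: (integrable_fin_num measurableT iX).
Qed.

(** In place of Chebyshev and Borel-Cantelli: the sum of the f_n has a finite mean, so the series
    converges almost surely and its terms vanish. *)
Lemma summable_mean_cvg0 (f : nat -> T -> R) (m : nat -> R) (c : R) :
  (forall n x, 0 <= f n x) -> (forall n, has_mean (f n) (m n)) ->
  (forall n, \sum_(i < n) m i <= c) ->
  {ae Pr, forall x, f n x @[n --> \oo] --> (0 : R)}.
Proof.
move=> f0 fm mc.
have mf n : measurable_fun [set: T] (EFin \o f n).
  by apply/measurable_EFinP; exact: (has_mean_measurable (fm n)).
have m0 n : 0 <= m n.
  exact: (has_mean_le (has_mean_cst 0) (fm n) (f0 n)).
pose F x := (\sum_(n <oo) (f n x)%:E)%E.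
have F0 x : (0 <= F x)%E by apply: nneseries_ge0 => n _; rewrite lee_fin.
have iF : Pr.-integrable [set: T] F.
  apply/integrableP; split.
    apply: ge0_emeasurable_sum => [n x _ _|n _]; [by rewrite lee_fin|exact: mf].
  under eq_integral => x _ do rewrite gee0_abs//.
  rewrite (integral_nneseries Pr measurableT) => [|n|n x _]; [|exact: mf|by rewrite lee_fin].
  apply: (@le_lt_trans _ _ c%:E); last exact: ltry.
  apply: lime_le; first by apply: is_cvg_nneseries => n _ _; apply: integral_ge0 => x _; rewrite lee_fin.
  apply: nearW => n; rewrite (eq_bigr (fun i => (m i)%:E)) => [|i _]; last by case: (fm i).
  by rewrite sumEFin lee_fin big_mkord.
have := integrable_ae measurableT iF.
apply: filterS => x /(_ Logic.I) Fx.
apply: (cvg_series_cvg_0 (u_ := fun n => f n x : R^o)).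
apply: nondecreasing_is_cvgn.
  by apply/nondecreasing_seqP => n; rewrite /series/= !big_mkord big_ord_recr lerDl.
exists (fine (F x)) => _ [n _ <-]; rewrite -lee_fin fineK// /series/= -sumEFin.
by apply: (nneseries_lim_ge n) => k _ _; rewrite lee_fin.
Qed.

End mean.

(** * Product formula for independent variables *)

Section product_formula.
Context {R : realType} {d : measure_display} {T : measurableType d}.
Variable Pr : probability T R.

Lemma monotone_mean_cvg (g : nat -> T -> R) (f : T -> R) :
  (forall n, measurable_fun [set: T] (g n)) -> (forall n x, 0 <= g n x) ->
  (forall x n m, (n <= m)%N -> g n x <= g m x) ->
  (forall x, g n x @[n --> \oo] --> f x) ->
  (\int[Pr]_x (g n x)%:E @[n --> \oo] --> \int[Pr]_x (f x)%:E)%E.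
Proof.
move=> mg g0 gnd gf.
rewrite (_ : (\int[Pr]_x (f x)%:E)%E = (\int[Pr]_x limn (fun n => (g n x)%:E))%E).
  apply: (@cvg_monotone_convergence _ _ _ Pr _ measurableT (fun n x => (g n x)%:E)).
  - by move=> n; apply/measurable_EFinP.
  - by move=> n x _; rewrite lee_fin.
  - by move=> x _ n m nm; rewrite lee_fin; exact: gnd.
apply: eq_integral => x _; apply/esym/cvg_lim; first exact: ereal_hausdorff.
by apply: cvg_EFin; [exact: nearW|exact: gf].
Qed.

Section one_factor.
Context {d' : measure_display} {T' : measurableType d'}.
Variables (V : T -> T') (mV : measurable_fun [set: T] V).
Import HBNNSimple.

Let simple_mean (h : {nnsfun T' >-> R}) (Z : T -> R) (c : R) :
  measurable_fun [set: T] Z -> (forall x, 0 <= Z x) ->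
  (forall B, measurable B ->
    (\int[Pr]_x (\1_B (V x) * Z x)%:E = (fine (Pr (V @^-1` B)) * c)%:E)%E) ->
  (\int[Pr]_x (h (V x) * Z x)%:E =
   ((\sum_(y <- finmap.enum_fset (fset_set (range h)))
       y * fine (Pr (V @^-1` (h @^-1` [set y])))) * c)%:E)%E.
Proof.
move=> mZ Z0 hZ.
have hE x : h x = \sum_(y <- finmap.enum_fset (fset_set (range h))) y * \1_(h @^-1` [set y]) x.
  by rewrite {1}fimfunE fsbig_finite//; exact: fimfunP.
under eq_integral => x _ do rewrite hE mulr_suml -sumEFin.
have mB y : measurable (h @^-1` [set y]) by exact: measurable_sfunP.
have pos y x : 0 <= y * \1_(h @^-1` [set y]) (V x) * Z x.
  apply: mulr_ge0 => //; rewrite indicE; case: (boolP (_ \in _)); last by rewrite mulr0.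
  by rewrite in_setE/= => <-; rewrite mulr1.
rewrite (ge0_integral_sum Pr measurableT) => [|y|y x _]; last 2 first.
- apply/measurable_EFinP; apply: measurable_funM => //.
  apply: measurable_funM => //; apply: (measurableT_comp _ mV).
  exact: measurable_indic.
- by rewrite lee_fin.
rewrite mulr_suml -sumEFin; apply: eq_bigr => y _.
have [y0|y0] := leP 0 y.
  under eq_integral => x _ do rewrite -mulrA EFinM.
  rewrite (ge0_integralZl_EFin Pr measurableT) ?hZ ?EFinM ?muleA//.
  - by move=> x _; rewrite lee_fin mulr_ge0// indicE.
  - apply/measurable_EFinP; apply: measurable_funM => //.
    by apply: (measurableT_comp _ mV); exact: measurable_indic.
have -> : h @^-1` [set y] = set0.
  apply/seteqP; split => // x /= hy; have : 0 <= h x by exact: fun_ge0.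
  by rewrite hy leNgt y0.
rewrite preimage_set0 measure0/= mulr0 mul0r -[RHS](integral0 Pr [set: T]).
by apply: eq_integral => x _; rewrite indic0 mulr0 mul0r.
Qed.

(** The factorization known for indicators of V extends to simple functions by linearity, then to
    nonnegative ones by monotone convergence. *)
Lemma mean_one_factor (Z : T -> R) (c : R) (f : T' -> R) (m : R) :
  measurable_fun [set: T] Z -> (forall x, 0 <= Z x) ->
  measurable_fun [set: T'] f -> (forall y, 0 <= f y) ->
  (forall B, measurable B ->
    (\int[Pr]_x (\1_B (V x) * Z x)%:E = (fine (Pr (V @^-1` B)) * c)%:E)%E) ->
  (\int[Pr]_x (f (V x))%:E = m%:E)%E ->
  (\int[Pr]_x (f (V x) * Z x)%:E = (m * c)%:E)%E.
Proof.
move=> mZ Z0 mf f0 hZ fm.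
have mEf : measurable_fun [set: T'] (EFin \o f) by exact/measurable_EFinP.
pose g := nnsfun_approx measurableT mEf.
have gf y : g n y @[n --> \oo] --> f y.
  have h : forall x, [set: T'] x -> (0 <= (f x)%:E)%E by move=> x _; rewrite lee_fin.
  exact: (fine_cvg (cvg_nnsfun_approx measurableT mEf h (I : [set: T'] y))).
have gnd y n k : (n <= k)%N -> g n y <= g k y.
  by move=> nk; have /lefP := nd_nnsfun_approx measurableT mEf nk; apply.
have mgV n : measurable_fun [set: T] (fun x => g n (V x)) by exact: measurableT_comp.
have g0 n y : 0 <= g n y by exact: fun_ge0.
pose a n := \sum_(y <- finmap.enum_fset (fset_set (range (g n))))
       y * fine (Pr (V @^-1` (g n @^-1` [set y]))).
have aE n : (\int[Pr]_x (g n (V x))%:E = (a n)%:E)%E.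
  have h B : measurable B ->
      (\int[Pr]_x (\1_B (V x) * 1)%:E = (fine (Pr (V @^-1` B)) * 1)%:E)%E.
    move=> mB; under eq_integral => x _ do rewrite mulr1.
    have mVB : measurable (V @^-1` B) by rewrite -[X in measurable X]setTI; exact: mV.
    rewrite mulr1 fineK; last exact: fin_num_measure.
    by rewrite -[LHS]/(\int[Pr]_x (\1_(V @^-1` B) x)%:E)%E (integral_indic Pr measurableT)//= setIT.
  rewrite -[a n]mulr1 -(@simple_mean (g n) (fun=> 1) 1 (measurable_cst _) (fun=> ler01) h).
  by apply: eq_integral => x _; rewrite mulr1.
have h1 := monotone_mean_cvg (fun n => measurable_funM (mgV n) mZ)
  (fun n x => mulr_ge0 (g0 n (V x)) (Z0 x))
  (fun x n k nk => ler_wpM2r (Z0 x) (gnd (V x) n k nk))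
  (fun x => cvgM (gf (V x)) (cvg_cst (Z x))).
have h2 := monotone_mean_cvg mgV (fun n x => g0 n (V x)) (fun x => gnd (V x))
  (fun x => gf (V x)).
have am : a n @[n --> \oo] --> m.
  have h2' : (a n)%:E @[n --> \oo] --> m%:E.
    have -> : (fun n => (a n)%:E) = (fun n => \int[Pr]_x (g n (V x))%:E)%E.
      by apply/funext => n; rewrite aE.
    by rewrite -fm.
  exact: (fine_cvg h2').
have h3 : (a n * c)%:E @[n --> \oo] --> (m * c)%:E.
  by apply: cvg_EFin; [exact: nearW|exact: (cvgM am (cvg_cst c))].
have e n : (\int[Pr]_x (g n (V x) * Z x)%:E = (a n * c)%:E)%E by exact: simple_mean.
have h1' : (\int[Pr]_x (g n (V x) * Z x)%:E)%E @[n --> \oo] -->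
  (\int[Pr]_x (f (V x) * Z x)%:E)%E by exact: h1.
rewrite -(cvg_lim (@ereal_hausdorff R) h3) -(cvg_lim (@ereal_hausdorff R) h1').
by congr (limn _); apply/funext => n; rewrite e.
Qed.

End one_factor.

Section independent.
Context {d' : measure_display} {T' : measurableType d'}.
Variable W : nat -> {RV Pr >-> T'}.
Hypothesis W_indep : mutually_independent W.

Lemma mean_prod_ge0 (s : seq nat) (f : nat -> T' -> R) (m : nat -> R) :
  uniq s -> (forall i, measurable_fun [set: T'] (f i)) ->
  (forall i y, 0 <= f i y) ->
  (forall i, (\int[Pr]_x (f i (W i x))%:E = (m i)%:E)%E) ->
  (\int[Pr]_x (\prod_(i <- s) f i (W i x))%:E = (\prod_(i <- s) m i)%:E)%E.
Proof.
move=> us mf f0 fm.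
(* Mixed statement: functions on [s1], indicators on [s2]. With [s1] empty it is the definition of
   independence, and each step trades one indicator for a function. *)
suff h (s1 s2 : seq nat) (B : nat -> set T') : uniq (s1 ++ s2) ->
    (forall i, measurable (B i)) ->
    (\int[Pr]_x ((\prod_(i <- s1) f i (W i x)) * \prod_(i <- s2) \1_(B i) (W i x))%:E =
    ((\prod_(i <- s1) m i) * \prod_(i <- s2) fine (Pr (W i @^-1` B i)))%:E)%E.
  have := h s [::] (fun=> setT); rewrite cats0 big_nil mulr1 => /(_ us (fun=> measurableT)) <-.
  by apply: eq_integral => x _; rewrite big_nil mulr1.
have mWB i (D : set T') : measurable D -> measurable (W i @^-1` D).
  by move=> mD; rewrite -[X in measurable X]setTI; exact: measurable_funPT.
have mind i (D : set T') : measurable D -> measurable_fun [set: T] (fun x => \1_D (W i x) : R).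
  move=> mD; apply: (measurableT_comp _ (measurable_funPT (W i))); exact: measurable_indic.
elim: s1 s2 B {us s} => [|i s1 IH] s2 B us mB.
  rewrite big_nil mul1r.
  pose E := \bigcap_(i in [set` s2]) (W i @^-1` B i).
  have mE : measurable E by apply: bigcap_measurableType => // i _; exact: mWB.
  have hE : Pr E = (\prod_(i <- s2) fine (Pr (W i @^-1` B i)))%:E.
    rewrite /E W_indep// -prodEFin; apply: eq_bigr => i _.
    by rewrite fineK// fin_num_measure//; exact: mWB.
  rewrite -hE -[in RHS](setIT E) -(integral_indic Pr measurableT mE).
  apply: eq_integral => x _; rewrite big_nil mul1r; congr (_%:E).
  rewrite indicE; case: (boolP (x \in E)) => [/set_mem Ex|].
    rewrite big_seq big1// => i is2; rewrite indicE mem_set//; exact: Ex.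
  rewrite notin_setE => nE; have [i is2 nB] : exists2 i, i \in s2 & ~ B i (W i x).
    apply: contrapT => h; apply: nE => i /= is2; apply: contrapT => nB.
    by apply: h; exists i.
  by rewrite (big_rem i)//= indicE memNset// mul0r.
pose Z x := (\prod_(j <- s1) f j (W j x)) * \prod_(j <- s2) \1_(B j) (W j x) : R.
have /= /andP[i_s us'] := us.
have mZ : measurable_fun [set: T] Z.
  apply: measurable_funM; apply: measurable_prod => j _; last exact: mind.
  exact: (measurableT_comp (mf j)).
have Z0 x : 0 <= Z x.
  by apply: mulr_ge0; apply: prodr_ge0 => j _ //; rewrite indicE.
have hZ C : measurable C -> (\int[Pr]_x (\1_C (W i x) * Z x)%:E =
    (fine (Pr (W i @^-1` C)) *
     ((\prod_(j <- s1) m j) * \prod_(j <- s2) fine (Pr (W j @^-1` B j))))%:E)%E.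
  move=> mC; pose B' j := if j == i then C else B j.
  have B's2 j : j \in s2 -> B' j = B j.
    move=> js2; rewrite /B'; case: eqP => // ji; move: i_s.
    by rewrite -ji mem_cat js2 orbT.
  have us'' : uniq (s1 ++ i :: s2).
    by rewrite -[i :: s2]cat1s uniq_catCA.
  have := IH (i :: s2) B' us''.
  have mB' j : measurable (B' j) by rewrite /B'; case: ifP.
  move=> /(_ mB'); rewrite big_cons {2}/B' eqxx => h.
  have hp : \prod_(j <- s2) fine (Pr (W j @^-1` B j)) =
      \prod_(j <- s2) fine (Pr (W j @^-1` B' j)).
    by apply: eq_big_seq => j js2; rewrite B's2.
  rewrite mulrCA hp.
  rewrite -h; apply: eq_integral => x _; congr (_%:E).
  rewrite big_cons {1}/B' eqxx /Z mulrCA; congr (_ * (_ * _)).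
  by apply: eq_big_seq => j js2; rewrite B's2.
have := mean_one_factor (measurable_funPT (W i)) mZ Z0 (mf i) (f0 i) hZ (fm i).
rewrite big_cons -mulrA => <-; apply: eq_integral => x _.
by rewrite /Z big_cons mulrA.
Qed.

Lemma has_mean_abs (X : T -> R) m : has_mean Pr X m ->
  exists a, has_mean Pr (fun x => `|X x|) a.
Proof.
move=> [iX _]; have iX' := integrable_norm iX.
exists (fine (\int[Pr]_x (`|X x|)%:E)); split => //.
by rewrite fineK//; exact: (integrable_fin_num measurableT iX').
Qed.

Lemma has_mean_pos_neg (X : T -> R) m : has_mean Pr X m -> exists a b,
  [/\ has_mean Pr (fun x => Order.max (X x) 0) a,
      has_mean Pr (fun x => Order.max (- X x) 0) b & m = a - b].
Proof.
move=> hX; have [c hc] := has_mean_abs hX; have mX := has_mean_measurable hX.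
have [a ha] : exists a, has_mean Pr (fun x => Order.max (X x) 0) a.
  apply: (has_mean_dominated _ hc) => [|x].
    by apply: measurable_maxr => //; exact: measurable_cst.
  by rewrite ger0_norm ?le_max ?lexx ?orbT// ge_max ler_norm normr_ge0.
have [b hb] : exists b, has_mean Pr (fun x => Order.max (- X x) 0) b.
  apply: (has_mean_dominated _ hc) => [|x].
    by apply: measurable_maxr; [exact: measurableT_comp|exact: measurable_cst].
  by rewrite ger0_norm ?le_max ?lexx ?orbT// ge_max -normrN ler_norm normr_ge0.
exists a, b; split => //; apply: (has_mean_unique hX).
have := has_meanB ha hb; congr (has_mean _ _ _); apply/funext => x.
by rewrite /Order.max; case: ltP => ?; case: ltP => ?; lra.
Qed.

Lemma has_mean_prod (s : seq nat) (f : nat -> T' -> R) (m : nat -> R) :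
  uniq s -> (forall i, measurable_fun [set: T'] (f i)) ->
  (forall i, has_mean Pr (fun x => f i (W i x)) (m i)) ->
  has_mean Pr (fun x => \prod_(i <- s) f i (W i x)) (\prod_(i <- s) m i).
Proof.
move=> us.
(* [t] lists the indices where f may change sign. One of them is removed by splitting its factor
   into positive and negative parts, the product being linear in that factor. *)
suff h (t : seq nat) : forall f m, (forall i, measurable_fun [set: T'] (f i)) ->
    (forall i, has_mean Pr (fun x => f i (W i x)) (m i)) ->
    (forall i y, i \in s -> i \notin t -> 0 <= f i y) ->
    has_mean Pr (fun x => \prod_(i <- s) f i (W i x)) (\prod_(i <- s) m i).
  by move=> mf fm; apply: (h s f m mf fm) => i y ->.
elim: t => {f m} [|j t IH] f m mf fm f0.
  (* [mean_prod_ge0] asks for nonnegativity at every index, so f is zeroed off [s]. *)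
  pose f' i y := if i \in s then f i y else 0.
  pose m' i := if i \in s then m i else 0.
  have mf' i : measurable_fun [set: T'] (f' i).
    by rewrite /f'; have [_|_] := boolP (i \in s) => //; exact: measurable_cst.
  have f'0 i y : 0 <= f' i y by rewrite /f'; case: ifP => // is_; exact: f0.
  have fm' i : (\int[Pr]_x (f' i (W i x))%:E = (m' i)%:E)%E.
    by rewrite /f' /m'; have [_|_] := boolP (i \in s); [case: (fm i)|rewrite integral0].
  have := mean_prod_ge0 us mf' f'0 fm'.
  have -> : \prod_(i <- s) m' i = \prod_(i <- s) m i.
    by apply: eq_big_seq => i is_; rewrite /m' is_.
  have e x : \prod_(i <- s) f' i (W i x) = \prod_(i <- s) f i (W i x).
    by apply: eq_big_seq => i is_; rewrite /f' is_.
  under eq_integral => x _ do rewrite e.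
  apply: has_mean_ge0 => [|x].
    by apply: measurable_prod => i _; exact: (measurableT_comp (mf i)).
  by rewrite big_seq; apply: prodr_ge0 => i is_; exact: f0.
have [a [b [ha hb mab]]] := has_mean_pos_neg (fm j).
pose fp i y := if i == j then Order.max (f i y) 0 else f i y.
pose fn i y := if i == j then Order.max (- f i y) 0 else f i y.
pose mp i := if i == j then a else m i.
pose mn i := if i == j then b else m i.
have hp : has_mean Pr (fun x => \prod_(i <- s) fp i (W i x)) (\prod_(i <- s) mp i).
  apply: IH => [i|i|i y is_ it].
  - rewrite /fp; have [_|_] := eqVneq i j => //.
    by apply: measurable_maxr => //; exact: measurable_cst.
  - by rewrite /fp /mp; have [->|_] := eqVneq i j.
  - rewrite /fp; case: eqP => [_|/eqP ij]; first by rewrite le_max lexx orbT.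
    by apply: f0 => //; rewrite in_cons negb_or ij.
have hn : has_mean Pr (fun x => \prod_(i <- s) fn i (W i x)) (\prod_(i <- s) mn i).
  apply: IH => [i|i|i y is_ it].
  - rewrite /fn; have [_|_] := eqVneq i j => //.
    by apply: measurable_maxr; [exact: measurableT_comp|exact: measurable_cst].
  - by rewrite /fn /mn; have [->|_] := eqVneq i j.
  - rewrite /fn; case: eqP => [_|/eqP ij]; first by rewrite le_max lexx orbT.
    by apply: f0 => //; rewrite in_cons negb_or ij.
have [js|js] := boolP (j \in s); last first.
  have nj i : i \in s -> (i == j) = false.
    by move=> is_; apply: contraNF js => /eqP <-.
  have -> : \prod_(i <- s) m i = \prod_(i <- s) mp i.
    by apply: eq_big_seq => i /nj ij; rewrite /mp ij.
  move: hp; congr (has_mean _ _ _); apply/funext => x.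
  by apply: eq_big_seq => i /nj ij; rewrite /fp ij.
have E (g gp gn : nat -> R) : (forall i, i != j -> gp i = g i) ->
    (forall i, i != j -> gn i = g i) -> g j = gp j - gn j ->
    \prod_(i <- s) g i = \prod_(i <- s) gp i - \prod_(i <- s) gn i.
  move=> hgp hgn hg; rewrite !(bigD1_seq j)//= hg mulrBl.
  by rewrite (eq_bigr _ hgp) (eq_bigr _ hgn).
rewrite (E m mp mn); first last.
- by rewrite /mp /mn eqxx.
- by move=> i /negbTE ij; rewrite /mn ij.
- by move=> i /negbTE ij; rewrite /mp ij.
have := has_meanB hp hn; congr (has_mean _ _ _); apply/funext => x.
apply/esym/E.
- by move=> i /negbTE ij; rewrite /fp ij.
- by move=> i /negbTE ij; rewrite /fn ij.
- rewrite /fp /fn eqxx; move: (f j (W j x)) => y.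
  by rewrite /Order.max; case: ltP => ?; case: ltP => ?; lra.
Qed.

End independent.
End product_formula.

(** * Strong law of large numbers *)

Section geometric_scales.
Context {R : realType}.

(** Terms with a^j <= x form an increasing geometric sum, the later ones x^2 / a^j a decreasing one;
    both are O(x). Applied to x = g(W_0) and averaged, it makes the truncated second moments
    summable with only E g finite. *)
Lemma geo_min_sum (a x : R) J : 1 < a -> 0 <= x ->
  \sum_(j < J) Order.min x (a ^+ j) ^+ 2 / a ^+ j <= 2 * (a / (a - 1)) * x.
Proof.
move=> a1 x0; have a0 : 0 < a by lra.
have d0 : 0 < a - 1 by lra.
(* [D] is kept opaque so that the linear arithmetic below treats it as an atom. *)
have [D DE] : {D | D = a / (a - 1)} by exists (a / (a - 1)).
rewrite -DE.
have D1 : 1 <= D by rewrite DE ler_pdivlMr//; lra.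
have D0 : 0 <= D by exact: le_trans ler01 D1.
have Da : a * D - D = a by rewrite DE; field; apply: lt0r_neq0.
have aj j : 0 < a ^+ j by rewrite exprn_gt0.
(* Invariants before and after a^J passes x; in the second, D x^2 / a^J drops by exactly the next
   summand. *)
suff : (a ^+ J <= x -> \sum_(j < J) Order.min x (a ^+ j) ^+ 2 / a ^+ j <= a ^+ J / (a - 1)) /\
  (x < a ^+ J -> \sum_(j < J) Order.min x (a ^+ j) ^+ 2 / a ^+ j <=
     2 * D * x - D * x ^+ 2 / a ^+ J).
  have [Jx|xJ] := leP (a ^+ J) x => -[h1 h2].
    apply: le_trans (h1 isT) _; apply: (@le_trans _ _ (D * x)).
      rewrite DE mulrAC; apply: ler_wpM2r; first by rewrite invr_ge0 ltW.
      have : 1 * a ^+ J <= a * x by apply: ler_pM => //; [exact: ltW|exact: ltW].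
      by rewrite mul1r.
    have : 0 <= D * x by rewrite mulr_ge0.
    lra.
  apply: le_trans (h2 isT) _; rewrite gerBl.
  by rewrite divr_ge0 ?(ltW (aj _))// mulr_ge0 ?sqr_ge0//.
elim: J => [|J [IH1 IH2]].
  rewrite big_ord0 expr0 divr1; split=> hx; first by rewrite divr_ge0// ltW.
  have : 0 <= D * x * (2 - x) by apply: mulr_ge0; [exact: mulr_ge0|lra].
  by rewrite expr2; lra.
rewrite !big_ord_recr/= exprS.
have sq : a ^+ J ^+ 2 / a ^+ J = a ^+ J by rewrite expr2 mulfK// gt_eqF.
have k : a ^+ J / (a - 1) + a ^+ J = a * a ^+ J / (a - 1).
  by field; apply: lt0r_neq0.
split=> hx.
  have Jx : a ^+ J <= x by apply: le_trans hx; rewrite ler_peMl// ltW.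
  rewrite min_r// sq -k lerD2r; exact: IH1.
have [Jx|xJ] := leP (a ^+ J) x.
  rewrite sq; apply: le_trans (_ : a * a ^+ J / (a - 1) <= _).
    by rewrite -k lerD2r; exact: IH1.
  have h1 : a * a ^+ J / (a - 1) = D * a ^+ J by rewrite DE mulrAC.
  have h2 : D * x ^+ 2 / (a * a ^+ J) <= D * x.
    rewrite ler_pdivrMr ?mulr_gt0// -mulrA; apply: ler_wpM2l => //.
    by rewrite expr2; apply: ler_wpM2l => //; exact: ltW.
  rewrite h1; have := ler_wpM2l D0 Jx; lra.
apply: le_trans (lerD (IH2 xJ) (lexx _)) _.
set y := x ^+ 2 / a ^+ J.
have -> : D * x ^+ 2 / a ^+ J = D * y by rewrite /y mulrA.
have -> : D * x ^+ 2 / (a * a ^+ J) = D * y / a.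
  by rewrite /y invfM; ring.
have : (D * y - D * y / a) = y.
  have -> : D = a * (D - 1) by lra.
  rewrite DE; field.
  by rewrite !lt0r_neq0.
lra.
Qed.

Lemma geo_scale_cvg (a : R) : 1 < a ->
  (Num.truncn (a ^+ j))%:R / a ^+ j @[j --> \oo] --> (1 : R).
Proof.
move=> a1; have a0 : 0 < a by lra.
have aj j : 0 < a ^+ j by rewrite exprn_gt0.
have h : 1 - a^-1 ^+ j @[j --> \oo] --> (1 - 0 : R).
  apply: cvgB; first exact: cvg_cst.
  by apply: cvg_expr; rewrite ger0_norm ?invr_ge0 ?(ltW a0)// invf_lt1.
rewrite subr0 in h; apply: (squeeze_cvgr _ h (cvg_cst (1 : R))).
apply: nearW => j; apply/andP; split; last first.
  by rewrite ler_pdivrMr// mul1r truncn_le ltW.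
rewrite ler_pdivlMr// mulrBl mul1r exprVn mulVf ?gt_eqF// lerBlDr natr1.
by apply: ltW; exact: truncnS_gt.
Qed.

Lemma expr_unbounded (a : R) (n : nat) : 1 < a -> exists j, n%:R < a ^+ j.
Proof.
move=> a1; have a0 : 0 < a by lra.
have : a^-1 ^+ j @[j --> \oo] --> (0 : R).
  by apply: cvg_expr; rewrite ger0_norm ?invr_ge0 ?(ltW a0)// invf_lt1.
have e0 : 0 < (n.+1%:R : R)^-1 by rewrite invr_gt0.
move=> /cvgn_epsP/(_ _ e0)[j /(_ j (leqnn j))]; rewrite subr0 exprVn.
rewrite ger0_norm ?invr_ge0 ?exprn_ge0 ?(ltW a0)// lef_pV2 ?posrE ?exprn_gt0// => h.
by exists j; apply: lt_le_trans h; rewrite ltr_nat.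
Qed.

(* A nondecreasing sequence is controlled between consecutive geometric times,
   up to the ratio of the progression, which can be taken close to 1. *)
Lemma monotone_mean_of_geometric (S : nat -> R) (mu : R) :
  (forall n, 0 <= S n) -> (forall n m, (n <= m)%N -> S n <= S m) ->
  (forall k : nat, S (Num.truncn ((1 + k.+1%:R^-1 : R) ^+ j)) / (1 + k.+1%:R^-1) ^+ j
     @[j --> \oo] --> mu) ->
  n%:R^-1 * S n @[n --> \oo] --> mu.
Proof.
move=> S0 Snd hS.
have mu0 : 0 <= mu.
  have := hS 0%N => h; rewrite -(cvg_lim (@Rhausdorff R) h).
  apply: limr_ge; first by apply/cvg_ex; exists mu.
  by apply: nearW => j; rewrite divr_ge0// exprn_ge0// addr_ge0.
(* k is taken so large that the ratio 1 + 1/(k+1) inflates mu + dl by at most dl. *)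
apply/cvgn_epsP => e e0; pose dl := e / 3; have dl0 : 0 < dl by rewrite divr_gt0.
have eE : e = dl + dl + dl by rewrite /dl; lra.
pose k := Num.truncn ((mu + dl) / dl); pose q := k.+1%:R^-1 : R.
have q0 : 0 < q by rewrite invr_gt0.
have hq : (mu + dl) * q <= dl.
  have := truncnS_gt ((mu + dl) / dl); rewrite -/k ltr_pdivrMr// => h.
  by rewrite ler_pdivrMr// ltW// mulrC.
pose a := 1 + q; have a1 : 1 < a by rewrite /a; lra.
have a0 : 0 < a by lra.
have aj j : 0 < a ^+ j by rewrite exprn_gt0.
have /cvgn_epsP/(_ _ dl0)[N hN] := hS k; rewrite -/q -/a in hN.
exists (Num.truncn (a ^+ N)).+1 => n nN.
have n0 : 0 < n%:R :> R by rewrite ltr0n (leq_trans _ nN).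
(* Minimality of J brackets n between consecutive powers, a^(J-1) <= n < a^J; J = 0 is excluded by n
   >= 1. *)
have [J nJ Jmin] := ex_minnP (expr_unbounded n a1).
have aNn : a ^+ N < n%:R by apply: lt_le_trans (truncnS_gt _) _; rewrite ler_nat.
case: J nJ Jmin => [|j] nJ Jmin.
  by move: nJ; rewrite expr0 ltNge ler1n -(ltr0n R) n0.
have jn : a ^+ j <= n%:R by rewrite leNgt; apply/negP => /Jmin; rewrite ltnn.
have Nj : (N <= j)%N.
  by rewrite -ltnS -(ltr_eXn2l a1); exact: lt_trans aNn nJ.
have [hj hj1] := (hN _ Nj, hN _ (leqW Nj)).
have up : S n / n%:R <= a * (mu + dl).
  have h1 : S n <= S (Num.truncn (a ^+ j.+1)).
    by apply: Snd; rewrite truncn_ge_nat ?(ltW (aj _))// ltW.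
  have h2 : S (Num.truncn (a ^+ j.+1)) <= (mu + dl) * a ^+ j.+1.
    rewrite -ler_pdivrMr//; have := le_trans (ler_norm _) hj1; lra.
  rewrite ler_pdivrMr//; apply: le_trans h1 (le_trans h2 _).
  rewrite exprS; have := ler_wpM2l (_ : 0 <= a * (mu + dl)) jn.
  rewrite mulrA [(mu + dl) * a]mulrC; apply; rewrite mulr_ge0 ?(ltW a0)//; lra.
have lo : mu - e <= S n / n%:R.
  have [h0|h0] := leP mu e.
    by apply: (@le_trans _ _ 0); [lra|rewrite divr_ge0].
  have h1 : S (Num.truncn (a ^+ j)) <= S n.
    apply: Snd; rewrite -(ler_nat R); apply: le_trans jn; by rewrite truncn_le ltW.
  have h2 : (mu - dl) * a ^+ j <= S (Num.truncn (a ^+ j)).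
    rewrite -ler_pdivlMr//; move: hj; rewrite ler_norml => /andP[h _]; lra.
  rewrite ler_pdivlMr//; apply: le_trans (le_trans h2 h1).
  apply: (@le_trans _ _ ((mu - e) * (a * a ^+ j))).
    by apply: ler_wpM2l; [lra|rewrite -exprS ltW].
  rewrite mulrA; apply: ler_wpM2r; first exact: ltW.
  have h4 : (mu - e) * q <= dl.
    by apply: le_trans hq; apply: ler_wpM2r; [exact: ltW|lra].
  rewrite /a mulrDr mulr1; lra.
rewrite mulrC ler_norml; apply/andP; split; first lra.
have : a * (mu + dl) = mu + dl + (mu + dl) * q by rewrite /a; ring.
lra.
Qed.

End geometric_scales.

Section equidistribution.
Context {R : realType} {d1 d2 d' : measure_display}.
Context {T1 : measurableType d1} {T2 : measurableType d2} {T' : measurableType d'}.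
Variables (P1 : probability T1 R) (P2 : probability T2 R).
Variables (X : {RV P1 >-> T'}) (Y : {RV P2 >-> T'}).
Hypothesis XY : forall B, measurable B -> distribution P2 Y B = distribution P1 X B.

Let transfer_ge0 (g : T' -> R) m : measurable_fun [set: T'] g -> (forall y, 0 <= g y) ->
  has_mean P1 (fun x => g (X x)) m -> has_mean P2 (fun x => g (Y x)) m.
Proof.
move=> mg g0 [_ hm]; apply: has_mean_ge0 => //; first exact: (measurableT_comp mg).
have mE : measurable_fun [set: T'] (EFin \o g) by exact/measurable_EFinP.
have gE0 y : (0 <= (EFin \o g) y)%E by rewrite lee_fin.
rewrite -[LHS](ge0_integral_distribution Y mE gE0) -hm.
rewrite -[RHS](ge0_integral_distribution X mE gE0).
by apply: eq_measure_integral => B mB _; exact: XY.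
Qed.

(** Serves both to pass from W_0 to W_t and to pass to the copy of the disturbance on the
    probability space of a policy. *)
Lemma has_mean_transfer (g : T' -> R) m : measurable_fun [set: T'] g ->
  has_mean P1 (fun x => g (X x)) m -> has_mean P2 (fun x => g (Y x)) m.
Proof.
move=> mg hm; have [a [b [ha hb ->]]] := has_mean_pos_neg hm.
have ha' : has_mean P2 (fun x => Order.max (g (Y x)) 0) a.
  apply: (transfer_ge0 (g := fun y => Order.max (g y) 0)) => // [|y].
    by apply: measurable_maxr => //; exact: measurable_cst.
  by rewrite le_max lexx orbT.
have hb' : has_mean P2 (fun x => Order.max (- g (Y x)) 0) b.
  apply: (transfer_ge0 (g := fun y => Order.max (- g y) 0)) => // [|y].
    by apply: measurable_maxr; [exact: measurableT_comp|exact: measurable_cst].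
  by rewrite le_max lexx orbT.
have := has_meanB ha' hb'; congr (has_mean _ _ _); apply/funext => x.
by rewrite /Order.max; case: ltP => ?; case: ltP => ?; lra.
Qed.

End equidistribution.

Section second_moments.
Context {R : realType} {d : measure_display} {T : measurableType d}.
Variable Pr : probability T R.

Lemma has_mean_bounded (X : T -> R) c : measurable_fun [set: T] X ->
  (forall x, `|X x| <= c) -> exists m, has_mean Pr X m.
Proof. by move=> mX; exact: (has_mean_dominated mX (has_mean_cst Pr c)). Qed.

Lemma has_mean_orthogonal_sum (Z : nat -> T -> R) v n :
  (forall t, has_mean Pr (fun x => Z t x ^+ 2) v) ->
  (forall t s, t != s -> has_mean Pr (fun x => Z t x * Z s x) 0) ->
  has_mean Pr (fun x => (\sum_(t < n) Z t x) ^+ 2) (n%:R * v).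
Proof.
move=> Zv Z0.
have -> : n%:R * v = \sum_(t < n) \sum_(s < n) (if t == s then v else 0).
  rewrite (eq_bigr (fun=> v)) => [|t _]; first by rewrite sumr_const card_ord mulr_natl.
  by rewrite -big_mkcond/= (big_pred1 t)// => s; rewrite eq_sym.
have h : has_mean Pr (fun x => \sum_(t < n) \sum_(s < n) Z t x * Z s x)
   (\sum_(t < n) \sum_(s < n) (if t == s then v else 0)).
  apply: has_mean_sum => t; apply: has_mean_sum => s; case: eqP => [->|/eqP ts].
    by have := Zv s; congr (has_mean _ _ _); apply/funext => x; rewrite expr2.
  exact: Z0.
move: h; congr (has_mean _ _ _); apply/funext => x.
by rewrite expr2 mulr_suml; apply: eq_bigr => t _; rewrite mulr_sumr.
Qed.

End second_moments.

Section strong_law.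
Context {R : realType} {d d' : measure_display} {T : measurableType d} {T' : measurableType d'}.
Variable Pr : probability T R.
Variable W : nat -> {RV Pr >-> T'}.
Hypothesis W_iid : IID W.

Lemma has_mean_iid (g : T' -> R) m t : measurable_fun [set: T'] g ->
  has_mean Pr (fun x => g (W 0%N x)) m -> has_mean Pr (fun x => g (W t x)) m.
Proof.
move=> mg; apply: has_mean_transfer => // B mB.
by case: W_iid => _; apply.
Qed.

Lemma has_mean_pair (f g : T' -> R) a b t s : t != s ->
  measurable_fun [set: T'] f -> measurable_fun [set: T'] g ->
  has_mean Pr (fun x => f (W t x)) a -> has_mean Pr (fun x => g (W s x)) b ->
  has_mean Pr (fun x => f (W t x) * g (W s x)) (a * b).
Proof.
move=> ts mf mg hf hg.
pose F i := if i == t then f else if i == s then g else fun=> 0.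
pose m i := if i == t then a else if i == s then b else 0.
have mF i : measurable_fun [set: T'] (F i).
  by rewrite /F; case: eqP => // _; case: eqP => // _; exact: measurable_cst.
have hF i : has_mean Pr (fun x => F i (W i x)) (m i).
  rewrite /F /m; case: eqP => [->//|_]; case: eqP => [->//|_].
  exact: has_mean_cst.
have us : uniq [:: t; s] by rewrite /= inE ts.
have := has_mean_prod W_iid.1 us mF hF.
have st : (s == t) = false by rewrite eq_sym; exact/negbTE.
rewrite !big_cons big_nil mulr1 /m !eqxx st.
by under eq_fun do rewrite !big_cons big_nil mulr1 /F !eqxx st.
Qed.

Section nonnegative.
Variables (g : T' -> R) (mu : R).
Hypotheses (mg : measurable_fun [set: T'] g) (g0 : forall y, 0 <= g y).
Hypothesis g_mean : has_mean Pr (fun x => g (W 0%N x)) mu.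

(* Etemadi's argument along [a ^+ j]: with [Y] the truncation of [g] at
   [a ^+ j], both the variance of the centred sum and the probability that the
   truncation is active are bounded by [E (Y ^+ 2) / a ^+ j], which is summable. *)
Lemma strong_law_geometric (a : R) : 1 < a -> {ae Pr, forall x,
  (\sum_(t < Num.truncn (a ^+ j)) g (W t x)) / a ^+ j @[j --> \oo] --> mu}.
Proof.
move=> a1; have a0 : 0 < a by lra.
have aj j : 0 < a ^+ j by rewrite exprn_gt0.
pose N j := Num.truncn (a ^+ j).
have Na j : (N j)%:R <= a ^+ j by rewrite truncn_le ltW.
pose Y j y := Order.min (g y) (a ^+ j).
have mY j : measurable_fun [set: T'] (Y j).
  by apply: measurable_minr => //; exact: measurable_cst.
have Y0 j y : 0 <= Y j y by rewrite le_min g0 ltW.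
have Ya j y : Y j y <= a ^+ j by rewrite ge_min lexx orbT.
have mYW j t : measurable_fun [set: T] (fun x => Y j (W t x)) by exact: (measurableT_comp (mY j)).
have /choice [m1 hm1] j : exists m, has_mean Pr (fun x => Y j (W 0%N x)) m.
  by apply: (@has_mean_bounded _ _ _ Pr _ (a ^+ j)) => // x; rewrite ger0_norm.
have /choice [m2 hm2] j : exists m, has_mean Pr (fun x => Y j (W 0%N x) ^+ 2) m.
  apply: (@has_mean_bounded _ _ _ Pr _ ((a ^+ j) ^+ 2)) => [|x]; first exact: measurable_funX.
  by rewrite ger0_norm ?sqr_ge0// lerXn2r// nnegrE// ltW.
have m2_0 j : 0 <= m2 j.
  by apply: (has_mean_le (has_mean_cst Pr 0) (hm2 j)) => x; exact: sqr_ge0.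
pose Z j t x := Y j (W t x) - m1 j.
have hZ2 j t : has_mean Pr (fun x => Z j t x ^+ 2) (m2 j - m1 j ^+ 2).
  have h1 := has_mean_iid t (mY j) (hm1 j).
  have h2 := has_mean_iid t (measurable_funX 2 (mY j)) (hm2 j).
  have := has_meanD (has_meanB h2 (has_meanZ (2 * m1 j) h1)) (has_mean_cst Pr (m1 j ^+ 2)).
  congr (has_mean _ _ _); last by ring.
  by apply/funext => x; rewrite /Z /=; ring.
have hZZ j t s : t != s -> has_mean Pr (fun x => Z j t x * Z j s x) 0.
  move=> ts; rewrite -(mulr0 0).
  have mZ : measurable_fun [set: T'] (fun y => Y j y - m1 j).
    by apply: measurable_funB => //; exact: measurable_cst.
  have hZ r : has_mean Pr (fun x => Y j (W r x) - m1 j) 0.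
    rewrite -(subrr (m1 j)); apply: has_meanB; last exact: has_mean_cst.
    exact: (has_mean_iid r (mY j) (hm1 j)).
  exact: (has_mean_pair ts mZ mZ).
(* One quantity for both errors: the first term is the squared centred average, and the second is at
   least 1 as soon as a truncation at a^j is active before time N j. *)
pose F j x := (a ^+ j)^-2 * (\sum_(t < N j) Z j t x) ^+ 2
  + (a ^+ j)^-2 * \sum_(t < N j) Y j (W t x) ^+ 2.
have hF j : has_mean Pr (F j) ((a ^+ j)^-2 * ((N j)%:R * (m2 j - m1 j ^+ 2))
    + (a ^+ j)^-2 * \sum_(t < N j) m2 j).
  apply: has_meanD; apply: has_meanZ.
    exact: (has_mean_orthogonal_sum (N j) (hZ2 j) (hZZ j)).
  by apply: has_mean_sum => t; exact: (has_mean_iid t (measurable_funX 2 (mY j)) (hm2 j)).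
have F_le j : (a ^+ j)^-2 * ((N j)%:R * (m2 j - m1 j ^+ 2))
    + (a ^+ j)^-2 * \sum_(t < N j) m2 j <= 2 * (m2 j / a ^+ j).
  rewrite sumr_const card_ord -mulr_natl.
  have h1 : (N j)%:R * (m2 j - m1 j ^+ 2) <= a ^+ j * m2 j.
    apply: (@le_trans _ _ ((N j)%:R * m2 j)); last by apply: ler_wpM2r.
    by apply: ler_wpM2l => //; rewrite gerBl sqr_ge0.
  have h2 : (N j)%:R * m2 j <= a ^+ j * m2 j by apply: ler_wpM2r.
  have i0 : 0 <= (a ^+ j)^-2 by rewrite invr_ge0 sqr_ge0.
  have e : (a ^+ j)^-2 * (a ^+ j * m2 j) = m2 j / a ^+ j.
    by field; apply: lt0r_neq0.
  have := ler_wpM2l i0 h1; have := ler_wpM2l i0 h2; rewrite e; lra.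
have sumF J : \sum_(j < J) ((a ^+ j)^-2 * ((N j)%:R * (m2 j - m1 j ^+ 2))
    + (a ^+ j)^-2 * \sum_(t < N j) m2 j) <= 2 * (2 * (a / (a - 1)) * mu).
  apply: (@le_trans _ _ (\sum_(j < J) 2 * (m2 j / a ^+ j))).
    by apply: ler_sum => j _; exact: F_le.
  rewrite -mulr_sumr; apply: ler_wpM2l => //.
  have hs : has_mean Pr (fun x => \sum_(j < J) Y j (W 0%N x) ^+ 2 / a ^+ j)
      (\sum_(j < J) m2 j / a ^+ j).
    apply: has_mean_sum => j; have := has_meanZ (a ^+ j)^-1 (hm2 j).
    by rewrite mulrC; under eq_fun do rewrite mulrC.
  apply: (has_mean_le hs (has_meanZ (2 * (a / (a - 1))) g_mean)) => x.
  by apply: geo_min_sum => //; exact: g0.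
have F0 j x : 0 <= F j x.
  rewrite /F; apply: addr_ge0; apply: mulr_ge0; rewrite ?invr_ge0 ?sqr_ge0//.
  by apply: sumr_ge0 => t _; exact: sqr_ge0.
(* The bias of truncation vanishes by monotone convergence, as the levels a^j increase to
   infinity. *)
have m1mu : m1 j @[j --> \oo] --> mu.
  have Ynd x j k : (j <= k)%N -> Y j (W 0%N x) <= Y k (W 0%N x).
    move=> jk; rewrite le_min ge_min lexx/=.
    by apply: le_trans (Ya _ _) _; rewrite ler_weXn2l// ltW.
  have Yg x : Y j (W 0%N x) @[j --> \oo] --> g (W 0%N x).
    have [M hM] := expr_unbounded (Num.truncn (g (W 0%N x))).+1 a1.
    apply/cvgn_epsP => e e0; exists M => j Mj; rewrite /Y min_l ?subrr ?normr0 ?(ltW e0)//.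
    apply: le_trans (ltW (truncnS_gt _)) _; apply: le_trans (ltW hM) _.
    by rewrite ler_weXn2l// ltW.
  have h := @monotone_mean_cvg _ _ _ Pr _ _ (fun j => mYW j 0%N) (fun j x => Y0 j (W 0%N x)) Ynd Yg.
  rewrite g_mean.2 in h.
  have e : (fun j => \int[Pr]_x (Y j (W 0%N x))%:E)%E = (fun j => (m1 j)%:E).
    by apply/funext => j; case: (hm1 j).
  by rewrite e in h; exact: (fine_cvg h).
have := summable_mean_cvg0 F0 hF sumF.
apply: filterS => x Fx.
have scale := geo_scale_cvg a1; rewrite -/N in scale.
have centred : (\sum_(t < N j) Z j t x) / a ^+ j @[j --> \oo] --> (0 : R).
  apply/cvgn_epsP => e e0; have e2 : 0 < e ^+ 2 by rewrite exprn_gt0.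
  have [M hM] := (cvgn_epsP _ _).1 Fx _ e2; exists M => j /hM.
  rewrite !subr0 ger0_norm// => h.
  rewrite -(ler_pXn2r (_ : 0 < 2)%N) ?nnegrE ?(ltW e0)// real_normK ?num_real//.
  apply: le_trans h; rewrite /F expr_div_n mulrC lerDl.
  apply: mulr_ge0; first by rewrite invr_ge0 sqr_ge0.
  by apply: sumr_ge0 => t _; exact: sqr_ge0.
(* Any threshold below 1 excludes active truncations. *)
have [M hM] := (cvgn_epsP _ _).1 Fx (1 / 2) ltac:(lra).
have inactive j : (M <= j)%N -> forall t, (t < N j)%N -> Y j (W t x) = g (W t x).
  move=> Mj t tN; have := hM j Mj; rewrite subr0 ger0_norm// => h.
  rewrite /Y min_l// leNgt; apply/negP => ga.
  suff : 1 <= F j x by lra.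
  rewrite -[leLHS]addr0 addrC; apply: lerD.
    by rewrite mulr_ge0 ?sqr_ge0// invr_ge0 sqr_ge0.
  rewrite mulrC ler_pdivlMr ?exprn_gt0// mul1r (bigD1 (Ordinal tN))//=.
  rewrite /Y min_r ?(ltW ga)// lerDl; apply: sumr_ge0 => i _; exact: sqr_ge0.
have lim1 : (\sum_(t < N j) Z j t x) / a ^+ j + m1 j * ((N j)%:R / a ^+ j)
    @[j --> \oo] --> (0 + mu * 1 : R).
  by apply: cvgD; [exact: centred|apply: cvgM; [exact: m1mu|exact: scale]].
rewrite add0r mulr1 in lim1.
apply/cvgn_epsP => e e0; have [K hK] := (cvgn_epsP _ _).1 lim1 e e0.
exists (maxn M K) => j; rewrite geq_max => /andP[Mj /hK]; congr (_ <= _).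
congr (`|_ - _|); rewrite mulrA -mulrDl; congr (_ / _).
rewrite /Z sumrB sumr_const card_ord mulr_natr subrK.
by apply: eq_bigr => t _; exact: inactive.
Qed.

Lemma strong_law_nonneg : {ae Pr, forall x,
  T%:R^-1 * (\sum_(t < T) g (W t x)) @[T --> \oo] --> mu}.
Proof.
have : {ae Pr, forall x, forall k : nat,
    (\sum_(t < Num.truncn ((1 + k.+1%:R^-1 : R) ^+ j)) g (W t x)) / (1 + k.+1%:R^-1) ^+ j
      @[j --> \oo] --> mu}.
  apply: ae_foralln => k; apply: strong_law_geometric.
  by rewrite ltrDl invr_gt0.
apply: filterS => x hx.
apply: (monotone_mean_of_geometric (S := fun n => \sum_(t < n) g (W t x))) => //.
  by move=> n; apply: sumr_ge0.
move=> n m /subnK <-; rewrite addnC big_split_ord/= lerDl.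
by apply: sumr_ge0.
Qed.

End nonnegative.
End strong_law.

(** * Almost sure whiteness of the disturbance *)

Section matrix_measurability.
Context {d d' : measure_display} {T : measurableType d} {X : measurableType d'}.
Variables m n : nat.

Lemma measurable_entry (i : 'I_m) (j : 'I_n) :
  measurable_fun [set: 'M[T]_(m, n)] (fun M : 'M[T]_(m, n) => M i j).
Proof.
move=> _ B mB; rewrite setTI; apply: sub_sigma_algebra; exists (i, j) => //.
by exists B => //; rewrite setTI.
Qed.

Lemma measurable_fun_mx (f : X -> 'M[T]_(m, n)) :
  (forall i j, measurable_fun [set: X] (fun x => f x i j)) ->
  measurable_fun [set: X] f.
Proof.
move=> mf; apply: (@measurability _ _ _ _ _ f (@entry_events d T m n)) => //.
move=> _ [_ [[i j] _ [B mB <-]] <-].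
by have := mf i j measurableT B mB; congr measurable; rewrite !setTI.
Qed.

End matrix_measurability.

Section almost_sure_whiteness.
Context {R : realType} {d : measure_display} {T : measurableType d} {nw : nat}.
Variable Pr : probability T R.
Variable W : nat -> {RV Pr >-> 'cV[R]_nw}.
Hypothesis W_iid : IID W.
Hypothesis W_mean : forall a, has_mean Pr (fun x => W 0%N x a 0) 0.
Hypothesis W_cov : forall a b, has_mean Pr (fun x => W 0%N x a 0 * W 0%N x b 0) (a == b)%:R.

Let me_ a : measurable_fun [set: 'cV[R]_nw] (fun v : 'cV[R]_nw => v a 0).
Proof. exact: measurable_entry. Qed.

Let W_sqr a : has_mean Pr (fun x => W 0%N x a 0 ^+ 2) 1.
Proof. by have := W_cov a a; rewrite eqxx; under eq_fun do rewrite -expr2. Qed.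

(** The strong law above is for nonnegative functions; polarization reduces the signed product to
    the squares of sum and difference. *)
Lemma covariance_average a b : {ae Pr, forall x,
  T%:R^-1 * (\sum_(t < T) W t x a 0 * W t x b 0) @[T --> \oo] --> ((a == b)%:R : R)}.
Proof.
have hp : has_mean Pr (fun x => (W 0%N x a 0 + W 0%N x b 0) ^+ 2) (2 + 2 * (a == b)%:R).
  have := has_meanD (has_meanD (W_sqr a) (W_sqr b)) (has_meanZ 2 (W_cov a b)).
  congr (has_mean _ _ _); apply/funext => x; ring.
have hm : has_mean Pr (fun x => (W 0%N x a 0 - W 0%N x b 0) ^+ 2) (2 - 2 * (a == b)%:R).
  have := has_meanB (has_meanD (W_sqr a) (W_sqr b)) (has_meanZ 2 (W_cov a b)).
  congr (has_mean _ _ _); apply/funext => x; ring.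
have mp : measurable_fun [set: 'cV[R]_nw] (fun v : 'cV[R]_nw => (v a 0 + v b 0) ^+ 2).
  by apply: measurable_funX; apply: measurable_funD.
have mm : measurable_fun [set: 'cV[R]_nw] (fun v : 'cV[R]_nw => (v a 0 - v b 0) ^+ 2).
  by apply: measurable_funX; apply: measurable_funB.
have := strong_law_nonneg W_iid mp (fun v => sqr_ge0 _) hp.
have := strong_law_nonneg W_iid mm (fun v => sqr_ge0 _) hm.
apply: filterS2 => x hmx hpx.
have h : 4^-1 * (T%:R^-1 * (\sum_(t < T) (W t x a 0 + W t x b 0) ^+ 2)
    - T%:R^-1 * (\sum_(t < T) (W t x a 0 - W t x b 0) ^+ 2)) @[T --> \oo] -->
    (4^-1 * ((2 + 2 * (a == b)%:R) - (2 - 2 * (a == b)%:R)) : R).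
  by apply: cvgM; [exact: cvg_cst|apply: cvgB; [exact: hpx|exact: hmx]].
have e : 4^-1 * ((2 + 2 * (a == b)%:R) - (2 - 2 * (a == b)%:R)) = (a == b)%:R :> R by lra.
rewrite e in h; apply: eq_cvgn h => N.
rewrite -mulrBr mulrCA -sumrB; congr (_ * _); rewrite mulr_sumr.
by apply: eq_bigr => t _; field.
Qed.

Let Z k a b t x := W t x a 0 * W (t + k)%N x b 0.

Let Z_sqr k a b t : has_mean Pr (fun x => Z k.+1 a b t x ^+ 2) 1.
Proof.
have ts : t != (t + k.+1)%N by lia.
have h := has_mean_pair W_iid ts (measurable_funX 2 (me_ a)) (measurable_funX 2 (me_ b))
  (has_mean_iid W_iid t (measurable_funX 2 (me_ a)) (W_sqr a))
  (has_mean_iid W_iid (t + k.+1) (measurable_funX 2 (me_ b)) (W_sqr b)).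
rewrite mulr1 in h; move: h; congr (has_mean _ _ _); apply/funext => x.
by rewrite /Z exprMn.
Qed.

Let prod_pick (L : seq nat) (p : nat) (h : nat -> R) : uniq L -> p \in L ->
  \prod_(i <- L) (if i == p then h i else 1) = h p.
Proof.
move=> uL pL; rewrite (bigD1_seq p)//= eqxx big1 ?mulr1// => i /negbTE ->.
by [].
Qed.

(** Among t, t+k+1, s, s+k+1 only t+k+1 and s can coincide, so W_t occurs in a single factor, of
    mean 0. *)
Let Z_orth k a b t s : (t < s)%N ->
  has_mean Pr (fun x => Z k.+1 a b t x * Z k.+1 a b s x) 0.
Proof.
move=> ts; pose L := undup [:: t; (t + k.+1)%N; s; (s + k.+1)%N].
(* Gathers every factor at time i, so that the product formula over the distinct times in [L] also
   covers t+k+1 = s. *)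
pose F i (v : 'cV[R]_nw) := (if i == t then v a 0 else 1) *
  (if i == (t + k.+1)%N then v b 0 else 1) * (if i == s then v a 0 else 1) *
  (if i == (s + k.+1)%N then v b 0 else 1).
have mF i : measurable_fun [set: 'cV[R]_nw] (F i).
  have ite c (g : 'cV[R]_nw -> R) : measurable_fun [set: 'cV[R]_nw] g ->
      measurable_fun [set: 'cV[R]_nw] (fun v => if c then g v else 1).
    by case: c => // _; exact: measurable_cst.
  by apply: measurable_funM; [apply: measurable_funM; [apply: measurable_funM|]|];
    apply: ite.
have /choice [m hm] i : exists m, has_mean Pr (fun x => F i (W i x)) m /\ (i = t -> m = 0).
  have W_a c : has_mean Pr (fun x => W i x c 0) 0 by exact: (has_mean_iid W_iid i (me_ c)).
  rewrite /F; have [->|it] := eqVneq i t.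
    have -> : (t == (t + k.+1)%N) = false by lia.
    have -> : (t == s) = false by lia.
    have -> : (t == (s + k.+1)%N) = false by lia.
    exists 0; split => //; under eq_fun do rewrite !mulr1.
    exact: (has_mean_iid W_iid t (me_ a)).
  have [itk|itk] := eqVneq i (t + k.+1)%N.
    have -> : (i == (s + k.+1)%N) = false by lia.
    (* The coincidence t+k+1 = s, where the factor is a product of two entries of the same vector
       and its mean a covariance. *)
    have [is_|is_] := eqVneq i s.
      exists (b == a)%:R; split => [|it']; last by rewrite it' eqxx in it.
      under eq_fun do rewrite mul1r mulr1.
      exact: (has_mean_iid W_iid i (measurable_funM (me_ b) (me_ a)) (W_cov b a)).
    exists 0; split => //; under eq_fun do rewrite mul1r !mulr1; exact: W_a.
  have [is_|is_] := eqVneq i s.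
    have -> : (i == (s + k.+1)%N) = false by lia.
    exists 0; split => //; under eq_fun do rewrite !mul1r mulr1; exact: W_a.
  have [isk|isk] := eqVneq i (s + k.+1)%N.
    exists 0; split => //; under eq_fun do rewrite !mul1r; exact: W_a.
  exists 1; split => [|it']; last by rewrite it' eqxx in it.
  by under eq_fun do rewrite !mul1r; exact: has_mean_cst.
have uL : uniq L by exact: undup_uniq.
have := has_mean_prod W_iid.1 uL mF (fun i => (hm i).1).
have -> : \prod_(i <- L) m i = 0.
  rewrite (bigD1_seq t)//=; last by rewrite mem_undup inE eqxx.
  by rewrite (hm t).2// mul0r.
congr (has_mean _ _ _); apply/funext => x.
rewrite /F !big_split/=.
rewrite (prod_pick (fun i => W i x a 0))//; last by rewrite mem_undup !inE eqxx.
rewrite (prod_pick (fun i => W i x b 0))//; last by rewrite mem_undup !inE eqxx ?orbT.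
rewrite (prod_pick (fun i => W i x a 0))//; last by rewrite mem_undup !inE eqxx ?orbT.
rewrite (prod_pick (fun i => W i x b 0))//; last by rewrite mem_undup !inE eqxx ?orbT.
by rewrite /Z !mulrA.
Qed.

(** Orthogonality makes the mean square of the sum N l <= a^l, hence of the average at most a^-l,
    which is summable. *)
Lemma lag_average_geometric k i j (a : R) : 1 < a -> {ae Pr, forall x,
  (\sum_(t < Num.truncn (a ^+ l)) Z k.+1 i j t x) / a ^+ l @[l --> \oo] --> (0 : R)}.
Proof.
move=> a1; have a0 : 0 < a by lra.
have al l : 0 < a ^+ l by rewrite exprn_gt0.
pose N l := Num.truncn (a ^+ l).
have hZZ t s : t != s -> has_mean Pr (fun x => Z k.+1 i j t x * Z k.+1 i j s x) 0.
  rewrite neq_ltn => /orP[ts|st]; first exact: Z_orth.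
  by under eq_fun do rewrite mulrC; exact: Z_orth.
have hF l := has_meanZ ((a ^+ l)^-2) (has_mean_orthogonal_sum (N l) (Z_sqr k i j) hZZ).
have sumF J : \sum_(l < J) (a ^+ l)^-2 * ((N l)%:R * 1) <= (1 - a^-1)^-1.
  apply: le_trans (geo_sum_le J (_ : 0 <= a^-1) _); last 2 first.
  - by rewrite invr_ge0 ltW.
  - by rewrite invf_lt1.
  apply: ler_sum => l _; rewrite mulr1 exprVn.
  apply: (@le_trans _ _ ((a ^+ l)^-2 * a ^+ l)).
    by rewrite ler_wpM2l ?invr_ge0 ?sqr_ge0// truncn_le ltW.
  by rewrite expr2 invfM mulfVK// gt_eqF.
have F0 l x : 0 <= (a ^+ l)^-2 * (\sum_(t < N l) Z k.+1 i j t x) ^+ 2.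
  by rewrite mulr_ge0 ?invr_ge0 ?sqr_ge0.
have := summable_mean_cvg0 F0 hF sumF; apply: filterS => x Fx.
apply/cvgn_epsP => e e0; have e2 : 0 < e ^+ 2 by rewrite exprn_gt0.
have [M hM] := (cvgn_epsP _ _).1 Fx _ e2; exists M => l /hM.
rewrite !subr0 ger0_norm// => h.
rewrite -(ler_pXn2r (_ : 0 < 2)%N) ?nnegrE ?(ltW e0)// real_normK ?num_real//.
by rewrite expr_div_n mulrC.
Qed.

Lemma white_of_averages (w : nat -> 'cV[R]_nw) :
  (forall a b, T%:R^-1 * (\sum_(t < T) w t a 0 * w t b 0) @[T --> \oo] --> ((a == b)%:R : R)) ->
  (forall k i j (n : nat), let a := 1 + n.+1%:R^-1 : R in
    (\sum_(t < Num.truncn (a ^+ l)) w t i 0 * w (t + k.+1)%N j 0) / a ^+ l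
      @[l --> \oo] --> (0 : R)) ->
  white w.
Proof.
move=> h0 hk.
have entryE k N i j : mavg (fun t => w t *m (w (t + k)%N)^T) N i j =
    N%:R^-1 * (\sum_(t < N) w t i 0 * w (t + k)%N j 0).
  rewrite mxE summxE; congr (_ * _); apply: eq_bigr => t _.
  by rewrite !mxE big_ord1 mxE.
case=> [|k] i j.
  rewrite eqxx mxE; apply: eq_cvgn (h0 i j) => N.
  by rewrite entryE; under [in RHS]eq_bigr do rewrite addn0.
have -> : ((k.+1 == 0%N)%:R%:M : 'M[R]_nw) i j = 0 by rewrite raddf0 mxE.
have sqr_avg i' : N%:R^-1 * (\sum_(t < N) w t i' 0 ^+ 2) @[N --> \oo] --> (1 : R).
  have := h0 i' i'; rewrite eqxx; apply: eq_cvgn => N.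
  by congr (_ * _); apply: eq_bigr => t _; rewrite expr2.
have sqr_avg_shift : N%:R^-1 * (\sum_(t < N) w (t + k.+1)%N j 0 ^+ 2)
    @[N --> \oo] --> (1 : R).
  have e (f : nat -> R) N : mavg (fun t => (f t)%:M : 'M[R]_1) N 0 0 = N%:R^-1 * \sum_(t < N) f t.
    by rewrite mxE summxE; congr (_ * _); apply: eq_bigr => t _; rewrite mxE eqxx.
  have h : mcvg (mavg (fun t => (w t j 0 ^+ 2)%:M : 'M[R]_1)) (1%:M).
    by move=> p q; rewrite !ord1 mxE eqxx; apply: eq_cvgn (sqr_avg j) => N; rewrite e.
  have h' : mcvg _ _ := mavg_shift k.+1 h; have := h' 0 0; rewrite mxE eqxx; apply: eq_cvgn => N.
  by rewrite (e (fun t => w (t + k.+1)%N j 0 ^+ 2)).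
pose S N := \sum_(t < N) (w t i 0 + w (t + k.+1)%N j 0) ^+ 2.
have SE N : S N = \sum_(t < N) w t i 0 ^+ 2 + \sum_(t < N) w (t + k.+1)%N j 0 ^+ 2
    + 2 * \sum_(t < N) w t i 0 * w (t + k.+1)%N j 0.
  by rewrite mulr_sumr -!big_split/=; apply: eq_bigr => t _; ring.
have Savg : N%:R^-1 * S N @[N --> \oo] --> (2 : R).
  apply: monotone_mean_of_geometric.
  - by move=> N; apply: sumr_ge0 => t _; exact: sqr_ge0.
  - move=> n m /subnK <-; rewrite addnC /S big_split_ord/= lerDl.
    by apply: sumr_ge0 => t _; exact: sqr_ge0.
  move=> n; set a := 1 + n.+1%:R^-1.
  have a1 : 1 < a by rewrite ltrDl invr_gt0.
  have al l : 0 < a ^+ l by rewrite exprn_gt0// (lt_trans _ a1).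
  pose N l := Num.truncn (a ^+ l).
  have Noo : N l @[l --> \oo] --> \oo.
    move=> E [M _ ME]; have [l0 hl0] := expr_unbounded M a1.
    exists l0 => // l /= l0l; apply: ME => /=.
    rewrite truncn_ge_nat ?(ltW (al _))//; apply: le_trans (ltW hl0) _.
    by rewrite ler_weXn2l// ltW.
  have scale := geo_scale_cvg a1; rewrite -/N in scale.
  (* Replaces the normalization by N l with a^l, their ratio tending to 1; N l > 0 since a^l >=
     1. *)
  have rescale (f : nat -> R) (c : R) : N%:R^-1 * f N @[N --> \oo] --> c ->
      f (N l) / a ^+ l @[l --> \oo] --> c.
    move=> fc; have h : (N l)%:R^-1 * f (N l) * ((N l)%:R / a ^+ l) @[l --> \oo] --> (c * 1 : R).
      by apply: cvgM; [exact: (cvg_comp _ _ Noo fc)|exact: scale].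
    rewrite mulr1 in h; apply: eq_cvgn h => l.
    have N0 : (N l)%:R != 0 :> R.
      by rewrite pnatr_eq0 -lt0n truncn_gt0 exprn_ege1// ltW.
    by field; rewrite N0 gt_eqF.
  have h : (\sum_(t < N l) w t i 0 ^+ 2) / a ^+ l
      + (\sum_(t < N l) w (t + k.+1)%N j 0 ^+ 2) / a ^+ l
      + 2 * ((\sum_(t < N l) w t i 0 * w (t + k.+1)%N j 0) / a ^+ l) @[l --> \oo]
      --> (1 + 1 + 2 * 0 : R).
    apply: cvgD; first apply: cvgD.
    - exact: (rescale (fun N => \sum_(t < N) w t i 0 ^+ 2) 1 (sqr_avg i)).
    - exact: (rescale (fun N => \sum_(t < N) w (t + k.+1)%N j 0 ^+ 2) 1 sqr_avg_shift).
    - by apply: cvgM; [exact: cvg_cst|exact: hk].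
  rewrite mulr0 addr0 in h; apply: eq_cvgn h => l.
  by rewrite SE -!mulrDl mulrA -mulrDl.
have h : 2^-1 * (N%:R^-1 * S N - N%:R^-1 * (\sum_(t < N) w t i 0 ^+ 2)
    - N%:R^-1 * (\sum_(t < N) w (t + k.+1)%N j 0 ^+ 2)) @[N --> \oo] -->
    (2^-1 * (2 - 1 - 1) : R).
  apply: cvgM; first exact: cvg_cst.
  by apply: cvgB; [apply: cvgB; [exact: Savg|exact: sqr_avg]|exact: sqr_avg_shift].
have e : 2^-1 * (2 - 1 - 1) = 0 :> R by lra.
rewrite e in h; apply: eq_cvgn h => N; rewrite entryE SE.
by move: (N%:R^-1) => q; field.
Qed.

Theorem white_ae : {ae Pr, forall x, white (fun t => W t x)}.
Proof.
have h0 : {ae Pr, forall x, forall a b,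
    T%:R^-1 * (\sum_(t < T) W t x a 0 * W t x b 0) @[T --> \oo] --> ((a == b)%:R : R)}.
  by apply: filter_forall => a; apply: filter_forall => b; exact: covariance_average.
have hk : {ae Pr, forall x, forall k i j (n : nat), let a := 1 + n.+1%:R^-1 : R in
    (\sum_(t < Num.truncn (a ^+ l)) W t x i 0 * W (t + k.+1)%N x j 0) / a ^+ l
      @[l --> \oo] --> (0 : R)}.
  apply: ae_foralln => k; apply: filter_forall => i; apply: filter_forall => j.
  apply: ae_foralln => n; apply: lag_average_geometric.
  by rewrite ltrDl invr_gt0.
by apply: filterS2 h0 hk => x; exact: white_of_averages.
Qed.

End almost_sure_whiteness.

(** * The noncausal cost as a lower bound *)

Section linear_measurability.
Context {R : realType} {d : measure_display} {X : measurableType d}.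

Lemma measurable_mx_entry m n (f : X -> 'M[R]_(m, n)) i j :
  measurable_fun [set: X] f -> measurable_fun [set: X] (fun x => f x i j).
Proof. by move=> mf; exact: (measurableT_comp (measurable_entry i j) mf). Qed.

Lemma measurable_mxM m n p (M : 'M[R]_(m, n)) (f : X -> 'M[R]_(n, p)) :
  measurable_fun [set: X] f -> measurable_fun [set: X] (fun x => M *m f x).
Proof.
move=> mf; apply: measurable_fun_mx => i j; under eq_fun do rewrite mxE.
apply: measurable_sum => k; apply: measurable_funM; first exact: measurable_cst.
exact: measurable_mx_entry.
Qed.

Lemma measurable_mxD m n (f g : X -> 'M[R]_(m, n)) :
  measurable_fun [set: X] f -> measurable_fun [set: X] g ->
  measurable_fun [set: X] (fun x => f x + g x).
Proof.
move=> mf mg; apply: measurable_fun_mx => i j; under eq_fun do rewrite mxE.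
by apply: measurable_funD; exact: measurable_mx_entry.
Qed.

Lemma measurable_mxN m n (f : X -> 'M[R]_(m, n)) :
  measurable_fun [set: X] f -> measurable_fun [set: X] (fun x => - f x).
Proof.
move=> mf; apply: measurable_fun_mx => i j; under eq_fun do rewrite mxE.
by apply: measurableT_comp => //; exact: measurable_mx_entry.
Qed.

Lemma measurable_mxB m n (f g : X -> 'M[R]_(m, n)) :
  measurable_fun [set: X] f -> measurable_fun [set: X] g ->
  measurable_fun [set: X] (fun x => f x - g x).
Proof. by move=> mf mg; apply: measurable_mxD => //; exact: measurable_mxN. Qed.

Lemma measurable_mx_sum m n I (s : seq I) (f : I -> X -> 'M[R]_(m, n)) :
  (forall i, measurable_fun [set: X] (f i)) ->
  measurable_fun [set: X] (fun x => \sum_(i <- s) f i x).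
Proof.
move=> mf; apply: measurable_fun_mx => a b; under eq_fun do rewrite summxE.
by apply: measurable_sum => i; exact: measurable_mx_entry.
Qed.

Lemma measurable_col m n (f : X -> 'M[R]_(m, n)) j :
  measurable_fun [set: X] f -> measurable_fun [set: X] (fun x => col j (f x)).
Proof.
move=> mf; apply: measurable_fun_mx => a b; under eq_fun do rewrite mxE.
exact: measurable_mx_entry.
Qed.

Lemma measurable_prefix n N (z : X -> nat -> 'cV[R]_n) :
  (forall t, measurable_fun [set: X] (fun x => z x t)) ->
  measurable_fun [set: X] (fun x => prefix_mx (z x) N).
Proof.
move=> mz; apply: measurable_fun_mx => i j; under eq_fun do rewrite mxE.
exact: measurable_mx_entry.
Qed.

End linear_measurability.

Section expectation.
Context {R : realType} {d : measure_display} {T : measurableType d}.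
Variable Pr : probability T R.

Lemma expectationE (X : T -> R) : ('E_Pr[X] = \int[Pr]_x (X x)%:E)%E.
Proof. by rewrite unlock. Qed.

Lemma has_mean_le_integral (X : T -> R) M : measurable_fun [set: T] X ->
  (forall x, 0 <= X x) -> (\int[Pr]_x (X x)%:E <= M%:E)%E ->
  exists2 m, has_mean Pr X m & m <= M.
Proof.
move=> mX X0 XM.
have I0 : (0 <= \int[Pr]_x (X x)%:E)%E by apply: integral_ge0 => x _; rewrite lee_fin.
have fin : (\int[Pr]_x (X x)%:E)%E \is a fin_num.
  by rewrite ge0_fin_numE//; apply: le_lt_trans XM _; exact: ltry.
exists (fine (\int[Pr]_x (X x)%:E)); last by rewrite -lee_fin fineK.
by apply: has_mean_ge0 => //; rewrite fineK.
Qed.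

(** Deterministic facts can be read off a single path: their negation would make almost every point
    contradictory. *)
Lemma ae_false : ~ {ae Pr, forall x : T, False}.
Proof.
move=> [N [mN N0 sN]].
have NT : N = setT by apply/seteqP; split => // x _; apply: sN.
have : Pr setT = 1%E by exact: probability_setT.
by rewrite -NT N0 => /eqP; rewrite eqe eq_sym oner_eq0.
Qed.

(** Prescribed expectations do not state integrability. Squares are nonnegative with a finite
    integral; they dominate the rest through |y| <= 1 + y^2 and |yz| <= y^2 + z^2. *)
Lemma unit_covariance_means nw (w : nat -> {RV Pr >-> 'cV[R]_nw}) :
  zero_mean_unit_covariance w ->
  (forall a, has_mean Pr (fun x => w 0%N x a 0) 0) /\
  (forall a b, has_mean Pr (fun x => w 0%N x a 0 * w 0%N x b 0) (a == b)%:R).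
Proof.
move=> [h1 h2].
have mw a : measurable_fun [set: T] (fun x => w 0%N x a 0).
  exact: measurable_mx_entry.
have c a b : (\int[Pr]_x (w 0%N x a 0 * w 0%N x b 0)%:E = (a == b)%:R%:E)%E.
  have := h2 0%N 0%N a b; rewrite eqxx mul1r mxE expectationE => <-.
  by apply: eq_integral => x _; rewrite mxE big_ord1 mxE.
have hs a : has_mean Pr (fun x => w 0%N x a 0 * w 0%N x a 0) 1.
  apply: has_mean_ge0 => [|x|]; first exact: measurable_funM.
    by rewrite -expr2 sqr_ge0.
  by rewrite c eqxx.
split=> [a|a b].
  have [m hm] : exists m, has_mean Pr (fun x => w 0%N x a 0) m.
    apply: (has_mean_dominated (mw a) (has_meanD (has_mean_cst Pr 1) (hs a))) => x /=.
    rewrite -expr2 -real_normK ?num_real//; move: (`|_|) (normr_ge0 (w 0%N x a 0)) => y y0.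
    have := sqr_ge0 (y - 1); nra.
  suff -> : (0 : R) = m by [].
  by have := h1 0%N a; rewrite expectationE hm.2 => -[].
have [m hm] : exists m, has_mean Pr (fun x => w 0%N x a 0 * w 0%N x b 0) m.
  apply: (has_mean_dominated _ (has_meanD (hs a) (hs b))) => [|x /=].
    exact: measurable_funM.
  rewrite normrM -!expr2 -[_ ^+ 2]real_normK ?num_real// -[w 0%N x b 0 ^+ 2]real_normK ?num_real//.
  move: (`|_|) (`|_|) (normr_ge0 (w 0%N x a 0)) (normr_ge0 (w 0%N x b 0)) => y z y0 z0.
  have := sqr_ge0 (y - z); nra.
suff -> : (a == b)%:R = m by [].
by have := c a b; rewrite hm.2 => -[].
Qed.

End expectation.

Section noncausal_cost.
Context {R : realType} {nx nu nw : nat}.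
Variables (A : 'M[R]_nx) (Bu : 'M[R]_(nx, nu)) (Bw : 'M[R]_(nx, nw)).
Variables (Q : 'M[R]_nx) (Ru : 'M[R]_nu) (P : 'M[R]_nx).
Hypotheses (hQ : possemidef Q) (hR : posdef Ru).
Hypothesis hP : stabilizing_solution A Bu Q Ru P.
Context {d : measure_display} {T : measurableType d}.
Variables (Pr : probability T R) (w : nat -> {RV Pr >-> 'cV[R]_nw}).
Hypotheses (hiid : IID w) (hw : zero_mean_unit_covariance w).
Variable X : 'M[R]_nx.
Hypothesis hX : lyapunov A Bu Bw Ru P X.

Local Notation J := (optimal_noncausal_cost Bu Bw Ru P X).

Lemma disturbance_white : {ae Pr, forall x, white (fun t => w t x)}.
Proof. by have [h1 h2] := unit_covariance_means hw; exact: white_ae. Qed.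

Lemma average_cost_ge0 x u N : (0 <= average_cost Q Ru x u N)%E.
Proof.
rewrite lee_fin mulr_ge0 ?invr_ge0//; apply: sumr_ge0 => t _; apply: addr_ge0.
  by case: hQ => _; apply.
exact: quad_ge0.
Qed.

Lemma average_cost_lim_ge0 x u (c : R) :
  average_cost Q Ru x u N @[N --> \oo] --> c%:E -> 0 <= c.
Proof.
move=> h; rewrite -lee_fin -(cvg_lim (@ereal_hausdorff R) h).
apply: lime_ge; first by apply/cvg_ex; eexists; exact: h.
by apply: nearW => N; exact: average_cost_ge0.
Qed.

(** J is a limit of nonnegative averages along any white path, and almost sure whiteness provides
    one. *)
Lemma optimal_noncausal_cost_ge0 : 0 <= J.
Proof.
rewrite leNgt; apply/negP => J0; apply: (@ae_false _ _ _ Pr).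
apply: filterS disturbance_white => x hx.
have := average_cost_lim_ge0 (nc_average_cost hP hx hX 0).
by rewrite leNgt J0.
Qed.

Lemma nc_cost_definedP x0 : nc_cost_defined A Bu Bw Q Ru P w x0.
Proof.
apply: filterS disturbance_white => x hx.
by apply/cvg_ex; eexists; exact: (nc_average_cost hP hx hX x0).
Qed.

Lemma nc_expected_costE x0 : nc_expected_cost A Bu Bw Q Ru P w x0 = J%:E.
Proof.
apply: integral_ae_cst; first exact: optimal_noncausal_cost_ge0.
apply: filterS disturbance_white => x hx.
exact: (cvg_lim (@ereal_hausdorff R) (nc_average_cost hP hx hX x0)).
Qed.

Lemma known_then_white p (w0 : 'M[R]_(nw, p.+1)) (v : nat -> 'cV[R]_nw) :
  white v -> white (known_then w0 v).
Proof.
apply: (@white_eventually _ _ _ _ p.+1) => t pt.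
by rewrite /known_then leqNgt pt.
Qed.

Section lower_bound.
Context {d' : measure_display} {T' : measurableType d'}.
Variables (Pr' : probability T' R).
Variables (w' : nat -> {RV Pr' >-> 'cV[R]_nw}) (u : nat -> {RV Pr' >-> 'cV[R]_nu}).
Variables (p : nat) (x0 : 'cV[R]_nx) (w0 : 'M[R]_(nw, p.+1)).

Lemma measurable_dist t : measurable_fun [set: T'] (fun om => dist_of w0 w' om t).
Proof.
rewrite /dist_of /known_then; case: (t <= p)%N; first exact: measurable_cst.
exact: measurable_funPT.
Qed.

Lemma measurable_state t :
  measurable_fun [set: T'] (fun om => state_of A Bu Bw x0 w0 w' u om t).
Proof.
elim: t => [|t IH]; first exact: measurable_cst.
apply: measurable_mxD; last exact: (measurable_mxM Bw (measurable_dist t)).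
apply: measurable_mxD; first exact: (measurable_mxM A IH).
by apply: measurable_mxM; exact: measurable_funPT.
Qed.

(** Along t = 2^n the bounded second moments divided by 2^n are summable, so |x_t|^2 / t tends to 0
    there, outside one null set for all e and N. *)
Lemma stabilizing_small_subsequence :
  stabilizing_loop A Bu Bw x0 w0 w' u ->
  {ae Pr', forall om, forall e N, 0 < e ->
    exists2 t, (N <= t)%N & nrm (state_of A Bu Bw x0 w0 w' u om t) <= e * sqrtS t}.
Proof.
move=> [M hM]; pose x om t := state_of A Bu Bw x0 w0 w' u om t.
pose q t om := ((x om t)^T *m x om t) 0 0.
have qE t om : q t om = \sum_i x om t i 0 ^+ 2.
  by rewrite /q mxE; apply: eq_bigr => i _; rewrite mxE expr2.
have q0 t om : 0 <= q t om by rewrite qE; apply: sumr_ge0 => i _; exact: sqr_ge0.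
have mq t : measurable_fun [set: T'] (q t).
  rewrite (_ : q t = fun om => \sum_i x om t i 0 ^+ 2); last exact/funext/qE.
  apply: measurable_sum => i; apply: measurable_funX.
  by apply: measurable_mx_entry; exact: measurable_state.
have /choice [m hm] t : exists m, has_mean Pr' (q t) m /\ m <= M.
  have [m h1 h2] : exists2 m, has_mean Pr' (q t) m & m <= M; last by exists m.
  by apply: has_mean_le_integral => //; rewrite -expectationE; case: (hM t).
have m0 t : 0 <= m t by exact: (has_mean_le (has_mean_cst Pr' 0) (hm t).1 (q0 t)).
have M0 : 0 <= M by apply: le_trans (m0 0%N) (hm 0%N).2.
have hF n := has_meanZ (2^-1 ^+ n) (hm (2 ^ n)%N).1.
have F0 n om : 0 <= 2^-1 ^+ n * q (2 ^ n)%N om by rewrite mulr_ge0// exprn_ge0.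
have sumF n : \sum_(i < n) 2^-1 ^+ i * m (2 ^ i)%N <= (1 - 2^-1)^-1 * M.
  apply: (@le_trans _ _ ((\sum_(i < n) 2^-1 ^+ i) * M)).
    rewrite mulr_suml; apply: ler_sum => i _; apply: ler_wpM2l; last exact: (hm _).2.
    by rewrite exprn_ge0.
  apply: ler_wpM2r => //; apply: geo_sum_le; lra.
have := summable_mean_cvg0 F0 hF sumF; apply: filterS => om hom e N e0.
have e2 : 0 < e ^+ 2 / nx.+1%:R by rewrite divr_gt0// exprn_gt0.
have [n hn] := (cvgn_epsP _ _).1 hom _ e2.
pose k := maxn n N; exists (2 ^ k)%N.
  by apply: leq_trans (ltnW (ltn_expl k (ltnSn 1))); rewrite leq_maxr.
have := hn k (leq_maxl _ _); rewrite subr0 ger0_norm// => h.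
rewrite -(ler_pXn2r (_ : 0 < 2)%N) ?nnegrE ?nrm_ge0 ?mulr_ge0 ?sqrtS_ge0 ?(ltW e0)//.
apply: le_trans (nrm_sqr_le _) _; rewrite -/(x om _) -qE exprMn sqr_sqrtS.
have k0 : 0 < 2 ^+ k :> R by rewrite exprn_gt0.
have {}h : q (2 ^ k)%N om <= e ^+ 2 / nx.+1%:R * 2 ^+ k.
  by rewrite -ler_pdivrMr// mulrC -exprVn.
apply: (@le_trans _ _ (nx%:R * (e ^+ 2 / nx.+1%:R * 2 ^+ k))).
  by apply: ler_wpM2l.
rewrite mulrA; apply: ler_pM; rewrite ?exprn_ge0//.
- by rewrite mulr_ge0// divr_ge0// sqr_ge0.
- rewrite mulrCA ler_piMr ?sqr_ge0// ler_pdivrMr// mul1r ler_nat; exact: leqnSn.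
- by rewrite -natrX ler_nat.
Qed.

Lemma loop_cost_lower_bound : IID w' ->
  (forall t B, measurable B -> distribution Pr' (w' t) B = distribution Pr (w t) B) ->
  stabilizing_loop A Bu Bw x0 w0 w' u ->
  loop_cost_defined A Bu Bw Q Ru x0 w0 w' u ->
  (J%:E <= loop_cost A Bu Bw Q Ru x0 w0 w' u)%E.
Proof.
move=> iid' dw stab cdef.
have [h1 h2] := unit_covariance_means hw.
have white' : {ae Pr', forall om, white (fun t => w' t om)}.
  apply: white_ae => // [a|a b].
    apply: (has_mean_transfer (dw 0%N) (g := fun v : 'cV[R]_nw => v a 0)) => //.
    exact: measurable_entry.
  apply: (has_mean_transfer (dw 0%N) (g := fun v : 'cV[R]_nw => v a 0 * v b 0)) => //.
  by apply: measurable_funM; exact: measurable_entry.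
apply: integral_ae_ge; first exact: optimal_noncausal_cost_ge0.
apply: filterS3 white' (stabilizing_small_subsequence stab) cdef => om wom som com.
have wd : white (dist_of w0 w' om) by exact: known_then_white.
have [psi [_ psi_rec psi_o psi_b]] := noise_summary Bw hP wd.
by apply: (average_cost_lower_bound hP wd psi_rec psi_b psi_o hX _ som com) => t.
Qed.

End lower_bound.
End noncausal_cost.

(** * The preview policy *)

Section random_vectors.
Context {R : realType} {d d' : measure_display} {T : measurableType d} {T' : measurableType d'}.
Variable Pr : probability T R.

Lemma random_variable_of (f : T -> T') : measurable_fun [set: T] f ->
  exists X : {RV Pr >-> T'}, forall x, X x = f x.
Proof.
move=> mf; pose mixin := isMeasurableFun.Build _ _ _ _ f mf.
by exists (HB.pack f mixin : {mfun T >-> T'}).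
Qed.

Lemma has_mean_majorant (r a : R) (b : nat -> T -> R) (m : nat -> R) t :
  (forall s, has_mean Pr (b s) (m s)) ->
  has_mean Pr (fun x => majorant r a (fun s => b s x) t) (majorant r a m t).
Proof.
move=> hb; elim: t => [|t IH] /=; first exact: has_mean_cst.
exact: has_meanD (has_meanZ r IH) (hb t).
Qed.

Lemma majorant_le (r a c : R) (m : nat -> R) t : 0 <= r -> r < 1 -> 0 <= a ->
  (forall s, m s <= c) -> 0 <= c -> majorant r a m t <= a + c / (1 - r).
Proof.
move=> r0 r1 a0 mc c0; have d0 : 0 < 1 - r by rewrite subr_gt0.
have q0 : 0 <= c / (1 - r) by rewrite divr_ge0// ltW.
elim: t => [|t IH] /=; first by rewrite lerDl.
apply: le_trans (lerD (ler_wpM2l r0 IH) (mc t)) _.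
have e : r * (c / (1 - r)) + c = c / (1 - r) by field; apply: lt0r_neq0.
have : r * a <= a by rewrite ler_piMl// ltW.
rewrite mulrDr; lra.
Qed.

End random_vectors.

Section preview_policy.
Context {R : realType} {nx nu nw : nat}.
Variables (A : 'M[R]_nx) (Bu : 'M[R]_(nx, nu)) (Bw : 'M[R]_(nx, nw)).
Variables (Q : 'M[R]_nx) (Ru : 'M[R]_nu) (P : 'M[R]_nx).
Hypotheses (hQ : possemidef Q) (hR : posdef Ru).
Hypothesis hP : stabilizing_solution A Bu Q Ru P.
Context {d : measure_display} {T : measurableType d}.
Variables (Pr : probability T R) (w : nat -> {RV Pr >-> 'cV[R]_nw}).
Hypotheses (hiid : IID w) (hw : zero_mean_unit_covariance w).
Variable X : 'M[R]_nx.
Hypothesis hX : lyapunov A Bu Bw Ru P X.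

Local Notation H := (Hmx Bu Ru P).
Local Notation Kx := (Kx A Bu Ru P).
Local Notation Kw := (Kw Bu Bw Ru P).
Local Notation Kv := (Kv Bu Ru P).
Local Notation Ah := (Ahat A Bu Ru P).
Local Notation J := (optimal_noncausal_cost Bu Bw Ru P X).
Local Notation preview_input p v := (feedback A Bu Bw Ru P (preview_sum A Bu Bw Ru P p v) v).

Variables (p : nat) (x0 : 'cV[R]_nx) (w0 : 'M[R]_(nw, p.+1)).

Local Notation info t := ('M[R]_(nx, t.+1) * 'M[R]_(nw, (t + p).+1))%type.

(** The last column of [i.1] is x_t. The indices given to [inord] are in range because t+k+1 <=
    t+p. *)
Definition preview_law t (i : info t) : 'cV[R]_nu :=
  - (Kx *m col ord_max i.1) - Kw *m col (inord t) i.2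
  - Kv *m \sum_(k < p) Ah^T ^+ k.+1 *m (P *m Bw *m col (inord (t + k.+1)) i.2).

Lemma preview_lawE t (x : nat -> 'cV[R]_nx) (v : nat -> 'cV[R]_nw) :
  preview_law (get_info p x v t) = preview_input p v t (x t).
Proof.
have colE n (z : nat -> 'cV[R]_n) N (j : 'I_N) : col j (prefix_mx z N) = z j.
  by apply/colP => i; rewrite !mxE.
rewrite /preview_law /feedback /get_info/= !colE /= inordK; last lia.
congr (_ - _ - Kv *m _); apply: eq_bigr => k _.
by rewrite colE inordK//; have := ltn_ord k; lia.
Qed.

Lemma measurable_preview_law t : measurable_fun [set: info t] (@preview_law t).
Proof.
have m1 : measurable_fun [set: info t] (fun i : info t => i.1) by exact: measurable_fst.
have m2 : measurable_fun [set: info t] (fun i : info t => i.2) by exact: measurable_snd.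
apply: measurable_mxB.
  apply: measurable_mxB.
    by apply/measurable_mxN/measurable_mxM/measurable_col.
  by apply/measurable_mxM/measurable_col.
apply/measurable_mxM/measurable_mx_sum => k.
by apply/measurable_mxM/measurable_mxM/measurable_col.
Qed.

Definition preview_policy : policy p := fun t => kdirac (@measurable_preview_law t).

Let v om := dist_of w0 w om.
Let x om t := state A Bu Bw (preview_input p (v om)) x0 (v om) t.

(** The kernel is a Dirac mass, so the original probability space carries the loop. The trajectory
    [x] is defined from the disturbance first, and the inputs are read off it. *)
Lemma preview_closed_loop : exists u : nat -> {RV Pr >-> 'cV[R]_nu},
  (forall t om, u t om = preview_input p (v om) t (x om t)) /\
  (forall om t, state_of A Bu Bw x0 w0 w u om t = x om t).
Proof.
have mv t : measurable_fun [set: T] (fun om => v om t) by exact: measurable_dist.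
have mS t : measurable_fun [set: T] (fun om => preview_sum A Bu Bw Ru P p (v om) t).
  by apply: measurable_mx_sum => k; do 2!apply: measurable_mxM.
have mI (y : T -> 'cV[R]_nx) t : measurable_fun [set: T] y ->
    measurable_fun [set: T] (fun om => preview_input p (v om) t (y om)).
  move=> my; apply: measurable_mxB; last exact: measurable_mxM.
  by apply: measurable_mxB; [apply: measurable_mxN|]; exact: measurable_mxM.
have mx t : measurable_fun [set: T] (x^~ t).
  elim: t => [|t IH]; first exact: measurable_cst.
  apply: measurable_mxD; last exact: (measurable_mxM Bw (mv t)).
  apply: measurable_mxD; first exact: (measurable_mxM A IH).
  by apply: measurable_mxM; exact: mI.
have /choice [u uE] t : exists U : {RV Pr >-> 'cV[R]_nu},
    forall om, U om = preview_input p (v om) t (x om t).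
  by apply: random_variable_of; exact: mI.
exists u; split => // om; elim=> [//|t IH].
by rewrite /state_of/= -/(state_of A Bu Bw x0 w0 w u om t) IH uE.
Qed.

Section closed_loop.
Variable u : nat -> {RV Pr >-> 'cV[R]_nu}.
Hypothesis uE : forall t om, u t om = preview_input p (v om) t (x om t).
Hypothesis xE : forall om t, state_of A Bu Bw x0 w0 w u om t = x om t.

(** For a Dirac kernel the integrand is the indicator of u_t in B, so both sides measure the same
    event. *)
Lemma preview_generated : generated_by A Bu Bw preview_policy x0 w0 w u.
Proof.
move=> t N B C mB mC E.
have mE : measurable E.
  have mpair : measurable_fun [set: T] (fun om =>
      (prefix_mx (input_of u om) t, prefix_mx (dist_of w0 w om) N)).
    apply: measurable_fun_pair; apply: measurable_prefix => s.
      exact: measurable_funPT.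
    exact: measurable_dist.
  by rewrite -[E]setTI; exact: mpair.
have muB : measurable (u t @^-1` B).
  by rewrite -[X in measurable X]setTI; exact: measurable_funPT.
rewrite -(integral_indic Pr mE muB); apply: eq_integral => om _.
rewrite /preview_policy /kdirac/= diracE indicE; congr (_%:R%:E).
suff -> : preview_law (get_info p (state_of A Bu Bw x0 w0 w u om) (dist_of w0 w om) t)
   = u t om by [].
by rewrite preview_lawE uE xE.
Qed.

Lemma dist_second_moment t i : exists m,
  has_mean Pr (fun om => v om t i 0 ^+ 2) m /\ m <= 1 + nrm w0 ^+ 2.
Proof.
rewrite /v /dist_of /known_then; case: (t <= p)%N.
  exists ((col (inord t) w0) i 0 ^+ 2); split; first exact: has_mean_cst.
  apply: (@le_trans _ _ (nrm w0 ^+ 2)); last by rewrite lerDr.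
  rewrite mxE -real_normK ?num_real// lerXn2r ?nnegrE ?nrm_ge0//; exact: nrm_entry.
exists 1; split; last by rewrite lerDl sqr_ge0.
have [_ h2] := unit_covariance_means hw.
apply: (has_mean_iid hiid t (g := fun y : 'cV[R]_nw => y i 0 ^+ 2)).
  by apply: measurable_funX; exact: measurable_entry.
by have := h2 i i; rewrite eqxx; under eq_fun do rewrite -expr2.
Qed.

Lemma preview_stabilizing : stabilizing_loop A Bu Bw x0 w0 w u.
Proof.
have [K [r [c [K0 r0 r1 c0 hK]]]] := preview_state_bound Bw hP p.
have /choice [m hm] (ti : nat * 'I_nw) : exists m,
   has_mean Pr (fun om => v om ti.1 ti.2 0 ^+ 2) m /\ m <= 1 + nrm w0 ^+ 2.
  exact: dist_second_moment.
pose b s := c * \sum_(k < p.+1) \sum_i m ((s + k)%N, i).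
have hb s : has_mean Pr (fun om => c * \sum_(k < p.+1) \sum_i v om (s + k)%N i 0 ^+ 2) (b s).
  apply: has_meanZ; apply: has_mean_sum => k; apply: has_mean_sum => i.
  exact: (hm ((s + k)%N, i)).1.
have sum_le n (f : 'I_n -> R) e : (forall i, f i <= e) -> \sum_i f i <= n%:R * e.
  move=> fe; apply: (@le_trans _ _ (\sum_(i < n) e)); first exact: ler_sum.
  by rewrite sumr_const card_ord mulr_natl.
pose C := c * (p.+1%:R * (nw%:R * (1 + nrm w0 ^+ 2))).
have bC s : b s <= C.
  apply: ler_wpM2l => //; apply: (sum_le _) => k; apply: (sum_le _) => i.
  exact: (hm _).2.
have C0 : 0 <= C by rewrite !mulr_ge0// addr_ge0// sqr_ge0.
pose q t om := ((x om t)^T *m x om t) 0 0.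
have qE t om : q t om = \sum_i x om t i 0 ^+ 2.
  by rewrite /q mxE; apply: eq_bigr => i _; rewrite mxE expr2.
have q0 t om : 0 <= q t om by rewrite qE; apply: sumr_ge0 => i _; exact: sqr_ge0.
have q_nrm t om : q t om <= nrm (x om t) ^+ 2.
  rewrite qE expr2 {2}nrm_cV mulr_sumr; apply: ler_sum => i _.
  rewrite -real_normK ?num_real// expr2; apply: ler_wpM2r => //.
  exact: nrm_entry.
have hY t := has_meanZ K (has_mean_majorant r (nrm x0 ^+ 2) t hb).
have qY t om := le_trans (q_nrm t om) (hK x0 (v om) t).
pose M := K * (nrm x0 ^+ 2 + C / (1 - r)).
have YM t : K * majorant r (nrm x0 ^+ 2) b t <= M.
  apply: ler_wpM2l => //; apply: majorant_le => //; rewrite ?sqr_ge0//.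
  exact: ltW.
have mx t i : measurable_fun [set: T] (fun om => x om t i 0).
  have mst := measurable_state A Bu Bw w u x0 w0 t.
  by under eq_fun do rewrite -xE; exact: measurable_mx_entry.
have mq t : measurable_fun [set: T] (q t).
  rewrite (_ : q t = fun om => \sum_i x om t i 0 ^+ 2); last exact/funext/qE.
  by apply: measurable_sum => i; apply: measurable_funX.
have /choice [mu hmu] t : exists m', has_mean Pr (q t) m'.
  apply: (has_mean_dominated (mq t) (hY t)) => om.
  by rewrite ger0_norm//; exact: qY.
have muM t : mu t <= M := le_trans (has_mean_le (hmu t) (hY t) (qY t)) (YM t).
(* M bounds the second moments; the extra 1 covers the first moments through |y| <= 1 + y^2. *)
exists (1 + M) => t; split.
  move=> i; rewrite expectationE; under eq_integral do rewrite xE.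
  have xq om : `|x om t i 0| <= 1 + q t om.
    have : `|x om t i 0| ^+ 2 <= q t om.
      rewrite real_normK ?num_real// qE (bigD1 i)//= lerDl.
      by apply: sumr_ge0 => k _; exact: sqr_ge0.
    move: (q t om) (`|_|) (normr_ge0 (x om t i 0)) => y z z0 zy.
    have := sqr_ge0 (z - 1); nra.
  have h1 := has_meanD (has_mean_cst Pr 1) (hmu t).
  have [e he] := has_mean_dominated (mx t i) h1 xq.
  rewrite he.2 lee_fin ler_norml; apply/andP; split.
    have := has_mean_le (has_meanZ (-1) he) h1 => /(_ _) h2.
    have : -1 * e <= 1 + mu t.
      apply: h2 => om; rewrite mulN1r; apply: le_trans (xq om).
      by rewrite -normrN ler_norm.
    by have := muM t; lra.
  have : e <= 1 + mu t by apply: (has_mean_le he h1) => om; exact: le_trans (ler_norm _) (xq om).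
  by have := muM t; lra.
rewrite expectationE; under eq_integral do rewrite xE.
by rewrite (hmu t).2 lee_fin; have := muM t; lra.
Qed.

Let N := Kv *m Ah^T ^+ p.+1.

Lemma preview_cost_cvg : {ae Pr, forall om,
  average_cost Q Ru (state_of A Bu Bw x0 w0 w u om) (input_of u om) t
    @[t --> \oo] --> (J + \tr (H *m N *m X *m N^T))%:E}.
Proof.
have := disturbance_white hiid hw; apply: filterS => om hom.
have wd : white (v om) by exact: known_then_white.
have h := preview_average_cost (p := p) hP wd hX x0.
rewrite (_ : state_of A Bu Bw x0 w0 w u om = x om); last exact/funext/xE.
rewrite (_ : input_of u om = fun t => preview_input p (v om) t (x om t)); first exact: h.
by apply/funext => t; exact: uE.
Qed.

Lemma preview_cost_defined : loop_cost_defined A Bu Bw Q Ru x0 w0 w u.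
Proof.
have := preview_cost_cvg; apply: filterS => om h.
by apply/cvg_ex; eexists; exact: h.
Qed.

Lemma preview_loop_cost :
  loop_cost A Bu Bw Q Ru x0 w0 w u = (J + \tr (H *m N *m X *m N^T))%:E.
Proof.
apply: integral_ae_cst; last first.
  have := preview_cost_cvg; apply: filterS => om h.
  exact: (cvg_lim (@ereal_hausdorff R) h).
(* Nonnegativity of the constant is again read off one path. *)
rewrite leNgt; apply/negP => J0; apply: (@ae_false _ _ _ Pr).
have := preview_cost_cvg; apply: filterS => om h.
by have := average_cost_lim_ge0 hQ hR h; rewrite leNgt J0.
Qed.

End closed_loop.

Lemma preview_optimal_cost_bounds :
  (J%:E <= preview_optimal_cost A Bu Bw Q Ru w x0 w0 <=
   (J + \tr (H *m (Kv *m Ah^T ^+ p.+1) *m X *m (Kv *m Ah^T ^+ p.+1)^T))%:E)%E.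
Proof.
apply/andP; split.
  apply: le_ereal_inf_tmp => c [K [d' [T' [Pr' [w' [u [iid' dw _ stab [cdef ->]]]]]]]].
  exact: (loop_cost_lower_bound hQ hR hP hiid hw hX iid' dw stab cdef).
apply: ereal_inf_lbound; exists preview_policy.
have [u [uE xE]] := preview_closed_loop.
exists d, T, Pr, w, u; split => //.
- exact: preview_generated.
- exact: preview_stabilizing.
- split; first exact: preview_cost_defined.
  by rewrite (preview_loop_cost uE xE).
Qed.

End preview_policy.

Theorem theorem6 (R : realType) (nx nu nw : nat)
    (A : 'M[R]_nx) (Bu : 'M[R]_(nx, nu)) (Bw : 'M[R]_(nx, nw))
    (Q : 'M[R]_nx) (Ru : 'M[R]_nu) (P : 'M[R]_nx)
    (hA : A \in unitmx)
    (hstab : stabilizable A Bu)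
    (hQ : possemidef Q)
    (hR : posdef Ru)
    (hdet : detectable A Q)
    (hP : stabilizing_solution A Bu Q Ru P)
    (d : measure_display) (T : measurableType d) (Pr : probability T R)
    (w : nat -> {RV Pr >-> 'cV[R]_nw})
    (hiid : IID w)
    (hw : zero_mean_unit_covariance w)
    (x0 : 'cV[R]_nx) (w0 : forall p : nat, 'M[R]_(nw, p.+1)) :
  [/\ nc_cost_defined A Bu Bw Q Ru P w x0,
      exists X : 'M[R]_nx,
        unique (lyapunov A Bu Bw Ru P) X /\
        nc_expected_cost A Bu Bw Q Ru P w x0 =
          (\tr (P *m Bw *m Bw^T)
           - \tr (Hmx Bu Ru P *m Kv Bu Ru P *m X *m (Kv Bu Ru P)^T))%:E
    & preview_optimal_cost A Bu Bw Q Ru w x0 (w0 p) @[p --> \oo]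
        --> nc_expected_cost A Bu Bw Q Ru P w x0].
Proof.
have [X [hX uX]] := lyapunov_unique_solution Bw hP.
have costE := nc_expected_costE hQ hR hP hiid hw hX x0.
split; first exact: (nc_cost_definedP hP hiid hw hX).
  by exists X; split => //; rewrite costE.
rewrite costE; set J := optimal_noncausal_cost _ _ _ _ _.
have J_cvg := preview_excess_cvg0 hP X.
have up : (J + \tr (Hmx Bu Ru P *m (Kv Bu Ru P *m (Ahat A Bu Ru P)^T ^+ p.+1) *m X
    *m (Kv Bu Ru P *m (Ahat A Bu Ru P)^T ^+ p.+1)^T))%:E @[p --> \oo] --> J%:E.
  apply: cvg_EFin; first exact: nearW.
  by have h := cvgD (cvg_cst J) J_cvg; rewrite addr0 in h; exact: h.
(* Neither bound involves [w0 p], so the initial information may vary with p. *)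
apply: (squeeze_cvge _ (cvg_cst J%:E) up); apply: nearW => p.
exact: preview_optimal_cost_bounds.
Qed.
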